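(* For all $\alpha,\nu\in\mathbb C$ and $x>0$, $$\mathbf W_{\alpha,\nu}(x)=\int_{-\infty}^{\infty}e^{\nu s}\,\eta_x(s)\,ds=2\int_0^\infty\cosh(\nu s)\,\eta_x(s)\,ds,$$ where $$\eta_x(s):=2^{-3/2}\pi^{-1/2}x^{-1+2\alpha}\exp\Bigl(\frac1{2x^2}-\frac1{4x^2}\cosh^2\bigl(\tfrac s2\bigr)\Bigr)D_{2\alpha}\Bigl(\frac1x\cosh\bigl(\tfrac s2\bigr)\Bigr),$$ the integrals converging absolutely.
   Context: For $\alpha,\nu\in\mathbb C$ and $x>0$, $\mathbf W_{\alpha,\nu}(x):=2^\alpha x^{2\alpha}e^{1/(4x^2)}W_{\alpha,\nu}\bigl(\tfrac1{2x^2}\bigr)=(2x^2)^{-\frac12+\alpha+\nu}\Psi\bigl(\tfrac12-\alpha-\nu,1-2\nu;\tfrac1{2x^2}\bigr)$, where $W_{\kappa,\mu}$ is the Whittaker function of the second kind and $\Psi$ the Tricomi confluent hypergeometric function. $D_\mu$ denotes the parabolic cylinder function. *)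

(* Defs.v *)
From Stdlib Require Import Reals ClassicalEpsilon.
From Coquelicot Require Import Coquelicot.
Open Scope R_scope.

Definition Cexp (z : C) : C :=
  (exp (Re z) * cos (Im z), exp (Re z) * sin (Im z)).

Definition Ccosh (z : C) : C := ((Cexp z + Cexp (- z)) / 2)%C.

Definition Rcpow (t : R) (a : C) : C := Cexp (a * RtoC (ln t))%C.

(* Characterization of the Tricomi confluent hypergeometric function
   Psi(a,b;.) on (0,oo): the solution of Kummer's equation
   z w'' + (b - z) w' - a w = 0 with w(z) ~ z^{-a} as z -> +oo
   (DLMF 13.2.6 / 13.7.3); this solution exists and is unique. *)
Definition is_Tricomi (a b : C) (f : R -> C) : Prop :=
  (exists f' f'' : R -> C, forall z : R, 0 < z ->
     is_derive f z (f' z) /\ is_derive f' z (f'' z) /\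
     (RtoC z * f'' z + (b - RtoC z) * f' z - a * f z = 0)%C) /\
  filterlim (fun z => (Rcpow z a * f z)%C) (Rbar_locally p_infty) (locally (RtoC 1)).

(* Tricomi function Psi(a,b;z), meaningful for z > 0 *)
Definition Tricomi (a b : C) : R -> C :=
  epsilon (inhabits (fun _ : R => RtoC 0)) (is_Tricomi a b).

(* Parabolic cylinder function D_mu(z) for z > 0, via DLMF 12.7.14:
   D_mu(z) = U(-mu-1/2, z) = 2^{mu/2} e^{-z^2/4} Psi(-mu/2, 1/2; z^2/2). *)
Definition ParCyl (mu : C) (z : R) : C :=
  (Rcpow 2 (mu / 2) * RtoC (exp (- z ^ 2 / 4))
     * Tricomi (- mu / 2) (RtoC (1 / 2)) (z ^ 2 / 2))%C.

Definition Wbold (alpha nu : C) (x : R) : C :=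
  (Rcpow (2 * x ^ 2) (RtoC (- 1 / 2) + alpha + nu)
     * Tricomi (RtoC (1 / 2) - alpha - nu) (RtoC 1 - 2 * nu) (1 / (2 * x ^ 2)))%C.

Definition eta (alpha : C) (x s : R) : C :=
  (RtoC (Rpower 2 (- 3 / 2) * / sqrt PI) * Rcpow x (RtoC (-1) + 2 * alpha)
   * RtoC (exp (1 / (2 * x ^ 2) - 1 / (4 * x ^ 2) * (cosh (s / 2)) ^ 2))
   * ParCyl (2 * alpha) (/ x * cosh (s / 2)))%C.

(* Main.v *)
(** With z = 1/(2x^2), p(s) = sinh^2(s/2) and q(s) = cosh^2(s/2) = 1 + p(s), the claim reads

      z^(-nu) Psi(1/2 - alpha - nu, 1 - 2 nu; z)
        = 1/(2 sqrt pi) int_R e^(nu s) k(z, s) ds,   k(z, s) = e^(-z p(s)) Psi(-alpha, 1/2; z q(s)).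

    Kummer's equation for Psi(-alpha, 1/2; .) makes the kernel satisfy
      z^2 k_zz + z (1 - z) k_z + (alpha - 1/2) z k = k_ss,
    and integrating by parts twice in s turns k_ss into nu^2 k: the right-hand side, multiplied by z^nu,
    solves Kummer's equation with parameters 1/2 - alpha - nu and 1 - 2 nu.  Comparison with the Gaussian
    integral gives its behaviour at infinity, and the solution of Kummer's equation asymptotic to z^(-a) is
    unique.  The function Psi(-alpha, 1/2; .) exists as a Laplace integral for first parameter of large real
    part, and for the others by the relation lowering the first parameter by one. *)

Require Import Defs.
From Stdlib Require Import Reals Lra Lia Psatz ClassicalEpsilon.
From Corelib Require Import ssreflect.
From Coquelicot Require Import Coquelicot.
Open Scope R_scope.

(** * Integrals over the real line *)

(** [Tricomi] is an [epsilon] choice, so its values say nothing until a solution with the prescribed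
    asymptotics is exhibited and shown unique: existence is needed already for the D inside [eta],
    uniqueness for recognising the integral. Uniqueness rests on the fact that an independent
    solution grows like e^z z^(a-b). The Laplace integral must be divided by Gamma(a), whose
    non-vanishing is proved only when Re a is large against (Im a)^2; the lowering relation then
    reaches every parameter. That relation involves the derivative, so the limit of z^a w' travels
    with that of z^a w. All convergence and differentiation questions are settled by one majorant K
    e^(-|s|). The kernel obeys it because sinh^2(s/2) >= s^2/4: the resulting Gaussian absorbs e^(nu
    s), powers of cosh(s/2) and the polynomial growth of Psi. For large z the mass sits at |s| of
    order 1/sqrt z. There z^(1/2-alpha) k(z, s) is close to sqrt z e^(-z p), and inserting the
    harmless factor cosh(s/2) makes the comparison integral exactly 2 sqrt pi, whence the constant
    1/(2 sqrt pi). *)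

Notation is_lint f l := (is_RInt_gen f (Rbar_locally m_infty) (Rbar_locally p_infty) l).

(** A single [M] replaces the two filters at the endpoints, and continuity makes [RInt] a true
    integral on every compact interval. [M] may be negative, so [a <= b] is not implied. *)
Lemma is_lint_eps (f : R -> R) (l : R) :
  (forall x, continuous f x) ->
  is_lint f l <->
  (forall eps : posreal, exists M, forall a b, a < - M -> M < b ->
     Rabs (RInt f a b - l) < eps).
Proof.
intros Hc.
assert (Hex : forall a b, ex_RInt f a b)
  by (intros; apply (ex_RInt_continuous (V := R_CompleteNormedModule)); auto).
split.
- intros H eps.
  destruct (H (ball l eps) (locally_ball l eps)) as [P Q [M1 H1] [M2 H2] HPQ].
  exists (Rmax (Rabs M1) (Rabs M2)). intros a b Ha Hb.
  assert (HM1 := Rmax_l (Rabs M1) (Rabs M2)).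
  assert (HM2 := Rmax_r (Rabs M1) (Rabs M2)).
  destruct (HPQ a b) as [y [Hy1 Hy2]].
  + apply H1. assert (H3 := Rabs_maj2 M1). lra.
  + apply H2. assert (H3 := Rle_abs M2). lra.
  + simpl in Hy1. rewrite (is_RInt_unique _ _ _ _ Hy1). apply Hy2.
- intros H P [eps HP].
  destruct (H eps) as [M HM].
  exists (fun a => a < - M) (fun b => M < b).
  + exists (- M). auto.
  + exists M. auto.
  + intros a b Ha Hb. exists (RInt f a b). split.
    * apply (RInt_correct (V := R_CompleteNormedModule)). apply Hex.
    * apply HP. apply (HM a b Ha Hb).
Qed.

(** Cauchy criterion: moving an endpoint changes the integral of [f] by no more than it changes that
    of [g], and the integrals of [g] converge. *)
Lemma ex_lint_dominated (f g : R -> R) (I : R) :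
  (forall x, continuous f x) -> (forall x, continuous g x) ->
  (forall x, Rabs (f x) <= g x) -> is_lint g I ->
  exists l, is_lint f l.
Proof.
intros Hf Hg Hfg HI.
assert (Hexf : forall a b, ex_RInt f a b)
  by (intros; apply (ex_RInt_continuous (V := R_CompleteNormedModule)); auto).
assert (Hexg : forall a b, ex_RInt g a b)
  by (intros; apply (ex_RInt_continuous (V := R_CompleteNormedModule)); auto).
move: (proj1 (is_lint_eps g I Hg) HI) => {}HI.
(* The absolute values stand outside both integrals so that the bound holds for either order of the
   endpoints; those compared below come in no fixed order. *)
assert (Hle : forall a b, Rabs (RInt f a b) <= Rabs (RInt g a b)).
{ assert (H0 : forall a b, a <= b -> Rabs (RInt f a b) <= RInt g a b).
  { intros a b Hab. refine (norm_RInt_le f g a b _ _ Hab (fun x _ => Hfg x) _ _).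
    - apply (RInt_correct (V := R_CompleteNormedModule)); auto.
    - apply (RInt_correct (V := R_CompleteNormedModule)); auto. }
  intros a b. destruct (Rle_dec a b) as [h|h].
  - apply (Rle_trans _ _ _ (H0 a b h)). apply Rle_abs.
  - assert (h' : b <= a) by lra. specialize (H0 b a h').
    rewrite -(opp_RInt_swap (V := R_CompleteNormedModule) f b a); [|by auto..].
    rewrite -(opp_RInt_swap (V := R_CompleteNormedModule) g b a); [|by auto..].
    unfold opp; simpl. rewrite !Rabs_Ropp.
    apply (Rle_trans _ _ _ H0). apply Rle_abs. }
assert (HH : exists l : R, filterlim (fun ab : R * R => RInt f (fst ab) (snd ab))
     (filter_prod (Rbar_locally m_infty) (Rbar_locally p_infty)) (locally l)).
{ apply (filterlim_locally_cauchy (U := R_CompleteSpace)).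
  intros eps.
  assert (He : 0 < eps / 4) by (destruct eps; simpl; lra).
  destruct (HI (mkposreal _ He)) as [M HM]. simpl in HM.
  exists (fun ab => fst ab < - M /\ M < snd ab). split.
  - exists (fun a => a < - M) (fun b => M < b).
    + exists (- M); auto.
    + exists M; auto.
    + simpl; auto.
  - intros [a b] [a' b'] [h1 h2] [h3 h4]. simpl in *.
    change (Rabs (RInt f a' b' - RInt f a b) < eps).
    rewrite -(RInt_Chasles (V := R_CompleteNormedModule) f a' a b'); [|by auto..].
    rewrite -(RInt_Chasles (V := R_CompleteNormedModule) f a b b'); [|by auto..].
    assert (E1 := Hle a' a). assert (E2 := Hle b b').
    assert (E3 := HM a b h1 h2). assert (E4 := HM a' b h3 h2).
    assert (E5 := HM a b' h1 h4).
    rewrite -(RInt_Chasles (V := R_CompleteNormedModule) g a' a b) in E4; [|by auto..].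
    rewrite -(RInt_Chasles (V := R_CompleteNormedModule) g a b b') in E5; [|by auto..].
    unfold plus in *; simpl in *.
    set (fa := RInt f a' a) in *. set (fb := RInt f b b') in *.
    set (ga := RInt g a' a) in *. set (gb := RInt g b b') in *.
    set (gg := RInt g a b) in *. set (ff := RInt f a b).
    (* [ga] and [gb] are differences of two integrals of [g], each within eps/4 of [I]. *)
    assert (Rabs ga < eps / 2) by (revert E3 E4; split_Rabs; lra).
    assert (Rabs gb < eps / 2) by (revert E3 E5; split_Rabs; lra).
    replace (fa + (ff + fb) - ff) with (fa + fb) by ring.
    apply Rle_lt_trans with (1 := Rabs_triang _ _). lra. }
destruct HH as [l Hl]. exists l.
apply (proj2 (is_lint_eps f l Hf)). intros eps.
destruct (Hl (ball l eps) (locally_ball l eps)) as [P Q [M1 H1] [M2 H2] HPQ].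
exists (Rmax (Rabs M1) (Rabs M2)). intros a b Ha Hb.
assert (HM1 := Rmax_l (Rabs M1) (Rabs M2)).
assert (HM2 := Rmax_r (Rabs M1) (Rabs M2)).
apply (HPQ a b).
- apply H1. assert (H3 := Rabs_maj2 M1). lra.
- apply H2. assert (H3 := Rle_abs M2). lra.
Qed.

Lemma is_lint_antiderivative (F f : R -> R) (la lb : R) :
  (forall x, is_derive F x (f x)) -> (forall x, continuous f x) ->
  filterlim F (Rbar_locally m_infty) (locally la) ->
  filterlim F (Rbar_locally p_infty) (locally lb) ->
  is_lint f (lb - la).
Proof.
intros HF Hf Ha Hb.
assert (HD : forall x, Derive F x = f x) by (intros; apply is_derive_unique, HF).
assert (Hall : filter_prod (Rbar_locally m_infty) (Rbar_locally p_infty)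
   (fun _ : R * R => True)) by apply filter_true.
apply (is_RInt_gen_ext (Derive F)).
- apply: filter_imp Hall. intros; apply HD.
- apply is_RInt_gen_Derive; auto.
  + apply: filter_imp Hall. intros; eexists; apply HF.
  + apply: filter_imp Hall. intros. apply (continuous_ext f); auto.
Qed.

Lemma is_lint_subst (f g dg : R -> R) (l : R) :
  (forall x, continuous f x) ->
  (forall x, is_derive g x (dg x)) -> (forall x, continuous dg x) ->
  filterlim g (Rbar_locally m_infty) (Rbar_locally m_infty) ->
  filterlim g (Rbar_locally p_infty) (Rbar_locally p_infty) ->
  is_lint f l -> is_lint (fun x => dg x * f (g x)) l.
Proof.
intros Hf Hg Hdg Hm Hp H.
assert (Hgc : forall x, continuous g x).
{ intros x. apply (ex_derive_continuous (V := R_NormedModule)). eexists; apply Hg. }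
assert (Hc : forall x, continuous (fun x => dg x * f (g x)) x).
{ intros x. apply (continuous_mult (K := R_AbsRing)); auto.
  apply continuous_comp; auto. }
move: (proj1 (is_lint_eps f l Hf) H) => {}H.
apply (proj2 (is_lint_eps _ l Hc)).
intros eps. destruct (H eps) as [M HM].
destruct (Hm (fun y => y < - M)) as [M1 H1]. { exists (-M); auto. }
destruct (Hp (fun y => M < y)) as [M2 H2]. { exists M; auto. }
exists (Rmax (Rabs M1) (Rabs M2)). intros a b Ha Hb.
assert (HM1 := Rmax_l (Rabs M1) (Rabs M2)).
assert (HM2 := Rmax_r (Rabs M1) (Rabs M2)).
rewrite (is_RInt_unique (V := R_CompleteNormedModule) _ a b (RInt f (g a) (g b))).
- apply HM; [apply H1 | apply H2].
  + assert (H3 := Rabs_maj2 M1). lra.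
  + assert (H3 := Rle_abs M2). lra.
- apply (is_RInt_comp (V := R_CompleteNormedModule) f g dg); auto.
Qed.

Lemma is_lint_shift (f : R -> R) (c l : R) :
  (forall x, continuous f x) ->
  is_lint f l -> is_lint (fun x => f (x + c)) l.
Proof.
intros Hf H.
apply (is_RInt_gen_ext (fun x => 1 * f (x + c))).
- apply: filter_imp (filter_true). intros; apply Rmult_1_l.
- apply (is_lint_subst f (fun x => x + c) (fun _ => 1)); auto.
  + intros x. auto_derive; auto.
  + intros x. apply continuous_const.
  + intros P [M HP]. exists (M - c). intros x hx. apply HP. lra.
  + intros P [M HP]. exists (M - c). intros x hx. apply HP. lra.
Qed.

Lemma is_lint_unique (f : R -> R) (l1 l2 : R) :
  is_lint f l1 -> is_lint f l2 -> l1 = l2.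
Proof.
intros H1 H2.
rewrite -(is_RInt_gen_unique (V := R_CompleteNormedModule) f l1 H1).
apply (is_RInt_gen_unique (V := R_CompleteNormedModule) f l2 H2).
Qed.

Lemma is_lint_ext (f g : R -> R) (l : R) :
  (forall x, f x = g x) -> is_lint f l -> is_lint g l.
Proof.
intros H. apply is_RInt_gen_ext. apply: filter_imp (filter_true). intros; apply H.
Qed.

Lemma is_lint_le (f g : R -> R) (l1 l2 : R) :
  (forall x, continuous f x) -> (forall x, continuous g x) ->
  (forall x, f x <= g x) -> is_lint f l1 -> is_lint g l2 -> l1 <= l2.
Proof.
intros Hf Hg Hfg H1 H2.
move: (proj1 (is_lint_eps f l1 Hf) H1) => {}H1.
move: (proj1 (is_lint_eps g l2 Hg) H2) => {}H2.
apply Rnot_lt_le. intros Hl.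
assert (He : 0 < (l1 - l2) / 2) by lra.
destruct (H1 (mkposreal _ He)) as [M1 HM1].
destruct (H2 (mkposreal _ He)) as [M2 HM2]. simpl in *.
set (M := Rmax (Rmax M1 M2) 0).
assert (M1 <= M /\ M2 <= M /\ 0 <= M).
{ unfold M. repeat split.
  - apply Rle_trans with (Rmax M1 M2); apply Rmax_l.
  - apply Rle_trans with (Rmax M1 M2); [apply Rmax_r | apply Rmax_l].
  - apply Rmax_r. }
assert (E1 := HM1 (- M - 1) (M + 1) ltac:(lra) ltac:(lra)).
assert (E2 := HM2 (- M - 1) (M + 1) ltac:(lra) ltac:(lra)).
assert (E3 : RInt f (- M - 1) (M + 1) <= RInt g (- M - 1) (M + 1)).
{ apply RInt_le.
  - lra.
  - apply (ex_RInt_continuous (V := R_CompleteNormedModule)); auto.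
  - apply (ex_RInt_continuous (V := R_CompleteNormedModule)); auto.
  - auto. }
revert E1 E2. split_Rabs; lra.
Qed.

(** * Complex-valued functions of a real variable *)

(** Taken componentwise so that the real rules and [auto_derive] apply; [Cder_is_derive] and
    [is_derive_Cder] link it to the derivative used in [is_Tricomi]. *)
Definition Cder (f : R -> C) (x : R) (l : C) : Prop :=
  is_derive (fun t => Re (f t)) x (Re l) /\ is_derive (fun t => Im (f t)) x (Im l).

Definition Ccont (f : R -> C) (x : R) : Prop :=
  continuous (fun t => Re (f t)) x /\ continuous (fun t => Im (f t)) x.

Lemma Cmod_le_abs (z : C) : Cmod z <= Rabs (Re z) + Rabs (Im z).
Proof.
destruct z as [a b]. unfold Cmod; simpl.
assert (Ha := Rabs_pos a). assert (Hb := Rabs_pos b).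
apply Rle_trans with (sqrt ((Rabs a + Rabs b) * (Rabs a + Rabs b))).
- apply sqrt_le_1_alt. assert (E1 := Rsqr_abs a). assert (E2 := Rsqr_abs b).
  unfold Rsqr in *. nra.
- rewrite sqrt_square; lra.
Qed.

Lemma Im_le_Cmod (z : C) : Rabs (Im z) <= Cmod z.
Proof. apply Rle_trans with (2 := Rmax_Cmod z). apply Rmax_r. Qed.

Lemma Cder_is_derive (f : R -> C) (x : R) (l : C) :
  Cder f x l -> is_derive f x l.
Proof.
intros [H1 H2]. destruct l as [l1 l2]. simpl in *.
apply (filterdiff_ext (fun t : R => (Re (f t), Im (f t)))).
{ intros t. symmetry. apply surjective_pairing. }
apply (filterdiff_ext_lin _ (fun h : R => (scal h l1, scal h l2))).
2: reflexivity.
apply (filterdiff_comp_2 (fun t => Re (f t)) (fun t => Im (f t)) (fun a b => (a, b) : C)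
  (fun h => scal h l1) (fun h => scal h l2) (fun a b => (a, b) : C)); auto.
apply (filterdiff_ext (fun u : R * R => u)); [by intros []|].
apply (filterdiff_ext_lin _ (fun u : R * R => u)); [|by intros []].
apply filterdiff_id.
Qed.

Lemma is_derive_Cder (f : R -> C) (x : R) (l : C) :
  is_derive f x l -> Cder f x l.
Proof.
intros H. split.
- apply (filterdiff_ext_lin _ (fun h : R => fst (scal h l : C))); [|by intros].
  apply (filterdiff_comp' f (fun u : C => fst u) x (fun h => scal h l) (fun u : C => fst u)); auto.
  apply filterdiff_linear. apply is_linear_fst.
- apply (filterdiff_ext_lin _ (fun h : R => snd (scal h l : C))); [|by intros].
  apply (filterdiff_comp' f (fun u : C => snd u) x (fun h => scal h l) (fun u : C => snd u)); auto.
  apply filterdiff_linear. apply is_linear_snd.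
Qed.

Lemma Cder_eq (f : R -> C) (x : R) (l l' : C) : Cder f x l -> l = l' -> Cder f x l'.
Proof. by intros H <-. Qed.

Lemma Cder_ext (f g : R -> C) (x : R) (l : C) :
  (forall t, f t = g t) -> Cder f x l -> Cder g x l.
Proof.
intros E [H1 H2]; split.
- apply (is_derive_ext (fun t => Re (f t))); auto. intros; by rewrite E.
- apply (is_derive_ext (fun t => Im (f t))); auto. intros; by rewrite E.
Qed.

Lemma Cder_ext_loc (f g : R -> C) (x : R) (l : C) :
  locally x (fun t => f t = g t) -> Cder f x l -> Cder g x l.
Proof.
intros E [H1 H2]; split.
- apply (is_derive_ext_loc (fun t => Re (f t))); auto.
  apply: filter_imp E. intros; by rewrite H.
- apply (is_derive_ext_loc (fun t => Im (f t))); auto.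
  apply: filter_imp E. intros; by rewrite H.
Qed.

Lemma Cder_const (c : C) (x : R) : Cder (fun _ => c) x 0.
Proof. split; apply (is_derive_const (V := R_NormedModule)). Qed.

Lemma Cder_RtoC (h : R -> R) (x d : R) :
  is_derive h x d -> Cder (fun t => RtoC (h t)) x (RtoC d).
Proof. intros H. split; auto.
change (is_derive (fun _ : R => 0) x 0). apply (is_derive_const (V := R_NormedModule)). Qed.

Lemma Cder_plus (f g : R -> C) (x : R) (l m : C) :
  Cder f x l -> Cder g x m -> Cder (fun t => f t + g t)%C x (l + m)%C.
Proof.
intros [H1 H2] [H3 H4]; split; simpl.
- apply (is_derive_plus (V := R_NormedModule)); auto.
- apply (is_derive_plus (V := R_NormedModule)); auto.
Qed.

Lemma is_derive_Rmult (f g : R -> R) (x l m : R) :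
  is_derive f x l -> is_derive g x m -> is_derive (fun t => f t * g t) x (l * g x + f x * m).
Proof.
intros H1 H2. apply (is_derive_mult (K := R_AbsRing) f g x l m); auto. intros; apply Rmult_comm.
Qed.

Lemma is_derive_Rplus (f g : R -> R) (x l m : R) :
  is_derive f x l -> is_derive g x m -> is_derive (fun t => f t + g t) x (l + m).
Proof. apply (is_derive_plus (V := R_NormedModule)). Qed.

Lemma is_derive_Rminus (f g : R -> R) (x l m : R) :
  is_derive f x l -> is_derive g x m -> is_derive (fun t => f t - g t) x (l - m).
Proof. apply (is_derive_minus (V := R_NormedModule)). Qed.

Lemma Cder_mult (f g : R -> C) (x : R) (l m : C) :
  Cder f x l -> Cder g x m -> Cder (fun t => f t * g t)%C x (l * g x + f x * m)%C.
Proof.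
intros [H1 H2] [H3 H4]; split.
- change (is_derive (fun t => Re (f t) * Re (g t) - Im (f t) * Im (g t)) x (Re (l * g x + f x * m)%C)).
  replace (Re (l * g x + f x * m)%C) with
    ((Re l * Re (g x) + Re (f x) * Re m) - (Im l * Im (g x) + Im (f x) * Im m))
    by (rewrite /Re /Im /=; ring).
  apply is_derive_Rminus; apply is_derive_Rmult; auto.
- change (is_derive (fun t => Re (f t) * Im (g t) + Im (f t) * Re (g t)) x (Im (l * g x + f x * m)%C)).
  replace (Im (l * g x + f x * m)%C) with
    ((Re l * Im (g x) + Re (f x) * Im m) + (Im l * Re (g x) + Im (f x) * Re m))
    by (rewrite /Re /Im /=; ring).
  apply is_derive_Rplus; apply is_derive_Rmult; auto.
Qed.

Lemma Cder_scal (c : C) (f : R -> C) (x : R) (l : C) :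
  Cder f x l -> Cder (fun t => c * f t)%C x (c * l)%C.
Proof.
intros H. eapply Cder_eq. { apply Cder_mult; [apply Cder_const|apply H]. } cbv beta; ring.
Qed.

Lemma Cder_minus (f g : R -> C) (x : R) (l m : C) :
  Cder f x l -> Cder g x m -> Cder (fun t => f t - g t)%C x (l - m)%C.
Proof.
intros H1 H2.
apply (Cder_ext (fun t => f t + (-(1)) * g t)%C). { intros; ring. }
eapply Cder_eq. { apply Cder_plus; [apply H1|apply Cder_scal, H2]. } ring.
Qed.

Lemma Cder_comp (f : R -> C) (h : R -> R) (x d : R) (l : C) :
  Cder f (h x) l -> is_derive h x d -> Cder (fun t => f (h t)) x (RtoC d * l)%C.
Proof.
intros [H1 H2] Hh; split.
- replace (Re (RtoC d * l)%C) with (scal d (Re l)).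
  + apply (is_derive_comp (fun t => Re (f t)) h); auto.
  + rewrite /scal /= /mult /=. rewrite /Re; ring.
- replace (Im (RtoC d * l)%C) with (scal d (Im l)).
  + apply (is_derive_comp (fun t => Im (f t)) h); auto.
  + rewrite /scal /= /mult /=. rewrite /Im; ring.
Qed.

Lemma Cder_Cexp (a : C) (t : R) :
  Cder (fun t => Cexp (a * RtoC t)%C) t (a * Cexp (a * RtoC t))%C.
Proof.
destruct a as [a b]; split; rewrite /Cexp /=.
- auto_derive; auto. rewrite /Re /Im /Rminus /=. ring.
- auto_derive; auto. rewrite /Re /Im /Rminus /=. ring.
Qed.

(** This is the real part of 1/(u + i v). Exchanging [u] and [v] and changing the sign gives the
    imaginary part, so one computation serves both components of [Cder_inv]. *)
Lemma is_derive_Cinv_parts (u v : R -> R) (x l m : R) :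
  u x ^ 2 + v x ^ 2 <> 0 -> is_derive u x l -> is_derive v x m ->
  is_derive (fun t => u t / (u t ^ 2 + v t ^ 2)) x
    ((l * (v x ^ 2 - u x ^ 2) - 2 * u x * v x * m) / (u x ^ 2 + v x ^ 2) ^ 2).
Proof.
intros Hn H1 H2.
auto_derive. { repeat split; auto; eexists; eassumption. }
rewrite (is_derive_unique (fun t => u t) _ _ H1) (is_derive_unique (fun t => v t) _ _ H2).
field. contradict Hn. rewrite -Hn. ring.
Qed.

Lemma Cder_inv (f : R -> C) (x : R) (l : C) :
  f x <> 0%C -> Cder f x l -> Cder (fun t => / f t)%C x (- l / (f x * f x))%C.
Proof.
intros Hn [H1 H2].
assert (Hn' : Re (f x) ^ 2 + Im (f x) ^ 2 <> 0).
{ rewrite -Cmod2_alt. apply pow_nonzero. intros E. apply Hn. by apply Cmod_eq_0. }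
(* The squared modulus of (u + i v)^2, in the expanded shape in which [field] asks for its
   non-vanishing. *)
assert (Hs : forall u v : R, u ^ 2 + v ^ 2 <> 0 ->
  (u * u - v * v) * ((u * u - v * v) * 1) + (u * v + v * u) * ((u * v + v * u) * 1) <> 0).
{ intros u v Huv.
  replace (_ + _) with ((u ^ 2 + v ^ 2) ^ 2) by ring. by apply pow_nonzero. }
split.
- eapply (is_derive_ext (fun t => Re (f t) / (Re (f t) ^ 2 + Im (f t) ^ 2))); [by []|].
  eapply (eq_ind _ (fun d => is_derive _ x d)).
  { apply (is_derive_Cinv_parts (fun t => Re (f t)) (fun t => Im (f t))); eassumption. }
  destruct (f x) as [u v]. destruct l as [l1 l2]. rewrite /Re /Im /= in Hn' |- *.
  specialize (Hs u v Hn'). field. split; try exact Hs; contradict Hn'; lra.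
- eapply (is_derive_ext (fun t => - (Im (f t) / (Im (f t) ^ 2 + Re (f t) ^ 2)))).
  { intros t. rewrite /Re /Im /=. rewrite (Rplus_comm (snd (f t) * _)). by rewrite /Rdiv -Ropp_mult_distr_l. }
  eapply (eq_ind _ (fun d => is_derive _ x d)).
  { apply (is_derive_opp (V := R_NormedModule)).
    apply (is_derive_Cinv_parts (fun t => Im (f t)) (fun t => Re (f t))); try eassumption. by rewrite Rplus_comm. }
  destruct (f x) as [u v]. destruct l as [l1 l2]. rewrite /Re /Im /opp /= in Hn' |- *.
  specialize (Hs u v Hn'). field. repeat split; try exact Hs; contradict Hn'; lra.
Qed.

Lemma Cder_Ccont (f : R -> C) (x : R) (l : C) : Cder f x l -> Ccont f x.
Proof.
intros [H1 H2]; split; apply (ex_derive_continuous (V := R_NormedModule)); eexists; eassumption.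
Qed.

Lemma Ccont_ext (f g : R -> C) (x : R) : (forall t, f t = g t) -> Ccont f x -> Ccont g x.
Proof.
intros E [H1 H2]; split.
- apply (continuous_ext (fun t => Re (f t))); auto. intros; by rewrite E.
- apply (continuous_ext (fun t => Im (f t))); auto. intros; by rewrite E.
Qed.

Lemma Ccont_const (c : C) (x : R) : Ccont (fun _ => c) x.
Proof. split; apply continuous_const. Qed.

Lemma Ccont_RtoC (h : R -> R) (x : R) : continuous h x -> Ccont (fun t => RtoC (h t)) x.
Proof.
intros H; split; auto. change (continuous (fun _ : R => 0) x). apply continuous_const.
Qed.

Lemma Ccont_plus (f g : R -> C) (x : R) :
  Ccont f x -> Ccont g x -> Ccont (fun t => f t + g t)%C x.
Proof.
intros [H1 H2] [H3 H4]; split; simpl.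
- apply (continuous_plus (V := R_NormedModule)); auto.
- apply (continuous_plus (V := R_NormedModule)); auto.
Qed.

Lemma Ccont_mult (f g : R -> C) (x : R) :
  Ccont f x -> Ccont g x -> Ccont (fun t => f t * g t)%C x.
Proof.
intros [H1 H2] [H3 H4]; split; simpl.
- apply (continuous_minus (V := R_NormedModule)
    (fun t => Re (f t) * Re (g t)) (fun t => Im (f t) * Im (g t)));
  apply (continuous_mult (K := R_AbsRing)); auto.
- apply (continuous_plus (V := R_NormedModule)
    (fun t => Re (f t) * Im (g t)) (fun t => Im (f t) * Re (g t)));
  apply (continuous_mult (K := R_AbsRing)); auto.
Qed.

Lemma Ccont_minus (f g : R -> C) (x : R) :
  Ccont f x -> Ccont g x -> Ccont (fun t => f t - g t)%C x.
Proof.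
intros H1 H2. apply (Ccont_ext (fun t => f t + (-(1)) * g t)%C). { intros; ring. }
apply Ccont_plus; auto. apply Ccont_mult; auto. apply Ccont_const.
Qed.

Lemma Ccont_comp (f : R -> C) (h : R -> R) (x : R) :
  Ccont f (h x) -> continuous h x -> Ccont (fun t => f (h t)) x.
Proof.
intros [H1 H2] Hh. split.
- exact (continuous_comp h (fun y => Re (f y)) x Hh H1).
- exact (continuous_comp h (fun y => Im (f y)) x Hh H2).
Qed.

Lemma Ccont_Cmod (f : R -> C) (x : R) : Ccont f x -> continuous (fun t => Cmod (f t)) x.
Proof.
intros [H1 H2]. unfold Cmod.
apply (continuous_comp (fun t => fst (f t) ^ 2 + snd (f t) ^ 2) sqrt).
- apply (continuous_plus (V := R_NormedModule) (fun t => fst (f t) ^ 2) (fun t => snd (f t) ^ 2)).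
  + apply (continuous_ext (fun t => Re (f t) * Re (f t))). { intros t; rewrite /Re. cbv beta. simpl; ring. }
    apply (continuous_mult (K := R_AbsRing)); auto.
  + apply (continuous_ext (fun t => Im (f t) * Im (f t))). { intros t; rewrite /Im. simpl; ring. }
    apply (continuous_mult (K := R_AbsRing)); auto.
- apply continuous_sqrt.
Qed.

(** The mean value inequality is used on the real and imaginary parts separately, which costs the
    factor 2. *)
Lemma Cmod_bounded_variation (h dh : R -> C) (D x y : R) :
  (forall t, Rabs (t - x) <= Rabs (y - x) -> Cder h t (dh t) /\ Cmod (dh t) <= D) ->
  Cmod (h y - h x) <= 2 * D * Rabs (y - x).
Proof.
intros H.
assert (H1 : Rabs (Re (h y) - Re (h x)) <= D * Rabs (y - x)).
{ apply (bounded_variation (fun t => Re (h t)) (fun t => Re (dh t))).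
  intros t ht. destruct (H t ht) as [[h1 h2] h3]. split; auto.
  apply Rle_trans with (2 := h3). apply re_le_Cmod. }
assert (H2 : Rabs (Im (h y) - Im (h x)) <= D * Rabs (y - x)).
{ apply (bounded_variation (fun t => Im (h t)) (fun t => Im (dh t))).
  intros t ht. destruct (H t ht) as [[h1 h2] h3]. split; auto.
  apply Rle_trans with (2 := h3). apply Im_le_Cmod. }
apply Rle_trans with (1 := Cmod_le_abs _). rewrite /Re /Im /= in H1 H2 |- *.
unfold Rminus in *. lra.
Qed.

(** * Integrals of complex-valued functions over the line *)

Definition is_clint (f : R -> C) (l : C) : Prop :=
  is_lint (fun t => Re (f t)) (Re l) /\ is_lint (fun t => Im (f t)) (Im l).

Definition CInt (f : R -> C) : C :=
  (RInt_gen (fun t => Re (f t)) (Rbar_locally m_infty) (Rbar_locally p_infty),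
   RInt_gen (fun t => Im (f t)) (Rbar_locally m_infty) (Rbar_locally p_infty)).

Lemma is_clint_CInt (f : R -> C) (l : C) : is_clint f l -> CInt f = l.
Proof.
intros [H1 H2]. destruct l as [l1 l2]. unfold CInt. f_equal.
- apply (is_RInt_gen_unique (V := R_CompleteNormedModule)), H1.
- apply (is_RInt_gen_unique (V := R_CompleteNormedModule)), H2.
Qed.

Lemma is_clint_dominated (f : R -> C) (g : R -> R) (I : R) :
  (forall x, Ccont f x) -> (forall x, continuous g x) ->
  (forall x, Cmod (f x) <= g x) -> is_lint g I -> is_clint f (CInt f).
Proof.
intros Hf Hg Hfg HI.
destruct (ex_lint_dominated (fun t => Re (f t)) g I) as [l1 H1]; auto.
{ intros u; exact (proj1 (Hf u)). } { intros; apply Rle_trans with (2 := Hfg x), re_le_Cmod. }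
destruct (ex_lint_dominated (fun t => Im (f t)) g I) as [l2 H2]; auto.
{ intros u; exact (proj2 (Hf u)). } { intros; apply Rle_trans with (2 := Hfg x), Im_le_Cmod. }
by rewrite (is_clint_CInt f (l1, l2)).
Qed.

Lemma is_clint_bound (f : R -> C) (g : R -> R) (l : C) (I : R) :
  (forall x, Ccont f x) -> (forall x, continuous g x) ->
  (forall x, Cmod (f x) <= g x) -> is_lint g I -> is_clint f l -> Cmod l <= 2 * I.
Proof.
intros Hf Hg Hfg HI [H1 H2].
assert (Hg' : forall x, continuous (fun x => - g x) x).
{ intros x. apply (continuous_opp (V := R_NormedModule)); auto. }
assert (HI' : is_lint (fun x => - g x) (- I)) by (apply (is_RInt_gen_opp (V := R_NormedModule)); auto).
assert (B1 : Re l <= I).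
{ apply (is_lint_le (fun t => Re (f t)) g); auto. { intros u; exact (proj1 (Hf u)). }
  intros x. apply Rle_trans with (2 := Hfg x), Rle_trans with (2 := re_le_Cmod _), Rle_abs. }
assert (B2 : Im l <= I).
{ apply (is_lint_le (fun t => Im (f t)) g); auto. { intros u; exact (proj2 (Hf u)). }
  intros x. apply Rle_trans with (2 := Hfg x), Rle_trans with (2 := Im_le_Cmod _), Rle_abs. }
assert (B3 : - I <= Re l).
{ apply (is_lint_le (fun x => - g x) (fun t => Re (f t))); auto. { intros u; exact (proj1 (Hf u)). }
  intros x. assert (E := Rabs_maj2 (Re (f x))). assert (E1 := re_le_Cmod (f x)). specialize (Hfg x). lra. }
assert (B4 : - I <= Im l).
{ apply (is_lint_le (fun x => - g x) (fun t => Im (f t))); auto. { intros u; exact (proj2 (Hf u)). }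
  intros x. assert (E := Rabs_maj2 (Im (f x))). assert (E1 := Im_le_Cmod (f x)). specialize (Hfg x). lra. }
apply Rle_trans with (1 := Cmod_le_abs l). split_Rabs; lra.
Qed.

Lemma is_clint_ext (f g : R -> C) (l : C) :
  (forall x, f x = g x) -> is_clint f l -> is_clint g l.
Proof.
intros E [H1 H2]; split.
- apply (is_lint_ext (fun t => Re (f t))); auto. intros; by rewrite E.
- apply (is_lint_ext (fun t => Im (f t))); auto. intros; by rewrite E.
Qed.

Lemma is_clint_plus (f g : R -> C) (l m : C) :
  is_clint f l -> is_clint g m -> is_clint (fun t => f t + g t)%C (l + m)%C.
Proof.
intros [H1 H2] [H3 H4]; split.
- apply (is_RInt_gen_plus (V := R_NormedModule) _ _ _ _ H1 H3).
- apply (is_RInt_gen_plus (V := R_NormedModule) _ _ _ _ H2 H4).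
Qed.

Lemma is_clint_scal (c : C) (f : R -> C) (l : C) :
  is_clint f l -> is_clint (fun t => c * f t)%C (c * l)%C.
Proof.
intros [H1 H2]; split.
- apply (is_RInt_gen_minus (V := R_NormedModule) _ _ _ _
   (is_RInt_gen_scal (V := R_NormedModule) _ (Re c) _ H1)
   (is_RInt_gen_scal (V := R_NormedModule) _ (Im c) _ H2)).
- apply (is_RInt_gen_plus (V := R_NormedModule) _ _ _ _
   (is_RInt_gen_scal (V := R_NormedModule) _ (Re c) _ H2)
   (is_RInt_gen_scal (V := R_NormedModule) _ (Im c) _ H1)).
Qed.

Lemma is_clint_minus (f g : R -> C) (l m : C) :
  is_clint f l -> is_clint g m -> is_clint (fun t => f t - g t)%C (l - m)%C.
Proof.
intros H1 H2. apply (is_clint_ext (fun t => f t + (-(1)) * g t)%C). { intros; ring. }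
replace (l - m)%C with (l + (-(1)) * m)%C by ring.
apply is_clint_plus; auto. by apply is_clint_scal.
Qed.

Lemma is_clint_RtoC (f : R -> R) (l : R) :
  is_lint f l -> is_clint (fun t => RtoC (f t)) (RtoC l).
Proof.
intros H; split; auto.
apply (is_lint_ext (fun t => scal 0 (f t))). { intros; apply Rmult_0_l. }
replace (Im (RtoC l)) with (scal 0 l : R) by apply Rmult_0_l.
by apply (is_RInt_gen_scal (V := R_NormedModule)).
Qed.

Lemma is_clint_shift (f : R -> C) (c : R) (l : C) :
  (forall x, Ccont f x) -> is_clint f l -> is_clint (fun t => f (t + c)) l.
Proof.
intros Hf [H1 H2]; split.
- apply (is_lint_shift (fun t => Re (f t))); auto. intros u; exact (proj1 (Hf u)).
- apply (is_lint_shift (fun t => Im (f t))); auto. intros u; exact (proj2 (Hf u)).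
Qed.

(** * Exponentially decaying integrands *)

Lemma exp_le (x y : R) : x <= y -> exp x <= exp y.
Proof. intros [H|H]; [left; by apply exp_increasing|right; by rewrite H]. Qed.

Lemma exp_neg_lt_inv (s : R) : 0 < s -> exp (- s) < / s.
Proof.
intros Hs. rewrite exp_Ropp. apply Rinv_lt_contravar.
- apply Rmult_lt_0_compat; auto. apply exp_pos.
- assert (H := exp_ineq1 s ltac:(lra)). lra.
Qed.

Lemma filterlim_exp_decay_p (F : R -> R) (l K : R) :
  (forall s, 0 <= s -> Rabs (F s - l) <= K * exp (- s)) ->
  filterlim F (Rbar_locally p_infty) (locally l).
Proof.
intros H P [eps HP].
assert (HK : 0 <= K).
{ assert (E := H 0 ltac:(lra)). rewrite Ropp_0 exp_0 in E. assert (E1 := Rabs_pos (F 0 - l)). lra. }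
assert (He := cond_pos eps).
assert (H0 : 0 <= K / eps) by (apply Rdiv_le_0_compat; auto).
exists (K / eps). intros s Hs. apply HP.
change (Rabs (F s - l) < eps).
apply Rle_lt_trans with (1 := H s ltac:(lra)).
assert (E := exp_neg_lt_inv s ltac:(lra)).
apply Rle_lt_trans with (K * / s).
- apply Rmult_le_compat_l; lra.
- apply (Rmult_lt_reg_r s); [lra|]. rewrite Rmult_assoc Rinv_l; [|lra].
  apply (Rmult_lt_compat_r eps) in Hs; auto.
  unfold Rdiv in Hs. rewrite Rmult_assoc Rinv_l in Hs; lra.
Qed.

Lemma filterlim_exp_decay_m (F : R -> R) (l K : R) :
  (forall s, s <= 0 -> Rabs (F s - l) <= K * exp s) ->
  filterlim F (Rbar_locally m_infty) (locally l).
Proof.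
intros H P HP.
destruct (filterlim_exp_decay_p (fun s => F (- s)) l K) with (2 := HP) as [M HM].
- intros s Hs. apply H. lra.
- exists (- M). intros x Hx. replace x with (- - x) by ring. apply HM. lra.
Qed.

(** This is 1/cosh^2(s/2): a smooth majorant of e^(-|s|) with the elementary primitive -4/(1 + e^s),
    hence of integral 4. *)
Definition decay_ref (s : R) : R := 4 * exp s / (1 + exp s) ^ 2.

Lemma decay_ref_ge (s : R) : exp (- Rabs s) <= decay_ref s.
Proof.
unfold decay_ref. assert (H := exp_pos s).
apply (Rmult_le_reg_r ((1 + exp s) ^ 2)). { nra. }
unfold Rdiv. rewrite Rmult_assoc Rinv_l; [|nra].
destruct (Rle_dec 0 s) as [h|h].
- rewrite Rabs_pos_eq // exp_Ropp.
  assert (1 <= exp s) by (rewrite -exp_0; by apply exp_le).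
  apply (Rmult_le_reg_l (exp s)); auto. rewrite -Rmult_assoc Rinv_r; nra.
- rewrite Rabs_left; [|lra]. rewrite Ropp_involutive.
  assert (exp s < 1) by (rewrite -exp_0; apply exp_increasing; lra). nra.
Qed.

Lemma decay_ref_cont (s : R) : continuous decay_ref s.
Proof.
apply (ex_derive_continuous (V := R_NormedModule)). unfold decay_ref. auto_derive.
assert (H := exp_pos s). nra.
Qed.

Lemma decay_ref_lint : is_lint decay_ref 4.
Proof.
replace 4 with (0 - (- 4)) by ring.
apply (is_lint_antiderivative (fun s => - 4 / (1 + exp s))).
- intros s. assert (H := exp_pos s). unfold decay_ref. auto_derive. { lra. } field. lra.
- apply decay_ref_cont.
- apply (filterlim_exp_decay_m _ _ 4). intros s _. assert (H := exp_pos s).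
  replace (-4 / (1 + exp s) - -4) with (4 * exp s * / (1 + exp s)) by (field; lra).
  assert (0 < / (1 + exp s) < 1).
  { split. { apply Rinv_0_lt_compat; lra. } rewrite -Rinv_1. apply Rinv_lt_contravar; lra. }
  rewrite Rabs_pos_eq; nra.
- apply (filterlim_exp_decay_p _ _ 4). intros s _. assert (H := exp_pos s).
  replace (-4 / (1 + exp s) - 0) with (- (4 * / (1 + exp s))) by (field; lra).
  assert (0 < / (1 + exp s)) by (apply Rinv_0_lt_compat; lra).
  rewrite Rabs_Ropp Rabs_pos_eq; [|lra]. rewrite exp_Ropp.
  apply Rmult_le_compat_l; [lra|]. apply Rinv_le_contravar; lra.
Qed.

(** The rate 1 is fixed once and for all: the kernels of the theorem decay faster than any
    exponential, and the Laplace kernels are used with Re a >= 1. *)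
Definition decays (f : R -> C) : Prop := exists K, forall s, Cmod (f s) <= K * exp (- Rabs s).

Lemma is_lint_decay_bound (K : R) : is_lint (fun s => K * decay_ref s) (K * 4).
Proof. apply (is_RInt_gen_scal (V := R_NormedModule)), decay_ref_lint. Qed.

Lemma decay_bound_cont (K s : R) : continuous (fun s => K * decay_ref s) s.
Proof. apply (continuous_scal_r (K := R_AbsRing) (V := R_NormedModule)), decay_ref_cont. Qed.

Lemma le_decay_bound (x K s : R) : 0 <= x -> x <= K * exp (- Rabs s) -> x <= K * decay_ref s.
Proof.
intros Hx H. assert (E := decay_ref_ge s). assert (E1 := exp_pos (- Rabs s)).
assert (0 <= K) by nra. nra.
Qed.

Lemma is_clint_decays (f : R -> C) :
  (forall s, Ccont f s) -> decays f -> is_clint f (CInt f).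
Proof.
intros Hf [K HK]. apply (is_clint_dominated f (fun s => K * decay_ref s) (K * 4)); auto.
- apply decay_bound_cont.
- intros s. apply le_decay_bound; auto. apply Cmod_ge_0.
- apply is_lint_decay_bound.
Qed.

Lemma is_clint_decay_le (f : R -> C) (l : C) (K : R) :
  (forall s, Ccont f s) -> (forall s, Cmod (f s) <= K * exp (- Rabs s)) ->
  is_clint f l -> Cmod l <= 8 * K.
Proof.
intros Hf HK Hl. replace (8 * K) with (2 * (K * 4)) by ring.
apply (is_clint_bound f (fun s => K * decay_ref s)); auto.
- apply decay_bound_cont.
- intros s. apply le_decay_bound; auto. apply Cmod_ge_0.
- apply is_lint_decay_bound.
Qed.

(** Integration by parts in the form used throughout: an integrated identity is proved by exhibiting
    its integrand as the derivative of a decaying function, whose boundary values are 0. *)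
Lemma is_clint_derivative (F f : R -> C) :
  (forall s, Cder F s (f s)) -> (forall s, Ccont f s) -> decays F -> is_clint f 0.
Proof.
intros HF Hf [K HK]. split.
- replace (Re 0) with (0 - 0) by (simpl; ring).
  apply (is_lint_antiderivative (fun t => Re (F t))).
  + intros u; exact (proj1 (HF u)). + intros u; exact (proj1 (Hf u)).
  + apply (filterlim_exp_decay_m _ _ K). intros s Hs. rewrite Rminus_0_r.
    apply Rle_trans with (1 := re_le_Cmod _). apply Rle_trans with (1 := HK s).
    rewrite Rabs_left1 // Ropp_involutive. lra.
  + apply (filterlim_exp_decay_p _ _ K). intros s Hs. rewrite Rminus_0_r.
    apply Rle_trans with (1 := re_le_Cmod _). apply Rle_trans with (1 := HK s).
    rewrite Rabs_pos_eq //. lra.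
- replace (Im 0) with (0 - 0) by (simpl; ring).
  apply (is_lint_antiderivative (fun t => Im (F t))).
  + intros u; exact (proj2 (HF u)). + intros u; exact (proj2 (Hf u)).
  + apply (filterlim_exp_decay_m _ _ K). intros s Hs. rewrite Rminus_0_r.
    apply Rle_trans with (1 := Im_le_Cmod _). apply Rle_trans with (1 := HK s).
    rewrite Rabs_left1 // Ropp_involutive. lra.
  + apply (filterlim_exp_decay_p _ _ K). intros s Hs. rewrite Rminus_0_r.
    apply Rle_trans with (1 := Im_le_Cmod _). apply Rle_trans with (1 := HK s).
    rewrite Rabs_pos_eq //. lra.
Qed.

(** * Differentiation under the integral sign *)

Lemma is_derive_quadratic (h : R -> R) (x l K d : R) :
  0 < d ->
  (forall y, Rabs (y - x) < d -> Rabs (h y - h x - (y - x) * l) <= K * (y - x) ^ 2) ->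
  is_derive h x l.
Proof.
intros Hd H. apply is_derive_Reals. intros eps Heps.
assert (HK : 0 < Rabs K + 1) by (assert (E := Rabs_pos K); lra).
assert (Hm : 0 < Rmin d (eps / (Rabs K + 1))).
{ apply Rmin_pos; auto. apply Rdiv_lt_0_compat; auto. }
exists (mkposreal _ Hm). simpl. intros t Ht Htd.
assert (H1 := Rmin_l d (eps / (Rabs K + 1))). assert (H2 := Rmin_r d (eps / (Rabs K + 1))).
assert (E := H (x + t) ltac:(replace (x + t - x) with t by ring; lra)).
replace (x + t - x) with t in E by ring.
assert (Ht' : 0 < Rabs t) by (apply Rabs_pos_lt; auto).
replace ((h (x + t) - h x) / t - l) with ((h (x + t) - h x - t * l) / t) by (field; auto).
unfold Rdiv. rewrite Rabs_mult Rabs_inv.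
apply (Rmult_lt_reg_r (Rabs t)); auto. rewrite Rmult_assoc Rinv_l; [|lra].
rewrite Rmult_1_r. apply Rle_lt_trans with (1 := E).
assert (Ht2 : t ^ 2 = Rabs t * Rabs t) by (rewrite -Rabs_mult Rabs_pos_eq; [ring|nra]).
rewrite Ht2 -Rmult_assoc. apply Rmult_lt_compat_r; auto.
apply Rle_lt_trans with (Rabs K * Rabs t).
{ apply Rmult_le_compat_r; [lra|apply Rle_abs]. }
assert (Rabs t < eps / (Rabs K + 1)) by lra.
apply (Rmult_lt_compat_r (Rabs K + 1)) in H0; auto.
unfold Rdiv in H0. rewrite Rmult_assoc Rinv_l in H0; [|lra]. nra.
Qed.

Lemma Cder_quadratic (h : R -> C) (x : R) (l : C) (K d : R) :
  0 < d ->
  (forall y, Rabs (y - x) < d ->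
     Cmod (h y - h x - RtoC (y - x) * l) <= K * (y - x) ^ 2) ->
  Cder h x l.
Proof.
intros Hd H. split; apply (is_derive_quadratic _ _ _ K d); auto; intros y Hy;
  apply Rle_trans with (2 := H y Hy).
- apply Rle_trans with (2 := re_le_Cmod _). right. f_equal. rewrite /Re /=. ring.
- apply Rle_trans with (2 := Im_le_Cmod _). right. f_equal. rewrite /Im /=. ring.
Qed.

(** The function [f t - t * f1 z0] has derivative [f1 t - f1 z0], itself at most 2 B |y - z0| in
    modulus. Two uses of [Cmod_bounded_variation] produce the constant 4. *)
Lemma Cmod_taylor2 (f f1 f2 : R -> C) (z0 y B : R) :
  (forall t, Rabs (t - z0) <= Rabs (y - z0) ->
     Cder f t (f1 t) /\ Cder f1 t (f2 t) /\ Cmod (f2 t) <= B) ->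
  Cmod (f y - f z0 - RtoC (y - z0) * f1 z0) <= 4 * B * (y - z0) ^ 2.
Proof.
intros H.
assert (HB : 0 <= B).
{ apply Rle_trans with (2 := proj2 (proj2 (H z0 ltac:(rewrite Rminus_diag Rabs_R0; apply Rabs_pos)))).
  apply Cmod_ge_0. }
assert (H1 : forall t, Rabs (t - z0) <= Rabs (y - z0) ->
   Cmod (f1 t - f1 z0) <= 2 * B * Rabs (y - z0)).
{ intros t Ht. apply Rle_trans with (2 * B * Rabs (t - z0)).
  - apply (Cmod_bounded_variation f1 f2). intros u Hu.
    assert (Hu' : Rabs (u - z0) <= Rabs (y - z0)) by lra.
    destruct (H u Hu') as [_ [? ?]]; auto.
  - apply Rmult_le_compat_l; lra. }
replace (4 * B * (y - z0) ^ 2) with (2 * (2 * B * Rabs (y - z0)) * Rabs (y - z0)).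
2:{ replace ((y - z0) ^ 2) with (Rabs (y - z0) * Rabs (y - z0)). ring.
    rewrite -Rabs_mult Rabs_pos_eq; [ring|apply Rle_0_sqr]. }
replace (f y - f z0 - RtoC (y - z0) * f1 z0)%C with
  ((f y - RtoC y * f1 z0) - (f z0 - RtoC z0 * f1 z0))%C by (rewrite RtoC_minus; ring).
apply (Cmod_bounded_variation (fun t => f t - RtoC t * f1 z0)%C (fun t => f1 t - f1 z0)%C).
intros t Ht. split; [|by apply H1].
apply Cder_minus. { apply H, Ht. }
eapply Cder_eq. { apply Cder_mult; [apply Cder_RtoC, (is_derive_id (K := R_AbsRing))|apply Cder_const]. }
rewrite /one /=. ring.
Qed.

(* A bound on the second derivative makes the Taylor remainder integrable, so no joint continuity is needed. *)
Lemma Cder_CInt (f f1 f2 : R -> R -> C) (z0 d K : R) :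
  0 < d ->
  (forall z s, Rabs (z - z0) < d -> Cder (fun z => f z s) z (f1 z s)) ->
  (forall z s, Rabs (z - z0) < d -> Cder (fun z => f1 z s) z (f2 z s)) ->
  (forall z s, Rabs (z - z0) < d -> Cmod (f2 z s) <= K * exp (- Rabs s)) ->
  (forall z s, Rabs (z - z0) < d -> Ccont (f z) s) ->
  (forall s, Ccont (f1 z0) s) ->
  (forall z, Rabs (z - z0) < d -> decays (f z)) -> decays (f1 z0) ->
  Cder (fun z => CInt (f z)) z0 (CInt (f1 z0)).
Proof.
intros Hd H1 H2 HK Hc Hc1 Hf Hf1.
assert (Hz0 : Rabs (z0 - z0) < d) by (rewrite Rminus_diag Rabs_R0; auto).
(* 32 = 8 * 4: the Taylor remainder carries the constant 4, and a function bounded by K e^(-|s|) has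
   integral at most 8 K. *)
apply (Cder_quadratic _ _ _ (32 * K) d); auto.
intros y Hy.
assert (HI : is_clint (fun s => f y s - f z0 s - RtoC (y - z0) * f1 z0 s)%C
   (CInt (f y) - CInt (f z0) - RtoC (y - z0) * CInt (f1 z0))%C).
{ apply is_clint_minus. apply is_clint_minus. 3: apply is_clint_scal.
  - apply is_clint_decays; auto.
  - apply is_clint_decays; auto.
  - apply is_clint_decays; auto. }
replace (32 * K * (y - z0) ^ 2) with (8 * (4 * K * (y - z0) ^ 2)) by ring.
apply (is_clint_decay_le _ _ _) with (3 := HI).
- intros s. apply Ccont_minus. apply Ccont_minus; auto. apply Ccont_mult; auto. apply Ccont_const.
- intros s. apply Rle_trans with (4 * (K * exp (- Rabs s)) * (y - z0) ^ 2).
  + apply (Cmod_taylor2 (fun z => f z s) (fun z => f1 z s) (fun z => f2 z s)).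
    intros t Ht. split; [|split]; [apply H1|apply H2|apply HK]; lra.
  + right; ring.
Qed.

(** * Uniqueness of the Tricomi solution *)

Lemma is_derive_Req (f : R -> R) (x l l' : R) : is_derive f x l -> l = l' -> is_derive f x l'.
Proof. by intros H <-. Qed.

Lemma Cexp_plus (a b : C) : Cexp (a + b) = (Cexp a * Cexp b)%C.
Proof.
destruct a as [a1 a2]; destruct b as [b1 b2].
rewrite /Cexp /Cmult /Re /Im /= exp_plus cos_plus sin_plus. f_equal; ring.
Qed.

Lemma Cexp_RtoC (r : R) : Cexp (RtoC r) = RtoC (exp r).
Proof. rewrite /Cexp /= cos_0 sin_0 /RtoC. f_equal; ring. Qed.

Lemma Cexp_0 : Cexp 0 = 1%C.
Proof. by rewrite Cexp_RtoC exp_0. Qed.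

Lemma Cmod_Cexp (z : C) : Cmod (Cexp z) = exp (Re z).
Proof.
rewrite /Cexp /Cmod /=.
set (c := cos (Im z)); set (s := sin (Im z)); set (e := exp (Re z)).
assert (H : s * s + c * c = 1) by exact (sin2_cos2 (Im z)).
replace (_ + _) with (e * e * (s * s + c * c)) by ring.
rewrite H Rmult_1_r sqrt_square //. left; apply exp_pos.
Qed.

Lemma Cexp_neq_0 (z : C) : Cexp z <> 0%C.
Proof. apply Cmod_gt_0. rewrite Cmod_Cexp. apply exp_pos. Qed.

Lemma Cexp_opp (z : C) : Cexp (- z) = (/ Cexp z)%C.
Proof.
assert (H : (Cexp z * Cexp (- z) = 1)%C).
{ rewrite -Cexp_plus. replace (z + - z)%C with (RtoC 0) by ring. apply Cexp_0. }
assert (Hn := Cexp_neq_0 z).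
rewrite -(Cmult_1_l (Cexp (- z))) -(Cinv_l (Cexp z)) // -Cmult_assoc H. ring.
Qed.

Lemma Cder_Cexp_comp (f : R -> C) (x : R) (l : C) :
  Cder f x l -> Cder (fun t => Cexp (f t)) x (l * Cexp (f x))%C.
Proof.
intros [H1 H2].
assert (G : forall u v : R -> R, forall l m : R, is_derive u x l -> is_derive v x m ->
  is_derive (fun t => exp (u t) * cos (v t)) x (l * (exp (u x) * cos (v x)) - m * (exp (u x) * sin (v x))) /\
  is_derive (fun t => exp (u t) * sin (v t)) x (l * (exp (u x) * sin (v x)) + m * (exp (u x) * cos (v x)))).
{ intros u v p q Hp Hq. split; (auto_derive; [repeat split; eexists; eassumption|]);
  rewrite (is_derive_unique (fun t => u t) _ _ Hp) (is_derive_unique (fun t => v t) _ _ Hq); ring. }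
destruct (G (fun t => Re (f t)) (fun t => Im (f t)) _ _ H1 H2). split; auto.
Qed.

Lemma Rcpow_plus (t : R) (a b : C) : Rcpow t (a + b) = (Rcpow t a * Rcpow t b)%C.
Proof. rewrite /Rcpow -Cexp_plus. f_equal. ring. Qed.

Lemma Rcpow_mult (s t : R) (a : C) : 0 < s -> 0 < t -> Rcpow (s * t) a = (Rcpow s a * Rcpow t a)%C.
Proof. intros Hs Ht. rewrite /Rcpow -Cexp_plus ln_mult // RtoC_plus. f_equal. ring. Qed.

Lemma Rcpow_opp (t : R) (a : C) : Rcpow t (- a) = (/ Rcpow t a)%C.
Proof. rewrite /Rcpow -Cexp_opp. f_equal. ring. Qed.

Lemma Rcpow_inv (t : R) (a : C) : 0 < t -> Rcpow (/ t) a = (/ Rcpow t a)%C.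
Proof. intros Ht. rewrite /Rcpow -Cexp_opp ln_Rinv // RtoC_opp. f_equal. ring. Qed.

Lemma Rcpow_neq_0 (t : R) (a : C) : Rcpow t a <> 0%C.
Proof. apply Cexp_neq_0. Qed.

Lemma Rcpow_RtoC (t r : R) : Rcpow t (RtoC r) = RtoC (Rpower t r).
Proof. by rewrite /Rcpow -RtoC_mult Cexp_RtoC. Qed.

Lemma Rcpow_1_r (t : R) : 0 < t -> Rcpow t 1 = RtoC t.
Proof. intros Ht. by rewrite Rcpow_RtoC Rpower_1. Qed.

Lemma Cmod_Rcpow (t : R) (a : C) : Cmod (Rcpow t a) = exp (Re a * ln t).
Proof. rewrite /Rcpow Cmod_Cexp. f_equal. rewrite /Re /=. ring. Qed.

Lemma Cder_Rcpow (a : C) (t : R) : 0 < t ->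
  Cder (fun z => Rcpow z a) t (a / RtoC t * Rcpow t a)%C.
Proof.
intros Ht. rewrite /Rcpow. eapply Cder_eq.
{ apply (Cder_Cexp_comp (fun z => a * RtoC (ln z))%C). apply Cder_scal, Cder_RtoC, is_derive_ln, Ht. }
rewrite RtoC_inv; [by rewrite /Cdiv|lra].
Qed.

Lemma RtoC_neq_0 (x : R) : x <> 0 -> RtoC x <> 0%C.
Proof. intros H E. apply H. by injection E. Qed.

(** The threshold is positive so that functions meaningful only for z > 0 can be rewritten under the
    limit. *)
Definition Clim (f : R -> C) (l : C) : Prop :=
  forall eps, 0 < eps -> exists M, 0 < M /\ forall x, M < x -> Cmod (f x - l) < eps.

Lemma Clim_filterlim (f : R -> C) (l : C) :
  Clim f l -> filterlim f (Rbar_locally p_infty) (locally l).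
Proof.
intros H P [eps HP]. destruct (H eps (cond_pos eps)) as [M [_ HM]].
exists M. intros x Hx. apply HP. specialize (HM x Hx).
split.
- change (Rabs (Re (f x) - Re l) < eps).
  apply Rle_lt_trans with (2 := HM). apply (re_le_Cmod (f x - l)%C).
- change (Rabs (Im (f x) - Im l) < eps).
  apply Rle_lt_trans with (2 := HM). apply (Im_le_Cmod (f x - l)%C).
Qed.

Lemma filterlim_Clim (f : R -> C) (l : C) :
  filterlim f (Rbar_locally p_infty) (locally l) -> Clim f l.
Proof.
intros H eps Heps.
assert (He : 0 < eps / 2) by lra.
destruct (H (ball l (mkposreal _ He))) as [M HM]. { apply locally_ball. }
exists (Rmax M 1). split. { apply Rlt_le_trans with 1; [lra|apply Rmax_r]. }
intros x Hx.
assert (Hx' : M < x) by (apply Rle_lt_trans with (2 := Hx), Rmax_l).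
destruct (HM x Hx') as [h1 h2].
change (Rabs (Re (f x) - Re l) < eps / 2) in h1.
change (Rabs (Im (f x) - Im l) < eps / 2) in h2.
apply Rle_lt_trans with (1 := Cmod_le_abs _).
change (Rabs (Re (f x) - Re l) + Rabs (Im (f x) - Im l) < eps). lra.
Qed.

Lemma Clim_ext_loc (f g : R -> C) (l : C) (M : R) :
  (forall x, M < x -> f x = g x) -> Clim f l -> Clim g l.
Proof.
intros E H eps Heps. destruct (H eps Heps) as [N [HN HN']].
exists (Rmax M N). split. { apply Rlt_le_trans with (1 := HN), Rmax_r. }
intros x Hx. rewrite -E.
- apply HN'. apply Rle_lt_trans with (2 := Hx), Rmax_r.
- apply Rle_lt_trans with (2 := Hx), Rmax_l.
Qed.

Lemma Clim_ext (f g : R -> C) (l : C) :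
  (forall x, 0 < x -> f x = g x) -> Clim f l -> Clim g l.
Proof. apply Clim_ext_loc. Qed.

Lemma Clim_eq (f : R -> C) (l l' : C) : l = l' -> Clim f l -> Clim f l'.
Proof. by intros <-. Qed.

Lemma Clim_const (c : C) : Clim (fun _ => c) c.
Proof.
intros eps Heps. exists 1. split; [lra|]. intros x _.
replace (c - c)%C with (RtoC 0) by ring. by rewrite Cmod_0.
Qed.

Lemma Clim_plus (f g : R -> C) (l m : C) :
  Clim f l -> Clim g m -> Clim (fun x => f x + g x)%C (l + m)%C.
Proof.
intros Hf Hg eps Heps.
destruct (Hf (eps / 2) ltac:(lra)) as [M [HM HM']].
destruct (Hg (eps / 2) ltac:(lra)) as [N [HN HN']].
exists (Rmax M N). split. { apply Rlt_le_trans with (1 := HM), Rmax_l. }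
intros x Hx.
assert (E1 := HM' x (Rle_lt_trans _ _ _ (Rmax_l M N) Hx)).
assert (E2 := HN' x (Rle_lt_trans _ _ _ (Rmax_r M N) Hx)).
replace (f x + g x - (l + m))%C with ((f x - l) + (g x - m))%C by ring.
apply Rle_lt_trans with (1 := Cmod_triangle _ _). lra.
Qed.

Lemma Clim_mult (f g : R -> C) (l m : C) :
  Clim f l -> Clim g m -> Clim (fun x => f x * g x)%C (l * m)%C.
Proof.
intros Hf Hg eps Heps.
assert (Hl := Cmod_ge_0 l). assert (Hm := Cmod_ge_0 m).
set (B := Cmod m + 1). set (A := Cmod l + 1).
assert (HB : 0 < B) by (unfold B; lra). assert (HA : 0 < A) by (unfold A; lra).
destruct (Hf (eps / (2 * B))) as [M [HM HM']]. { apply Rdiv_lt_0_compat; lra. }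
destruct (Hg (Rmin 1 (eps / (2 * A)))) as [N [HN HN']].
{ apply Rmin_pos; [lra|]. apply Rdiv_lt_0_compat; lra. }
exists (Rmax M N). split. { apply Rlt_le_trans with (1 := HM), Rmax_l. }
intros x Hx.
assert (E1 := HM' x (Rle_lt_trans _ _ _ (Rmax_l M N) Hx)).
assert (E2 := HN' x (Rle_lt_trans _ _ _ (Rmax_r M N) Hx)).
assert (E3 := Rmin_l 1 (eps / (2 * A))). assert (E4 := Rmin_r 1 (eps / (2 * A))).
assert (Hgx : Cmod (g x) <= B).
{ replace (g x) with ((g x - m) + m)%C by ring.
  apply Rle_trans with (1 := Cmod_triangle _ _). unfold B. lra. }
replace (f x * g x - l * m)%C with ((f x - l) * g x + l * (g x - m))%C by ring.
apply Rle_lt_trans with (1 := Cmod_triangle _ _). rewrite !Cmod_mult.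
assert (F1 : Cmod (f x - l) * Cmod (g x) <= Cmod (f x - l) * B).
{ apply Rmult_le_compat_l; auto. apply Cmod_ge_0. }
assert (F2 : Cmod l * Cmod (g x - m) <= A * Cmod (g x - m)).
{ apply Rmult_le_compat_r; [apply Cmod_ge_0|unfold A; lra]. }
assert (F3 : Cmod (f x - l) * B < eps / 2).
{ replace (eps / 2) with (eps / (2 * B) * B) by (field; lra). apply Rmult_lt_compat_r; auto. }
assert (F4 : A * Cmod (g x - m) <= A * (eps / (2 * A))).
{ apply Rmult_le_compat_l; lra. }
replace (A * (eps / (2 * A))) with (eps / 2) in F4 by (field; lra). lra.
Qed.

Lemma Clim_scal (c : C) (f : R -> C) (l : C) : Clim f l -> Clim (fun x => c * f x)%C (c * l)%C.
Proof. intros H. apply Clim_mult; auto. apply Clim_const. Qed.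

Lemma Clim_minus (f g : R -> C) (l m : C) :
  Clim f l -> Clim g m -> Clim (fun x => f x - g x)%C (l - m)%C.
Proof.
intros H1 H2. apply (Clim_ext (fun x => f x + (-(1)) * g x)%C). { intros; ring. }
replace (l - m)%C with (l + (-(1)) * m)%C by ring.
apply Clim_plus; auto. by apply Clim_scal.
Qed.

Lemma Clim_inv_1 (f : R -> C) : Clim f 1 -> Clim (fun x => / f x)%C 1.
Proof.
intros H eps Heps.
destruct (H (Rmin (1 / 2) (eps / 2))) as [M [HM HM']]. { apply Rmin_pos; lra. }
exists M. split; auto. intros x Hx. specialize (HM' x Hx).
assert (E1 := Rmin_l (1 / 2) (eps / 2)). assert (E2 := Rmin_r (1 / 2) (eps / 2)).
assert (Hf : 1 / 2 < Cmod (f x)).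
{ assert (E := Cmod_triangle (f x) (1 - f x)).
  replace (f x + (1 - f x))%C with (RtoC 1) in E by ring. rewrite Cmod_1 in E.
  replace (1 - f x)%C with (- (f x - 1))%C in E by ring. rewrite Cmod_opp in E. lra. }
assert (Hn : f x <> 0%C) by (apply Cmod_gt_0; lra).
replace (/ f x - 1)%C with (- (f x - 1) / f x)%C by (field; auto).
rewrite Cmod_div // Cmod_opp.
apply (Rmult_lt_reg_r (Cmod (f x))); [lra|]. unfold Rdiv. rewrite Rmult_assoc Rinv_l; [|lra]. nra.
Qed.

Lemma Clim_le (f : R -> C) (l : C) (K Z : R) :
  (forall x, Z < x -> Cmod (f x - l) <= K / x) -> Clim f l.
Proof.
intros H eps Heps.
exists (Rmax (Rmax Z 1) (Rabs K / eps)). split.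
{ apply Rlt_le_trans with 1; [lra|]. apply Rle_trans with (Rmax Z 1); [apply Rmax_r|apply Rmax_l]. }
intros x Hx.
assert (H1 : Z < x). { apply Rle_lt_trans with (2 := Hx), Rle_trans with (Rmax Z 1); apply Rmax_l. }
assert (H2 : 1 < x). { apply Rle_lt_trans with (2 := Hx), Rle_trans with (Rmax Z 1); [apply Rmax_r|apply Rmax_l]. }
assert (H3 : Rabs K / eps < x). { apply Rle_lt_trans with (2 := Hx), Rmax_r. }
apply Rle_lt_trans with (1 := H x H1).
apply (Rmult_lt_reg_r x); [lra|]. unfold Rdiv. rewrite Rmult_assoc Rinv_l; [|lra].
apply (Rmult_lt_compat_r eps) in H3; auto. unfold Rdiv in H3. rewrite Rmult_assoc Rinv_l in H3; [|lra].
assert (E := Rle_abs K). lra.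
Qed.

Lemma Clim_inv_id : Clim (fun z => / RtoC z)%C 0.
Proof.
apply (Clim_le _ _ 1 0). intros z Hz.
replace (/ RtoC z - 0)%C with (/ RtoC z)%C by ring.
rewrite Cmod_inv; [|apply RtoC_neq_0; lra]. rewrite Cmod_R Rabs_pos_eq; lra.
Qed.

Lemma Clim_unique (f : R -> C) (l m : C) : Clim f l -> Clim f m -> l = m.
Proof.
intros H1 H2.
assert (E : Cmod (l - m) = 0).
{ apply Rle_antisym; [|apply Cmod_ge_0]. apply Rnot_lt_le. intros Hp.
  destruct (H1 (Cmod (l - m) / 2) ltac:(lra)) as [M [_ HM]].
  destruct (H2 (Cmod (l - m) / 2) ltac:(lra)) as [N [_ HN]].
  set (x := Rmax M N + 1).
  assert (E1 := HM x ltac:(unfold x; assert (T := Rmax_l M N); lra)).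
  assert (E2 := HN x ltac:(unfold x; assert (T := Rmax_r M N); lra)).
  assert (E3 := Cmod_triangle (- (f x - l)) (f x - m)). rewrite Cmod_opp in E3.
  replace (- (f x - l) + (f x - m))%C with (l - m)%C in E3 by ring. lra. }
apply Cmod_eq_0 in E. replace l with ((l - m) + m)%C by ring. rewrite E. ring.
Qed.

(** The inequality 1 + v <= e^v at v = u + ln (d / M), multiplied by [M]: the shift tunes the
    coefficient of e^u to [d]. *)
Lemma linear_le_exp (M d : R) : 0 <= M -> 0 < d -> exists K, forall u, M * u <= d * exp u + K.
Proof.
intros HM Hd. destruct HM as [HM|HM].
- exists (- M * ln (d / M)). intros u.
  assert (Hr : 0 < d / M) by (apply Rdiv_lt_0_compat; auto).
  assert (E := exp_ineq1_le (u + ln (d / M))).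
  rewrite exp_plus exp_ln // in E.
  apply (Rmult_le_compat_l M) in E; [|lra].
  replace (M * (exp u * (d / M))) with (d * exp u) in E by (field; lra). nra.
- exists 0. intros u. rewrite -HM. assert (E := exp_pos u). nra.
Qed.

Lemma Cder_0_const (f : R -> C) (Z x y : R) :
  (forall t, Z < t -> Cder f t 0) -> Z < x -> Z < y -> f x = f y.
Proof.
intros H Hx Hy.
assert (Hmin : forall t, Rmin x y <= t -> Z < t).
{ intros t Ht. apply Rlt_le_trans with (2 := Ht). apply Rmin_glb_lt; auto. }
assert (G : forall h : R -> R, (forall t, Z < t -> is_derive h t 0) -> h x = h y).
{ intros h Hh. destruct (MVT_gen h x y (fun _ => 0)) as [c [_ E]].
  - intros t Ht. apply Hh, Hmin; lra.
  - intros t Ht. apply continuity_pt_filterlim, (ex_derive_continuous (V := R_NormedModule)).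
    eexists; apply Hh, Hmin; lra.
  - lra. }
rewrite (surjective_pairing (f x)) (surjective_pairing (f y)). f_equal.
- apply (G (fun t => Re (f t))). intros t Ht. apply (H t Ht).
- apply (G (fun t => Im (f t))). intros t Ht. apply (H t Ht).
Qed.

(** By the mean value theorem f(x + 1) - f(x) is a value of the derivative on [x, x + 1]; the
    difference tends to 0 while the derivative tends to [k]. The intermediate point depends on the
    component, so each component is treated alone. *)
Lemma Clim_Cder (f f' : R -> C) (Z : R) (k : C) :
  (forall t, Z < t -> Cder f t (f' t)) -> Clim f 0 -> Clim f' k -> k = 0%C.
Proof.
intros H Hf Hf'.
assert (G : forall (h h' : R -> R) (r : R),
  (forall t, Z < t -> is_derive h t (h' t)) ->
  (forall eps, 0 < eps -> exists M, forall x, M < x -> Rabs (h x) < eps) ->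
  (forall eps, 0 < eps -> exists M, forall x, M < x -> Rabs (h' x - r) < eps) -> r = 0).
{ intros h h' r Hd H1 H2. 
  destruct (Req_dec r 0) as [e|n]; auto. exfalso.
  assert (Hr : 0 < Rabs r) by by apply Rabs_pos_lt.
  destruct (H1 (Rabs r / 4) ltac:(lra)) as [M HM].
  destruct (H2 (Rabs r / 4) ltac:(lra)) as [N HN].
  set (x := Rmax (Rmax M N) Z + 1).
  assert (Hx : M < x /\ N < x /\ Z < x).
  { unfold x. assert (T1 := Rmax_l (Rmax M N) Z). assert (T2 := Rmax_r (Rmax M N) Z).
    assert (T3 := Rmax_l M N). assert (T4 := Rmax_r M N). lra. }
  destruct (MVT_gen h x (x + 1) h') as [c [Hc E]].
  - intros t Ht. rewrite Rmin_left in Ht; [|lra]. apply Hd; lra.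
  - intros t Ht. rewrite Rmin_left in Ht; [|lra].
    apply continuity_pt_filterlim, (ex_derive_continuous (V := R_NormedModule)).
    eexists; apply Hd; lra.
  - rewrite Rmin_left in Hc; [|lra].
    assert (E1 := HM x ltac:(lra)). assert (E2 := HM (x + 1) ltac:(lra)).
    assert (E3 := HN c ltac:(lra)).
    replace (x + 1 - x) with 1 in E by ring. revert Hr E1 E2 E3 E. split_Rabs; lra. }
rewrite (surjective_pairing k). apply (f_equal2 (fun a b : R => (a, b))).
- apply (G (fun t => Re (f t)) (fun t => Re (f' t))).
  + intros t Ht. apply (H t Ht).
  + intros e He. destruct (Hf e He) as [M [_ HM]]. exists M. intros x Hx.
    apply Rle_lt_trans with (2 := HM x Hx).
    replace (f x - 0)%C with (f x) by ring. apply re_le_Cmod.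
  + intros e He. destruct (Hf' e He) as [M [_ HM]]. exists M. intros x Hx.
    apply Rle_lt_trans with (2 := HM x Hx). apply (re_le_Cmod (f' x - k)%C).
- apply (G (fun t => Im (f t)) (fun t => Im (f' t))).
  + intros t Ht. apply (H t Ht).
  + intros e He. destruct (Hf e He) as [M [_ HM]]. exists M. intros x Hx.
    apply Rle_lt_trans with (2 := HM x Hx).
    replace (f x - 0)%C with (f x) by ring. apply Im_le_Cmod.
  + intros e He. destruct (Hf' e He) as [M [_ HM]]. exists M. intros x Hx.
    apply Rle_lt_trans with (2 := HM x Hx). apply (Im_le_Cmod (f' x - k)%C).
Qed.

(** * Kummer's equation and its recessive solution *)

Definition Kummer (a b : C) (f f' f'' : R -> C) : Prop :=
  forall z, 0 < z -> Cder f z (f' z) /\ Cder f' z (f'' z) /\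
    (RtoC z * f'' z + (b - RtoC z) * f' z - a * f z = 0)%C.

Lemma is_Tricomi_Kummer (a b : C) (f : R -> C) :
  is_Tricomi a b f <->
  (exists f' f'', Kummer a b f f' f'') /\ Clim (fun z => Rcpow z a * f z)%C 1.
Proof.
split.
- intros [[f' [f'' H]] Hl]. split; [|by apply filterlim_Clim].
  exists f', f''. intros z Hz. destruct (H z Hz) as [h1 [h2 h3]].
  split; [|split]; auto; by apply is_derive_Cder.
- intros [[f' [f'' H]] Hl]. split; [|by apply Clim_filterlim].
  exists f', f''. intros z Hz. destruct (H z Hz) as [h1 [h2 h3]].
  split; [|split]; auto; by apply Cder_is_derive.
Qed.

(* Gronwall, run backwards from the region where [d] is known to vanish. *)
Lemma Kummer_backward_unique (a b : C) (d d' d'' : R -> C) (Z : R) :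
  Kummer a b d d' d'' -> (forall z, Z < z -> d z = 0%C) ->
  forall z, 0 < z -> d z = 0%C.
Proof.
intros HK HZ z1 Hz1.
destruct (Rlt_dec Z z1) as [h|h]; [by apply HZ|].
set (z2 := Rmax Z z1 + 1).
assert (Hz2 : Z < z2 /\ z1 < z2).
{ unfold z2. assert (T1 := Rmax_l Z z1). assert (T2 := Rmax_r Z z1). lra. }
assert (Hd2 : d z2 = 0%C) by (apply HZ; lra).
(* [d] vanishes on a neighbourhood of [z2], so uniqueness of derivatives gives the second initial
   value. *)
assert (Hd2' : d' z2 = 0%C).
{ destruct (HK z2 ltac:(lra)) as [[h1 h2] _].
  assert (E0 : Cder (fun _ => RtoC 0) z2 (d' z2)).
  { apply (Cder_ext_loc d); [|by split].
    exists (mkposreal (z2 - Z) ltac:(lra)). intros y Hy. apply HZ.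
    change (Rabs (y - z2) < z2 - Z) in Hy. revert Hy. split_Rabs; lra. }
  destruct E0 as [g1 g2]. destruct (Cder_const 0 z2) as [k1 k2].
  rewrite (surjective_pairing (d' z2)).
  apply (f_equal2 (fun a b : R => (a, b))).
  - change (Re (d' z2) = 0). rewrite -(is_derive_unique _ _ _ g1). apply (is_derive_unique _ _ _ k1).
  - change (Im (d' z2) = 0). rewrite -(is_derive_unique _ _ _ g2). apply (is_derive_unique _ _ _ k2). }
(* Solving the equation for [d''] gives the coefficients 1 - b/t and a/t, both bounded by [M] for t
   >= z1. The energy |d|^2 + |d'|^2 then satisfies E' >= - L E. *)
set (M := 1 + (Cmod a + Cmod b) / z1).
set (L := 1 + 4 * M).
set (E := fun t => Re (d t) * Re (d t) + Im (d t) * Im (d t) + (Re (d' t) * Re (d' t) + Im (d' t) * Im (d' t))).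
set (E' := fun t => 2 * (Re (d t) * Re (d' t) + Im (d t) * Im (d' t)) + 2 * (Re (d' t) * Re (d'' t) + Im (d' t) * Im (d'' t))).
assert (Ha := Cmod_ge_0 a). assert (Hb := Cmod_ge_0 b).
assert (HM : 1 <= M).
{ unfold M. assert (0 <= (Cmod a + Cmod b) / z1) by (apply Rdiv_le_0_compat; lra). lra. }
assert (HE : forall t, 0 < t -> is_derive E t (E' t)).
{ intros t Ht. destruct (HK t Ht) as [[h1 h2] [[h3 h4] _]].
  unfold E.
  eapply is_derive_Req.
  { apply is_derive_Rplus; apply is_derive_Rplus; apply is_derive_Rmult; eassumption. }
  unfold E'; ring. }
assert (HE' : forall t, z1 <= t -> - L * E t <= E' t).
{ intros t Ht. destruct (HK t ltac:(lra)) as [_ [_ Ho]].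
  assert (Htn : RtoC t <> 0%C) by (apply RtoC_neq_0; lra).
  assert (Hd'' : Cmod (d'' t) <= M * (Cmod (d t) + Cmod (d' t))).
  { replace (d'' t) with ((1 - b / RtoC t) * d' t + a / RtoC t * d t)%C.
    2:{ apply (f_equal (fun u => u / RtoC t)%C) in Ho.
        replace (d'' t) with (((RtoC t * d'' t + (b - RtoC t) * d' t - a * d t) / RtoC t) + (1 - b / RtoC t) * d' t + a / RtoC t * d t)%C by (field; auto).
        rewrite Ho. field; auto. }
    apply Rle_trans with (1 := Cmod_triangle _ _).
    rewrite (Cmod_mult (1 - b / RtoC t)) (Cmod_mult (a / RtoC t)).
    assert (B0 : forall c : C, Cmod (c / RtoC t) <= Cmod c / z1).
    { intros c. rewrite Cmod_div // Cmod_R Rabs_pos_eq; [|lra].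
      apply Rmult_le_compat_l; [apply Cmod_ge_0|]. apply Rinv_le_contravar; lra. }
    assert (B1 : Cmod (1 - b / RtoC t) <= M).
    { apply Rle_trans with (1 := Cmod_triangle _ _). rewrite Cmod_1 Cmod_opp.
      specialize (B0 b). unfold M.
      assert (0 <= Cmod a / z1) by (apply Rdiv_le_0_compat; lra). lra. }
    assert (B2 : Cmod (a / RtoC t) <= M).
    { specialize (B0 a). unfold M.
      assert (0 <= Cmod b / z1) by (apply Rdiv_le_0_compat; lra). lra. }
    rewrite Rmult_plus_distr_l Rplus_comm.
    apply Rplus_le_compat; apply Rmult_le_compat_r; auto; apply Cmod_ge_0. }
  assert (CS : forall u v : C, Rabs (Re u * Re v + Im u * Im v) <= Cmod u * Cmod v).
  { intros u v. rewrite -Cmod_conj -Cmod_mult.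
    apply Rle_trans with (2 := re_le_Cmod _). right. f_equal. rewrite /Re /Im /=. ring. }
  assert (SQ : forall u : C, Re u * Re u + Im u * Im u = Cmod u * Cmod u).
  { intros u. assert (T := Cmod2_alt u). simpl in T. rewrite !Rmult_1_r in T. by rewrite T. }
  unfold E, E'. rewrite !SQ.
  assert (C1 := CS (d t) (d' t)). assert (C2 := CS (d' t) (d'' t)).
  assert (D1 := Cmod_ge_0 (d t)). assert (D2 := Cmod_ge_0 (d' t)).
  assert (C3 : Cmod (d' t) * Cmod (d'' t) <= Cmod (d' t) * (M * (Cmod (d t) + Cmod (d' t)))).
  { by apply Rmult_le_compat_l. }
  apply Rabs_le_between in C1. apply Rabs_le_between in C2.
  unfold L. set (p := Cmod (d t)) in *. set (q := Cmod (d' t)) in *.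
  assert (0 <= (p - q) * (p - q)) by apply Rle_0_sqr.
  assert (p * q <= (p * p + q * q) / 2) by lra.
  assert (0 <= M * (p * p)) by (apply Rmult_le_pos; [lra|apply Rle_0_sqr]).
  assert (0 <= M * (q * q)) by (apply Rmult_le_pos; [lra|apply Rle_0_sqr]).
  assert (M * (p * q) <= M * ((p * p + q * q) / 2)) by (apply Rmult_le_compat_l; lra).
  lra. }
(* This product is nondecreasing from [z1] on and vanishes at [z2]; being a sum of squares times a
   positive factor, it must vanish at [z1] as well. *)
set (F := fun t => E t * exp (L * t)).
set (F' := fun t => E' t * exp (L * t) + E t * (L * exp (L * t))).
assert (HF : forall t, 0 < t -> is_derive F t (F' t)).
{ intros t Ht. apply (is_derive_Rmult E (fun t => exp (L * t))); [by apply HE|].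
  auto_derive; auto. ring. }
destruct (MVT_gen F z1 z2 F') as [c [Hc Heq]].
- intros t Ht. rewrite Rmin_left in Ht; [|lra]. apply HF; lra.
- intros t Ht. rewrite Rmin_left in Ht; [|lra].
  apply continuity_pt_filterlim, (ex_derive_continuous (V := R_NormedModule)).
  eexists. apply HF; lra.
- rewrite Rmin_left in Hc; [|lra].
  assert (E2 : E z2 = 0). { unfold E. rewrite Hd2 Hd2' /=. ring. }
  assert (P1 : 0 <= E' c * exp (L * c) + E c * (L * exp (L * c))).
  { replace (_ + _) with ((E' c + L * E c) * exp (L * c)) by ring.
    apply Rmult_le_pos; [|left; apply exp_pos]. specialize (HE' c ltac:(lra)). lra. }
  unfold F, F' in Heq. rewrite E2 in Heq.
  assert (P2 : E z1 * exp (L * z1) <= 0) by nra.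
  assert (P3 : E z1 <= 0). { assert (T := exp_pos (L * z1)). nra. }
  assert (Q : Re (d z1) = 0 /\ Im (d z1) = 0) by (unfold E in P3; split; nra).
  rewrite (surjective_pairing (d z1)). destruct Q as [Q1 Q2].
  apply (f_equal2 (fun a b : R => (a, b))); auto.
Qed.

(** With u = ln z the modulus is the exponential of Re c * u - e^u, which [linear_le_exp] bounds. *)
Lemma Cmod_Cexp_Rcpow_bounded (c : C) :
  exists B, forall z, 1 < z -> Cmod (Cexp (RtoC (- z)) * Rcpow z c) <= B.
Proof.
destruct (linear_le_exp (Rabs (Re c)) 1 (Rabs_pos _) ltac:(lra)) as [K HK].
exists (exp K). intros z Hz.
rewrite Cmod_mult Cmod_Rcpow Cmod_Cexp -exp_plus. simpl.
assert (H : - z + Re c * ln z <= K).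
{ specialize (HK (ln z)). rewrite exp_ln in HK; [|lra].
  assert (0 < ln z) by (rewrite -ln_1; apply ln_increasing; lra).
  assert (Re c * ln z <= Rabs (Re c) * ln z).
  { apply Rmult_le_compat_r; [lra|apply Rle_abs]. } lra. }
destruct H as [H|H]; [left; by apply exp_increasing|right; by rewrite H].
Qed.

(* With W the Wronskian, y = (f2/f1 - 1) e^{-z} z^{b-2a} tends to 0 while
   y' tends to the constant e^{-z} z^b W, which therefore vanishes. *)
Lemma Kummer_recessive_unique (a b : C) (f1 f1' f1'' f2 f2' f2'' : R -> C) :
  Kummer a b f1 f1' f1'' -> Kummer a b f2 f2' f2'' ->
  Clim (fun z => Rcpow z a * f1 z)%C 1 -> Clim (fun z => Rcpow z a * f2 z)%C 1 ->
  forall z, 0 < z -> f2 z = f1 z.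
Proof.
intros H1 H2 L1 L2.
destruct (L1 (1 / 2) ltac:(lra)) as [Z0 [HZ0 HZ0']].
(* Beyond [Z] the function z^a f1 stays within 1/2 of 1, so the quotient f2/f1 is defined there. *)
set (Z := Z0 + 1).
assert (Hf1 : forall z, Z < z -> f1 z <> 0%C).
{ intros z Hz E. specialize (HZ0' z ltac:(unfold Z in Hz; lra)). rewrite E in HZ0'.
  replace (Rcpow z a * 0 - 1)%C with (- (1))%C in HZ0' by ring.
  rewrite Cmod_opp Cmod_1 in HZ0'. lra. }
set (W := fun z => (f1 z * f2' z - f1' z * f2 z)%C).
assert (HW : forall z, 0 < z -> Cder W z ((1 - b / RtoC z) * W z)%C).
{ intros z Hz. destruct (H1 z Hz) as [h1 [h2 h3]]. destruct (H2 z Hz) as [h4 [h5 h6]].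
  assert (Hzn : RtoC z <> 0%C) by (apply RtoC_neq_0; lra).
  unfold W. eapply Cder_eq. { apply Cder_minus; apply Cder_mult; eassumption. }
  replace ((f1' z * f2' z + f1 z * f2'' z - (f1'' z * f2 z + f1' z * f2' z)))%C with
   ((f1 z * (RtoC z * f2'' z + (b - RtoC z) * f2' z - a * f2 z) / RtoC z
    - f2 z * (RtoC z * f1'' z + (b - RtoC z) * f1' z - a * f1 z) / RtoC z)
    + (1 - b / RtoC z) * (f1 z * f2' z - f1' z * f2 z))%C by (field; auto).
  rewrite h3 h6. field; auto. }
(* Abel's identity: W' = (1 - b/z) W makes this product constant. *)
set (P := fun z => (Cexp (RtoC (- z)) * Rcpow z b * W z)%C).
assert (Hexp : forall z, Cder (fun z => Cexp (RtoC (- z))) z (- Cexp (RtoC (- z)))%C).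
{ intros z. eapply Cder_eq. { apply (Cder_Cexp_comp (fun z => RtoC (- z))), Cder_RtoC.
   apply (is_derive_opp (V := R_NormedModule)), (is_derive_id (K := R_AbsRing)). }
  rewrite /opp /one /=. rewrite RtoC_opp. ring. }
assert (HP : forall z, 0 < z -> Cder P z 0).
{ intros z Hz. assert (Hzn : RtoC z <> 0%C) by (apply RtoC_neq_0; lra).
  unfold P. eapply Cder_eq.
  { apply Cder_mult; [apply Cder_mult; [apply Hexp|apply Cder_Rcpow, Hz]|apply HW, Hz]. }
  cbv beta. field; auto. }
set (P0 := P 1).
assert (HP0 : forall z, 0 < z -> P z = P0) by (intros z Hz; apply (Cder_0_const P 0); auto; lra).
assert (HW0 : forall z, 0 < z -> W z = (P0 / (Cexp (RtoC (- z)) * Rcpow z b))%C).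
{ intros z Hz. rewrite -(HP0 z Hz). unfold P. field.
  split; [apply Rcpow_neq_0|apply Cexp_neq_0]. }
set (h := fun z => (f2 z * / f1 z)%C).
assert (Hh : forall z, Z < z -> Cder h z (W z / (f1 z * f1 z))%C).
{ intros z Hz. assert (Hz' : 0 < z) by (unfold Z in Hz; lra).
  destruct (H1 z Hz') as [h1 _]. destruct (H2 z Hz') as [h2 _].
  unfold h. eapply Cder_eq.
  { apply Cder_mult; [apply h2|apply Cder_inv; [by apply Hf1|apply h1]]. }
  cbv beta. unfold W. field. by apply Hf1. }
assert (Lh : Clim h 1).
{ apply (Clim_ext_loc (fun z => (Rcpow z a * f2 z) * / (Rcpow z a * f1 z))%C _ _ Z).
  - intros z Hz. unfold h. field. split; [by apply Hf1|apply Rcpow_neq_0].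
  - replace (RtoC 1) with (1 * 1)%C by ring. apply Clim_mult; auto. by apply Clim_inv_1. }
(* The derivative of f2/f1 is W / f1^2 = P0 e^z z^(-b) / f1^2. Multiplied by e^(-z) z^(b - 2a) it
   becomes P0 / (z^a f1)^2, which tends to [P0]. *)
set (c := (b - 2 * a)%C).
set (E := fun z => (Cexp (RtoC (- z)) * Rcpow z c)%C).
set (y := fun z => ((h z - 1) * E z)%C).
set (y' := fun z => (P0 * (/ (Rcpow z a * f1 z) * / (Rcpow z a * f1 z)) + y z * (c * / RtoC z - 1))%C).
assert (Ly : Clim y 0).
{ destruct (Cmod_Cexp_Rcpow_bounded c) as [B HB].
  intros eps Heps.
  assert (HB' : 0 < Rabs B + 1) by (assert (T := Rabs_pos B); lra).
  destruct (Lh (eps / (Rabs B + 1))) as [M [HM HM']]. { apply Rdiv_lt_0_compat; auto. }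
  exists (Rmax M 1). split. { apply Rlt_le_trans with (1 := HM), Rmax_l. }
  intros z Hz.
  assert (T1 := HM' z (Rle_lt_trans _ _ _ (Rmax_l M 1) Hz)).
  assert (T2 := HB z (Rle_lt_trans _ _ _ (Rmax_r M 1) Hz)).
  replace (y z - 0)%C with (y z) by ring. unfold y. rewrite Cmod_mult.
  apply Rle_lt_trans with (Cmod (h z - 1) * (Rabs B + 1)).
  - apply Rmult_le_compat_l; [apply Cmod_ge_0|]. unfold E. assert (T := Rle_abs B). lra.
  - apply (Rmult_lt_compat_r (Rabs B + 1)) in T1; auto.
    unfold Rdiv in T1. rewrite Rmult_assoc Rinv_l in T1; lra. }
assert (Linv := Clim_inv_id).
assert (Ly' : Clim y' P0).
{ apply (Clim_eq _ (P0 * (1 * 1) + 0 * (c * 0 - 1))%C); [ring|]. unfold y'.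
  apply Clim_plus; [apply Clim_scal; apply Clim_mult; by apply Clim_inv_1|].
  apply Clim_mult; auto. apply Clim_minus; [by apply Clim_scal|apply Clim_const]. }
assert (HP00 : P0 = 0%C).
{ apply (Clim_Cder y y' Z); auto.
  intros z Hz. assert (Hz' : 0 < z) by (unfold Z in Hz; lra).
  assert (Hzn : RtoC z <> 0%C) by (apply RtoC_neq_0; lra).
  unfold y, E. eapply Cder_eq.
  { apply Cder_mult; [apply Cder_minus; [by apply Hh|apply Cder_const]|].
    apply Cder_mult; [apply Hexp|apply Cder_Rcpow, Hz']. }
  cbv beta. rewrite (HW0 z Hz'). unfold y', y, E.
  assert (Ec : Rcpow z c = (Rcpow z b / (Rcpow z a * Rcpow z a))%C).
  { unfold c. replace (b - 2 * a)%C with (b + (- a + - a))%C by ring.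
    rewrite !Rcpow_plus Rcpow_opp. field. apply Rcpow_neq_0. }
  rewrite Ec.
  assert (N1 := Rcpow_neq_0 z a). assert (N2 := Rcpow_neq_0 z b). assert (N3 := Cexp_neq_0 (RtoC (- z))).
  assert (N4 := Hf1 z Hz). field. repeat split; auto. }
(* With the Wronskian zero, f2/f1 is constant beyond [Z] and equals its limit 1. It remains to carry
   f2 = f1 back to every z > 0, past possible zeros of [f1]. *)
assert (Hh0 : forall z, Z < z -> Cder h z 0).
{ intros z Hz. eapply Cder_eq. { by apply Hh. }
  rewrite HW0; [|unfold Z in Hz; lra]. rewrite HP00. field.
  assert (N := Hf1 z Hz). repeat split; auto; try apply Rcpow_neq_0; apply Cexp_neq_0. }
assert (Hh1 : forall z, Z < z -> h z = 1%C).
{ intros z Hz. apply (Clim_unique h); auto.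
  apply (Clim_ext_loc (fun _ => h z) _ _ Z); [|apply Clim_const].
  intros x Hx. by apply (Cder_0_const h Z). }
intros z Hz.
assert (D : (f2 z - f1 z = 0)%C).
{ apply (Kummer_backward_unique a b (fun z => f2 z - f1 z)%C (fun z => f2' z - f1' z)%C
   (fun z => f2'' z - f1'' z)%C Z); auto.
  - intros t Ht. destruct (H1 t Ht) as [h1 [h2 h3]]. destruct (H2 t Ht) as [h4 [h5 h6]].
    split; [|split]; [by apply Cder_minus|by apply Cder_minus|].
    replace (RtoC t * (f2'' t - f1'' t) + (b - RtoC t) * (f2' t - f1' t) - a * (f2 t - f1 t))%C with
     ((RtoC t * f2'' t + (b - RtoC t) * f2' t - a * f2 t) - (RtoC t * f1'' t + (b - RtoC t) * f1' t - a * f1 t))%C by ring.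
    rewrite h3 h6. ring.
  - intros t Ht. specialize (Hh1 t Ht). unfold h in Hh1.
    replace (f2 t) with (f2 t * / f1 t * f1 t)%C by (field; by apply Hf1). rewrite Hh1. ring. }
replace (f2 z) with ((f2 z - f1 z) + f1 z)%C by ring. rewrite D. ring.
Qed.

(** The witness [f] makes the [epsilon] choice satisfy its specification, and uniqueness of the
    recessive solution identifies the choice with [f] on z > 0. *)
Lemma Tricomi_eq (a b : C) (f f' f'' : R -> C) :
  Kummer a b f f' f'' -> Clim (fun z => Rcpow z a * f z)%C 1 ->
  forall z, 0 < z -> Tricomi a b z = f z.
Proof.
intros HK HL.
assert (HT : is_Tricomi a b (Tricomi a b)).
{ unfold Tricomi. apply epsilon_spec. exists f. apply is_Tricomi_Kummer. split; auto. by exists f', f''. }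
apply is_Tricomi_Kummer in HT. destruct HT as [[g' [g'' HK']] HL'].
apply (Kummer_recessive_unique a b f f' f'' _ g' g''); auto.
Qed.

(** * Existence of the Tricomi solution *)

Lemma sinh_ge (y : R) : 0 <= y -> y <= sinh y.
Proof.
intros Hy. destruct Hy as [Hy|Hy]; [|rewrite -Hy sinh_0; lra].
destruct (MVT_gen (fun t => sinh t - t) 0 y (fun t => cosh t - 1)) as [c [Hc E]].
- intros t _. unfold sinh, cosh. auto_derive; auto. field.
- intros t _. apply continuity_pt_filterlim.
  apply (ex_derive_continuous (V := R_NormedModule) (fun t => sinh t - t) t).
  unfold sinh. auto_derive; auto.
- rewrite sinh_0 in E.
  assert (Hcosh : 1 <= cosh c).
  { unfold cosh. rewrite exp_Ropp. assert (H := exp_pos c).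
    apply (Rmult_le_reg_r (2 * exp c)); [lra|].
    replace ((exp c + / exp c) / 2 * (2 * exp c)) with (exp c * exp c + 1) by (field; lra).
    assert (0 <= (exp c - 1) * (exp c - 1)) by apply Rle_0_sqr. lra. }
  assert (0 <= (cosh c - 1) * (y - 0)) by (apply Rmult_le_pos; lra). lra.
Qed.

Lemma sqr_le_sinh_sqr (y : R) : y * y <= sinh y * sinh y.
Proof.
destruct (Rle_dec 0 y) as [h|h].
- assert (H := sinh_ge y h). nra.
- assert (H := sinh_ge (- y) ltac:(lra)). 
  assert (E : sinh (- y) = - sinh y). { unfold sinh. rewrite Ropp_involutive. lra. }
  rewrite E in H. nra.
Qed.

(** The right-hand side is 4 sinh^2(x/2). *)
Lemma sqr_le_exp (x : R) : x * x <= exp x + exp (- x) - 2.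
Proof.
assert (H := sqr_le_sinh_sqr (x / 2)). unfold sinh in H.
assert (E1 : exp x = exp (x / 2) * exp (x / 2)) by (rewrite -exp_plus; f_equal; field).
assert (E2 : exp (- x) = exp (- (x / 2)) * exp (- (x / 2))) by (rewrite -exp_plus; f_equal; field).
assert (E3 : exp (x / 2) * exp (- (x / 2)) = 1) by (rewrite -exp_plus Rplus_opp_r; apply exp_0).
rewrite E1 E2. nra.
Qed.

Lemma cos_ge_quadratic (x : R) : 1 - x * x / 2 <= cos x.
Proof.
assert (E : cos x = 1 - 2 * sin (x / 2) * sin (x / 2)).
{ replace x with (2 * (x / 2)) at 1 by field. apply cos_2a_sin. }
rewrite E.
assert (G : forall y, 0 <= y -> sin y * sin y <= y * y).
{ intros y Hy. destruct (Rle_dec 1 y) as [h|h].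
  - assert (T := sin2_cos2 y). unfold Rsqr in T. assert (0 <= cos y * cos y) by apply Rle_0_sqr. nra.
  - destruct Hy as [Hy|Hy]; [|rewrite -Hy sin_0; lra].
    assert (sin y < y) by by apply sin_lt_x.
    assert (0 < sin y) by (apply sin_gt_0; [|assert (T := PI2_1); unfold PI2 in T]; lra). nra. }
destruct (Rle_dec 0 (x / 2)) as [h|h].
- specialize (G _ h). nra.
- specialize (G (- (x / 2)) ltac:(lra)). rewrite sin_neg in G. nra.
Qed.

(** [Cmod_bounded_variation] asks for control on a symmetric interval around its base point.
    Starting from the midpoint keeps that interval inside [x, y], as needed for functions controlled
    on one side only. *)
Lemma Cmod_mean_value (h dh : R -> C) (D x y : R) :
  x <= y -> (forall t, x <= t <= y -> Cder h t (dh t) /\ Cmod (dh t) <= D) ->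
  Cmod (h y - h x) <= 2 * D * (y - x).
Proof.
intros Hxy H. set (m := (x + y) / 2).
assert (H1 : Cmod (h y - h m) <= 2 * D * Rabs (y - m)).
{ apply (Cmod_bounded_variation h dh). intros t Ht. apply H.
  unfold m in *. revert Ht. split_Rabs; lra. }
assert (H2 : Cmod (h x - h m) <= 2 * D * Rabs (x - m)).
{ apply (Cmod_bounded_variation h dh). intros t Ht. apply H.
  unfold m in *. revert Ht. split_Rabs; lra. }
replace (h y - h x)%C with ((h y - h m) + - (h x - h m))%C by ring.
apply Rle_trans with (1 := Cmod_triangle _ _). rewrite Cmod_opp.
replace (2 * D * (y - x)) with (2 * D * Rabs (y - m) + 2 * D * Rabs (x - m)); [lra|].
unfold m. rewrite (Rabs_pos_eq (y - _)); [|lra]. rewrite (Rabs_left1 (x - _)); [|lra]. field.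
Qed.

Lemma Cmod_Rcpow_1_plus_le (c : C) (x : R) : 0 <= x -> Re c <= 0 -> Cmod (Rcpow (1 + x) c) <= 1.
Proof.
intros Hx Hc. rewrite Cmod_Rcpow.
apply Rle_trans with (exp 0); [apply exp_le|rewrite exp_0; lra].
assert (0 <= ln (1 + x)). { rewrite -ln_1. apply Rcomplements.ln_le; lra. }
assert (0 <= - Re c * ln (1 + x)) by (apply Rmult_le_pos; lra). lra.
Qed.

Lemma Cmod_Rcpow_1_plus_sub_1 (c : C) (x : R) : 0 <= x -> Re c <= 0 ->
  Cmod (Rcpow (1 + x) c - 1) <= 2 * Cmod c * x.
Proof.
intros Hx Hc.
replace (RtoC 1) with (Rcpow (1 + 0) c).
2:{ rewrite Rplus_0_r /Rcpow ln_1 Cmult_0_r. apply Cexp_0. }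
replace x with (x - 0) at 2 by ring.
apply (Cmod_mean_value (fun t => Rcpow (1 + t) c) (fun t => (c / RtoC (1 + t) * Rcpow (1 + t) c)%C)); auto.
intros t Ht. split.
- eapply Cder_eq. { apply (Cder_comp (fun t => Rcpow t c) (fun t => 1 + t) t 1).
    + apply Cder_Rcpow; lra.
    + auto_derive; auto. }
  ring.
- rewrite Cmod_mult Cmod_div; [|apply RtoC_neq_0; lra].
  rewrite Cmod_R Rabs_pos_eq; [|lra].
  assert (E1 := Cmod_Rcpow_1_plus_le c t ltac:(lra) Hc). assert (E0 := Cmod_ge_0 c).
  assert (E2 : Cmod c / (1 + t) <= Cmod c).
  { apply (Rmult_le_reg_r (1 + t)); [lra|]. unfold Rdiv. rewrite Rmult_assoc Rinv_l; [|lra]. nra. }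
  assert (E3 : 0 <= Cmod c / (1 + t)) by (apply Rdiv_le_0_compat; lra).
  assert (E4 := Cmod_ge_0 (Rcpow (1 + t) c)). nra.
Qed.

(** For u >= 0 the term z e^u absorbs (m + 1) u; for u < 0 the factor e^(m u) is enough because m >=
    1. *)
Lemma exp_exp_decay (m z : R) : 1 <= m -> 0 < z ->
  exists K, forall u, exp (m * u - z * exp u) <= K * exp (- Rabs u).
Proof.
intros Hm Hz. destruct (linear_le_exp (m + 1) z) as [K HK]; [lra|auto|].
exists (exp (Rabs K)). intros u. rewrite -exp_plus. apply exp_le.
assert (E := exp_pos u). assert (E1 := Rle_abs K). assert (E2 := Rabs_pos K).
destruct (Rle_dec 0 u) as [h|h].
- rewrite (Rabs_pos_eq u) //. specialize (HK u). lra.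
- rewrite (Rabs_left u); [|lra].
  assert (0 <= (m - 1) * - u) by (apply Rmult_le_pos; lra).
  assert (0 < z * exp u) by (apply Rmult_lt_0_compat; lra). lra.
Qed.

(** With t = e^u this is the [j]-th z-derivative of the integrand in the integral of t^(a-1) (1+t)^c
    e^(-z t) over t > 0, where c = b - a - 1 in the application. The measure dt/t = du moves the
    problem to the whole line. *)
Definition Laplace_kernel (a c : C) (j : nat) (z u : R) : C :=
  (RtoC ((- exp u) ^ j) * (Cexp (a * RtoC u) * Rcpow (1 + exp u) c * RtoC (exp (- (z * exp u)))))%C.

Section Laplace.
Variables (a c : C).
(** [Ha] gives the decay rate 1 as u tends to minus infinity, and [Hc] bounds the power of 1 + e^u
    by 1. *)
Hypothesis (Ha : 1 <= Re a) (Hc : Re c <= 0).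

Let one_exp_pos (u : R) : 0 < 1 + exp u.
Proof. assert (H := exp_pos u). lra. Qed.

Let base_Ccont (u : R) : Ccont (fun u => Cexp (a * RtoC u) * Rcpow (1 + exp u) c)%C u.
Proof.
apply Ccont_mult.
- eapply Cder_Ccont. apply Cder_Cexp.
- eapply Cder_Ccont. apply (Cder_comp (fun t => Rcpow t c) (fun u => 1 + exp u)).
  + apply Cder_Rcpow, one_exp_pos.
  + auto_derive; auto.
Qed.

Lemma Laplace_kernel_Ccont (j : nat) (z u : R) : Ccont (Laplace_kernel a c j z) u.
Proof.
apply Ccont_mult; [|apply Ccont_mult; [apply base_Ccont|]].
- apply Ccont_RtoC, (ex_derive_continuous (V := R_NormedModule)). auto_derive; auto.
- apply Ccont_RtoC, (ex_derive_continuous (V := R_NormedModule)). auto_derive; auto.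
Qed.

Lemma Cmod_Laplace_kernel (j : nat) (z u : R) :
  Cmod (Laplace_kernel a c j z u) <= exp ((Re a + INR j) * u - z * exp u).
Proof.
unfold Laplace_kernel. rewrite !Cmod_mult Cmod_Cexp !Cmod_R.
rewrite (Rabs_pos_eq (exp _)); [|left; apply exp_pos].
rewrite -RPow_abs Rabs_Ropp (Rabs_pos_eq (exp u)); [|left; apply exp_pos].
assert (E : exp u ^ j = exp (INR j * u)).
{ rewrite -Rpower_pow; [|apply exp_pos]. by rewrite /Rpower ln_exp. }
rewrite E.
replace (Re (a * RtoC u)%C) with (Re a * u) by (rewrite /Re /=; ring).
replace ((Re a + INR j) * u - z * exp u) with (INR j * u + (Re a * u + - (z * exp u))) by ring.
rewrite !exp_plus.
assert (B := Cmod_Rcpow_1_plus_le c (exp u) (Rlt_le _ _ (exp_pos u)) Hc).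
assert (P1 := exp_pos (INR j * u)). assert (P2 := exp_pos (Re a * u)). assert (P3 := exp_pos (- (z * exp u))).
apply Rmult_le_compat_l; [lra|]. apply Rmult_le_compat_r; [lra|].
rewrite -{2}(Rmult_1_r (exp _)). apply Rmult_le_compat_l; lra.
Qed.

Lemma Laplace_kernel_decays (j : nat) (z1 : R) : 0 < z1 ->
  exists K, forall z u, z1 <= z -> Cmod (Laplace_kernel a c j z u) <= K * exp (- Rabs u).
Proof.
intros Hz1. destruct (exp_exp_decay (Re a + INR j) z1) as [K HK]; auto.
{ assert (T := pos_INR j). lra. }
exists K. intros z u Hz. apply Rle_trans with (1 := Cmod_Laplace_kernel j z u).
apply Rle_trans with (2 := HK u). apply exp_le.
assert (E := exp_pos u). nra.
Qed.

Lemma Laplace_kernel_is_clint (j : nat) (z : R) : 0 < z ->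
  is_clint (Laplace_kernel a c j z) (CInt (Laplace_kernel a c j z)).
Proof.
intros Hz. apply is_clint_decays. { intros; apply Laplace_kernel_Ccont. }
destruct (Laplace_kernel_decays j z Hz) as [K HK]. exists K. intros s. apply HK; lra.
Qed.

Lemma Cder_Laplace_kernel (j : nat) (z u : R) :
  Cder (fun z => Laplace_kernel a c j z u) z (Laplace_kernel a c (S j) z u).
Proof.
unfold Laplace_kernel. eapply Cder_eq.
{ apply Cder_scal, Cder_scal, Cder_RtoC. instantiate (1 := - exp u * exp (- (z * exp u))).
  auto_derive; auto. ring. }
rewrite -tech_pow_Rmult !RtoC_mult. ring.
Qed.

Lemma Cder_Laplace (j : nat) (z : R) : 0 < z ->
  Cder (fun z => CInt (Laplace_kernel a c j z)) z (CInt (Laplace_kernel a c (S j) z)).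
Proof.
intros Hz.
destruct (Laplace_kernel_decays (S (S j)) (z / 2)) as [K HK]; [lra|].
assert (Hy : forall y, Rabs (y - z) < z / 2 -> z / 2 <= y).
{ intros y. split_Rabs; lra. }
apply (Cder_CInt (Laplace_kernel a c j) (Laplace_kernel a c (S j)) (Laplace_kernel a c (S (S j))) z (z / 2) K).
- lra.
- intros y s _. apply Cder_Laplace_kernel.
- intros y s _. apply Cder_Laplace_kernel.
- intros y s H. by apply HK, Hy.
- intros; apply Laplace_kernel_Ccont.
- intros; apply Laplace_kernel_Ccont.
- intros y H. destruct (Laplace_kernel_decays j (z / 2)) as [K' HK']; [lra|].
  exists K'. intros s. by apply HK', Hy.
- destruct (Laplace_kernel_decays (S j) z Hz) as [K' HK'].
  exists K'. intros s. apply HK'; lra.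
Qed.

(** For t = e^u the combination of the three integrands is the u-derivative of -t^a (1+t)^(c+1)
    e^(-z t), so its integral vanishes. *)
Lemma Laplace_Kummer (b : C) : (c = b - a - 1)%C ->
  Kummer a b (fun z => CInt (Laplace_kernel a c 0 z)) (fun z => CInt (Laplace_kernel a c 1 z))
    (fun z => CInt (Laplace_kernel a c 2 z)).
Proof.
intros Ec z Hz. split; [|split]; [by apply Cder_Laplace|by apply Cder_Laplace|].
set (h := fun u => (- (1) * (Cexp (a * RtoC u) * (Rcpow (1 + exp u) (c + 1) * RtoC (exp (- (z * exp u))))))%C).
set (h' := fun u => (RtoC z * Laplace_kernel a c 2 z u + (b - RtoC z) * Laplace_kernel a c 1 z u
   - a * Laplace_kernel a c 0 z u)%C).
assert (Hh' : is_clint h' (RtoC z * CInt (Laplace_kernel a c 2 z)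
   + (b - RtoC z) * CInt (Laplace_kernel a c 1 z) - a * CInt (Laplace_kernel a c 0 z))%C).
{ apply is_clint_minus; [apply is_clint_plus|]; apply is_clint_scal; by apply Laplace_kernel_is_clint. }
rewrite -(is_clint_CInt _ _ Hh'). apply is_clint_CInt.
apply (is_clint_derivative h).
- intros u. unfold h. assert (Hu := one_exp_pos u). eapply Cder_eq.
  { apply Cder_scal, Cder_mult; [apply Cder_Cexp|apply Cder_mult].
    - apply (Cder_comp (fun t => Rcpow t (c + 1)) (fun u => 1 + exp u) u (exp u)).
      + by apply Cder_Rcpow.
      + auto_derive; auto. ring.
    - apply Cder_RtoC. instantiate (1 := - (z * exp u) * exp (- (z * exp u))). auto_derive; auto. ring. }
  cbv beta. rewrite Rcpow_plus (Rcpow_1_r _ Hu).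
  unfold h', Laplace_kernel. replace b with (c + a + 1)%C by (rewrite Ec; ring).
  assert (Hn : (1 + RtoC (exp u))%C <> 0%C) by (rewrite -RtoC_plus; apply RtoC_neq_0; lra).
  replace ((- exp u) ^ 0) with 1 by ring. replace ((- exp u) ^ 1) with (- exp u) by ring.
  replace ((- exp u) ^ 2) with (exp u * exp u) by ring.
  rewrite !RtoC_mult !RtoC_plus !RtoC_opp !RtoC_mult. field. auto.
- intros u. unfold h'. apply Ccont_minus; [apply Ccont_plus|]; apply Ccont_mult;
  try apply Ccont_const; apply Laplace_kernel_Ccont.
- destruct (Laplace_kernel_decays 0 z Hz) as [K0 HK0].
  destruct (Laplace_kernel_decays 1 z Hz) as [K1 HK1].
  exists (K0 + K1). intros u. unfold h.
  rewrite Rcpow_plus (Rcpow_1_r _ (one_exp_pos u)).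
  (* -(1 + t) times the kernel of order 0 is the kernel of order 1 minus that of order 0, so the
     known decay of these two transfers to [h]. *)
  replace (_ * _)%C with (Laplace_kernel a c 1 z u - Laplace_kernel a c 0 z u)%C.
  2:{ unfold Laplace_kernel. replace ((- exp u) ^ 0) with 1 by ring. replace ((- exp u) ^ 1) with (- exp u) by ring.
      rewrite RtoC_plus RtoC_opp. ring. }
  apply Rle_trans with (1 := Cmod_triangle _ _). rewrite Cmod_opp.
  specialize (HK0 z u ltac:(lra)). specialize (HK1 z u ltac:(lra)). lra.
Qed.

(** Euler's integral for Gamma(a) after t = e^u; it is the limit of the rescaled Laplace
    integral. *)
Definition Gamma_kernel (u : R) : C := (Cexp (a * RtoC u) * RtoC (exp (- exp u)))%C.

Lemma Gamma_kernel_Ccont (u : R) : Ccont Gamma_kernel u.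
Proof.
apply Ccont_mult.
- eapply Cder_Ccont. apply Cder_Cexp.
- apply Ccont_RtoC, (ex_derive_continuous (V := R_NormedModule)). auto_derive; auto.
Qed.

Lemma Cmod_Gamma_kernel (u : R) : Cmod (Gamma_kernel u) = exp (Re a * u - exp u).
Proof.
unfold Gamma_kernel. rewrite Cmod_mult Cmod_Cexp Cmod_R Rabs_pos_eq; [|left; apply exp_pos].
rewrite -exp_plus. f_equal. rewrite /Re /=. ring.
Qed.

Lemma Gamma_is_clint : is_clint Gamma_kernel (CInt Gamma_kernel).
Proof.
apply is_clint_decays. { apply Gamma_kernel_Ccont. }
destruct (exp_exp_decay (Re a) 1) as [K HK]; [auto|lra|].
exists K. intros s. rewrite Cmod_Gamma_kernel. specialize (HK s). by rewrite Rmult_1_l in HK.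
Qed.

(* The substitution u -> u - ln z. *)
Lemma Laplace_rescaled (j : nat) (z : R) : 0 < z ->
  is_clint (fun u => RtoC ((- (exp u / z)) ^ j) * (Gamma_kernel u * Rcpow (1 + exp u / z) c))%C
    (Rcpow z a * CInt (Laplace_kernel a c j z))%C.
Proof.
intros Hz.
apply (is_clint_ext (fun u => (fun u => Rcpow z a * Laplace_kernel a c j z u)%C (u + - ln z))).
- intros u. unfold Laplace_kernel, Gamma_kernel.
  assert (E : exp (u + - ln z) = exp u / z) by (rewrite exp_plus exp_Ropp exp_ln //).
  rewrite E.
  replace (Cexp (a * RtoC (u + - ln z))) with (Cexp (a * RtoC u) / Rcpow z a)%C.
  2:{ rewrite /Cdiv -Rcpow_opp /Rcpow -Cexp_plus RtoC_plus RtoC_opp. f_equal. ring. }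
  replace (z * (exp u / z)) with (exp u) by (field; lra).
  field. apply Rcpow_neq_0.
- apply (is_clint_shift (fun u => Rcpow z a * Laplace_kernel a c j z u)%C).
  + intros x. apply Ccont_mult; [apply Ccont_const|apply Laplace_kernel_Ccont].
  + by apply is_clint_scal, Laplace_kernel_is_clint.
Qed.

Let scaled_Ccont (z u : R) : 0 < z -> Ccont (fun u => Rcpow (1 + exp u / z) c) u.
Proof.
intros Hz. eapply Cder_Ccont. apply (Cder_comp (fun t => Rcpow t c) (fun u => 1 + exp u / z)).
- apply Cder_Rcpow. assert (0 < exp u / z) by (apply Rdiv_lt_0_compat; [apply exp_pos|auto]). lra.
- auto_derive; auto.
Qed.

(** After rescaling, (1 + e^u/z)^c differs from 1 by at most 2 |c| e^u / z. The extra e^u only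
    raises the Gamma exponent by one, so the error is O(1/z). *)
Lemma Laplace_lim : Clim (fun z => Rcpow z a * CInt (Laplace_kernel a c 0 z))%C (CInt Gamma_kernel).
Proof.
destruct (exp_exp_decay (Re a + 1) 1) as [K HK]; [lra|lra|].
apply (Clim_le _ _ (8 * (2 * Cmod c * K)) 0). intros z Hz.
assert (Hx : forall u, 0 <= exp u / z).
{ intros u. apply Rdiv_le_0_compat; auto. left; apply exp_pos. }
assert (HI := is_clint_minus _ _ _ _ (Laplace_rescaled 0 z Hz) Gamma_is_clint).
replace (8 * (2 * Cmod c * K) / z) with (8 * (2 * Cmod c * K / z)) by (field; lra).
apply is_clint_decay_le with (3 := HI).
- intros s. apply Ccont_minus; [|apply Gamma_kernel_Ccont].
  apply Ccont_mult; [apply Ccont_const|]. apply Ccont_mult; [apply Gamma_kernel_Ccont|by apply scaled_Ccont].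
- intros u. 
  replace (_ - _)%C with (Gamma_kernel u * (Rcpow (1 + exp u / z) c - 1))%C by (simpl; ring).
  rewrite Cmod_mult Cmod_Gamma_kernel.
  assert (B := Cmod_Rcpow_1_plus_sub_1 c (exp u / z) (Hx u) Hc).
  apply Rle_trans with (exp (Re a * u - exp u) * (2 * Cmod c * (exp u / z))).
  { apply Rmult_le_compat_l; auto. left; apply exp_pos. }
  replace (exp (Re a * u - exp u) * (2 * Cmod c * (exp u / z))) with
    (2 * Cmod c / z * exp ((Re a + 1) * u - 1 * exp u)).
  2:{ replace ((Re a + 1) * u - 1 * exp u) with ((Re a * u - exp u) + u) by ring.
      rewrite (exp_plus _ u). field; lra. }
  replace (2 * Cmod c * K / z * exp (- Rabs u)) with (2 * Cmod c / z * (K * exp (- Rabs u))) by (field; lra).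
  apply Rmult_le_compat_l; auto.
  apply Rdiv_le_0_compat; auto. assert (T := Cmod_ge_0 c). lra.
Qed.

(** The derivative brings the factor -e^u/z into the rescaled integrand, so the whole integral is
    O(1/z). *)
Lemma Laplace_lim' : Clim (fun z => Rcpow z a * CInt (Laplace_kernel a c 1 z))%C 0.
Proof.
destruct (exp_exp_decay (Re a + 1) 1) as [K HK]; [lra|lra|].
apply (Clim_le _ _ (8 * K) 0). intros z Hz.
assert (Hx : forall u, 0 <= exp u / z).
{ intros u. apply Rdiv_le_0_compat; auto. left; apply exp_pos. }
assert (HI := Laplace_rescaled 1 z Hz).
replace (_ - 0)%C with (Rcpow z a * CInt (Laplace_kernel a c 1 z))%C by ring.
replace (8 * K / z) with (8 * (K / z)) by (field; lra).
apply is_clint_decay_le with (3 := HI).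
- intros s. apply Ccont_mult.
  + apply Ccont_RtoC, (ex_derive_continuous (V := R_NormedModule)). auto_derive; auto.
  + apply Ccont_mult; [apply Gamma_kernel_Ccont|by apply scaled_Ccont].
- intros u. rewrite Cmod_mult (Cmod_mult (Gamma_kernel u)) Cmod_Gamma_kernel Cmod_R pow_1 Rabs_Ropp Rabs_pos_eq //.
  assert (B := Cmod_Rcpow_1_plus_le c (exp u / z) (Hx u) Hc).
  apply Rle_trans with (exp u / z * (exp (Re a * u - exp u) * 1)).
  { apply Rmult_le_compat_l; auto. apply Rmult_le_compat_l; auto. left; apply exp_pos. }
  replace (exp u / z * (exp (Re a * u - exp u) * 1)) with (exp ((Re a + 1) * u - 1 * exp u) / z).
  2:{ replace ((Re a + 1) * u - 1 * exp u) with ((Re a * u - exp u) + u) by ring.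
      rewrite (exp_plus _ u). field; lra. }
  replace (K / z * exp (- Rabs u)) with (K * exp (- Rabs u) / z) by (field; lra).
  apply Rmult_le_compat_r; auto. left; by apply Rinv_0_lt_compat.
Qed.

End Laplace.

(** * Non-vanishing of the Gamma integral *)

Lemma is_lint_pos (f : R -> R) (l : R) :
  (forall x, continuous f x) -> (forall x, 0 < f x) -> is_lint f l -> 0 < l.
Proof.
intros Hf Hp H. move: (proj1 (is_lint_eps f l Hf) H) => {}H.
assert (Hex : forall a b, ex_RInt f a b)
  by (intros; apply (ex_RInt_continuous (V := R_CompleteNormedModule)); auto).
assert (P : 0 < RInt f 0 1). { apply RInt_gt_0; auto; lra. }
destruct (H (mkposreal _ P)) as [M HM]. simpl in HM.
set (N := Rabs M + 1). assert (HN : M < N /\ 0 < N /\ 1 <= N).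
{ unfold N. assert (T := Rle_abs M). assert (T2 := Rabs_pos M). lra. }
specialize (HM (- N) N ltac:(lra) ltac:(lra)).
assert (E : RInt f 0 1 <= RInt f (- N) N).
{ rewrite -(RInt_Chasles (V := R_CompleteNormedModule) f (- N) 0 N); [|by auto..].
  rewrite -(RInt_Chasles (V := R_CompleteNormedModule) f 0 1 N); [|by auto..].
  assert (0 <= RInt f (- N) 0). { apply RInt_ge_0; auto; try lra. intros; left; auto. }
  assert (0 <= RInt f 1 N). { apply RInt_ge_0; auto; try lra. intros; left; auto. }
  rewrite /plus /=. lra. }
revert HM. split_Rabs; lra.
Qed.

(* Re (s^{-i t} Gamma(s + i t)) >= int e^{s u - e^u} (1 - t^2 (u - ln s)^2 / 2) du,
   which is positive since (u - ln s)^2 <= e^u / s + s e^{-u} - 2. *)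
Lemma Gamma_neq_0 (a : C) : 2 <= Re a -> Im a * Im a / 2 < Re a - 1 ->
  CInt (Gamma_kernel a) <> 0%C.
Proof.
intros Ha Ht. set (s := Re a) in *. set (t := Im a) in *.
set (g := fun m u : R => exp (m * u - exp u)).
assert (Hg : forall m u, continuous (g m) u).
{ intros m u. apply (ex_derive_continuous (V := R_NormedModule)). unfold g. auto_derive; auto. }
assert (Hex : forall m, 1 <= m -> exists G, is_lint (g m) G).
{ intros m Hm. destruct (exp_exp_decay m 1) as [K HK]; [auto|lra|].
  apply (ex_lint_dominated (g m) (fun u => K * decay_ref u) (K * 4)).
  - apply Hg. - apply decay_bound_cont.
  - intros u. rewrite Rabs_pos_eq; [|left; apply exp_pos]. apply le_decay_bound; [left; apply exp_pos|].
    specialize (HK u). by rewrite Rmult_1_l in HK.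
  - apply is_lint_decay_bound. }
(* Gamma(m + 1) = m Gamma(m), since [m * g m - g (m + 1)] is the u-derivative of [g m]. *)
assert (Hrec : forall m G, 1 <= m -> is_lint (g m) G -> is_lint (g (m + 1)) (m * G)).
{ intros m G Hm HG. destruct (Hex (m + 1) ltac:(lra)) as [G' HG'].
  replace (m * G) with G'; auto.
  destruct (exp_exp_decay m 1) as [K HK]; [auto|lra|].
  assert (H0 : is_clint (fun u => RtoC (m * g m u - g (m + 1) u)) 0).
  { apply (is_clint_derivative (fun u => RtoC (g m u))).
    - intros u. apply Cder_RtoC. unfold g. auto_derive; auto.
      replace ((m + 1) * u - exp u) with ((m * u - exp u) + u) by ring. rewrite (exp_plus _ u). rewrite /Rminus. ring.
    - intros u. apply Ccont_RtoC, (continuous_minus (V := R_NormedModule)); [|apply Hg].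
      apply (continuous_scal_r (K := R_AbsRing) (V := R_NormedModule)), Hg.
    - exists K. intros u. rewrite Cmod_R Rabs_pos_eq; [|left; apply exp_pos]. specialize (HK u). by rewrite Rmult_1_l in HK. }
  destruct H0 as [H0 _].
  assert (H1 := is_RInt_gen_minus (V := R_NormedModule) _ _ _ _ (is_RInt_gen_scal (V := R_NormedModule) _ m _ HG) HG').
  assert (E := is_lint_unique _ _ _ H0 H1). rewrite /minus /scal /plus /opp /= /mult /= in E. lra. }
(* [G0] and [G] are Gamma(s - 1) and Gamma(s); expressing all in terms of [G0] makes the final
   comparison explicit. *)
destruct (Hex (s - 1) ltac:(lra)) as [G0 HG0].
set (G := (s - 1) * G0).
assert (HG : is_lint (g s) G).
{ replace s with (s - 1 + 1) by ring. apply Hrec; auto; lra. }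
assert (HG1 : is_lint (g (s + 1)) (s * G)) by (apply Hrec; auto; lra).
assert (HG0p : 0 < G0). { apply (is_lint_pos (g (s - 1))); auto. intros; apply exp_pos. }
intros E0.
(* The unimodular factor s^(-i t) centres the oscillation at u = ln s, where s u - e^u is
   maximal. *)
set (w := Cexp (0, - (t * ln s))).
assert (HI : is_clint (fun u => w * Gamma_kernel a u)%C (w * 0)%C).
{ apply is_clint_scal. rewrite -E0. apply Gamma_is_clint. unfold s in Ha. lra. }
destruct HI as [HI _].
(* Multiplying [g s u] by e^(u - ln s) or by its inverse shifts the exponent by one, so the lower
   bound integrates to values of Gamma at s - 1, s and s + 1. *)
assert (Hlow : is_lint (fun u => (1 + t * t) * g s u - t * t / 2 * (/ s * g (s + 1) u + s * g (s - 1) u))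
   ((1 + t * t) * G - t * t / 2 * (/ s * (s * G) + s * G0))).
{ apply (is_RInt_gen_minus (V := R_NormedModule)).
  - apply (is_RInt_gen_scal (V := R_NormedModule)), HG.
  - apply (is_RInt_gen_scal (V := R_NormedModule)), (is_RInt_gen_plus (V := R_NormedModule));
    by apply (is_RInt_gen_scal (V := R_NormedModule)). }
assert (Hle : (1 + t * t) * G - t * t / 2 * (/ s * (s * G) + s * G0) <= Re (w * 0)%C).
{ apply (is_lint_le _ _ _ _) with (4 := Hlow) (5 := HI).
  - intros u. apply (ex_derive_continuous (V := R_NormedModule)). unfold g. auto_derive; auto.
  - intros u. exact (proj1 (Ccont_mult (fun _ => w) (Gamma_kernel a) u (Ccont_const w u) (Gamma_kernel_Ccont a u))).
  - intros u.
    set (v := u - ln s).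
    replace (Re (w * Gamma_kernel a u)%C) with (g s u * cos (t * v)).
    2:{ unfold w, Gamma_kernel. rewrite Cmult_assoc -Cexp_plus.
        rewrite /Cexp /Re /Im /=. change (fst a) with s. change (snd a) with t. unfold g.
        replace (exp (s * u - exp u)) with (exp (0 + (s * u - t * 0)) * exp (- exp u)).
        2:{ rewrite -exp_plus. f_equal. ring. }
        replace (- (t * ln s) + (s * 0 + t * u)) with (t * v) by (unfold v; ring). ring. }
    assert (E1 : g (s + 1) u = s * (g s u * exp v)).
    { unfold g, v. unfold Rminus at 3. rewrite (exp_plus u (- ln s)) exp_Ropp exp_ln; [|lra].
      replace ((s + 1) * u - exp u) with ((s * u - exp u) + u) by ring. rewrite (exp_plus _ u). field; lra. }
    assert (E2 : g (s - 1) u = / s * (g s u * exp (- v))).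
    { unfold g, v. replace (- (u - ln s)) with (ln s + - u) by ring.
      rewrite (exp_plus (ln s)) exp_ln; [|lra].
      replace ((s - 1) * u - exp u) with ((s * u - exp u) + - u) by ring. rewrite (exp_plus _ (- u)). field; lra. }
    rewrite E1 E2.
    assert (C1 := cos_ge_quadratic (t * v)). assert (C2 := sqr_le_exp v).
    replace (_ - _) with (g s u * (1 - t * t / 2 * (exp v + exp (- v) - 2))) by (field; lra).
    apply Rmult_le_compat_l; [left; apply exp_pos|].
    assert (C3 : t * t * (v * v) <= t * t * (exp v + exp (- v) - 2)).
    { apply Rmult_le_compat_l; auto. apply Rle_0_sqr. }
    lra. }
replace (Re (w * 0)%C) with 0 in Hle by (rewrite /Re /=; ring).
(* Once G = (s - 1) G0 is inserted the bound collapses to this product, and the hypothesis on Im a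
   is exactly its positivity. *)
replace (_ - _) with (G0 * (s - 1 - t * t / 2)) in Hle by (unfold G; field; lra).
assert (0 < G0 * (s - 1 - t * t / 2)) by (apply Rmult_lt_0_compat; lra). lra.
Qed.

(** The limit for [w1] strengthens the Tricomi normalisation. It feeds the lowering relation and the
    polynomial bound on the derivative. *)
Definition Kummer_recessive (a b : C) (w w1 w2 : R -> C) : Prop :=
  Kummer a b w w1 w2 /\ Clim (fun z => Rcpow z a * w z)%C 1 /\ Clim (fun z => Rcpow z a * w1 z)%C 0.

(** The first two conditions give Gamma(a) <> 0 and the third gives Re (b - a - 1) <= 0. All three
    hold once a large enough integer has been added to [a]. *)
Lemma ex_Kummer_recessive_large (a b : C) :
  2 <= Re a -> Im a * Im a / 2 < Re a - 1 -> Re b - Re a - 1 <= 0 ->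
  exists w w1 w2, Kummer_recessive a b w w1 w2.
Proof.
intros Ha Ht Hb. set (c := (b - a - 1)%C).
assert (Hc : Re c <= 0) by (unfold c; rewrite /Re /= in Hb |- *; lra).
assert (Ha' : 1 <= Re a) by lra.
assert (HG := Gamma_neq_0 a Ha Ht). set (G := CInt (Gamma_kernel a)) in *.
exists (fun z => / G * CInt (Laplace_kernel a c 0 z))%C, (fun z => / G * CInt (Laplace_kernel a c 1 z))%C,
  (fun z => / G * CInt (Laplace_kernel a c 2 z))%C.
split; [|split].
- intros z Hz. destruct (Laplace_Kummer a c Ha' Hc b (eq_refl _) z Hz) as [h1 [h2 h3]].
  split; [|split]; [by apply Cder_scal|by apply Cder_scal|].
  set (w0 := CInt (Laplace_kernel a c 0 z)) in *. set (w1 := CInt (Laplace_kernel a c 1 z)) in *.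
  set (w2 := CInt (Laplace_kernel a c 2 z)) in *.
  replace (RtoC z * (/ G * w2) + (b - RtoC z) * (/ G * w1) - a * (/ G * w0))%C with
   (/ G * (RtoC z * w2 + (b - RtoC z) * w1 - a * w0))%C by ring. rewrite h3. ring.
- apply (Clim_ext (fun z => / G * (Rcpow z a * CInt (Laplace_kernel a c 0 z)))%C). { intros; ring. }
  replace (RtoC 1) with (/ G * G)%C by (field; auto). apply Clim_scal, Laplace_lim; auto.
- apply (Clim_ext (fun z => / G * (Rcpow z a * CInt (Laplace_kernel a c 1 z)))%C). { intros; ring. }
  replace (RtoC 0) with (/ G * 0)%C by ring. apply Clim_scal, Laplace_lim'; auto.
Qed.

(* U(a) = (a + 1 - b + z) U(a+1) - z U'(a+1), whose derivative is a (U'(a+1) - U(a+1)). *)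
Lemma Kummer_recessive_lower (a b : C) (w w1 w2 : R -> C) :
  Kummer_recessive (a + 1) b w w1 w2 -> exists v v1 v2, Kummer_recessive a b v v1 v2.
Proof.
intros [HK [L0 L1]].
exists (fun z => (a + 1 - b + RtoC z) * w z - RtoC z * w1 z)%C, (fun z => a * (w1 z - w z))%C,
  (fun z => a * (w2 z - w1 z))%C.
assert (Hid : forall z, Cder (fun z => RtoC z) z 1).
{ intros z. apply Cder_RtoC. apply (is_derive_id (K := R_AbsRing)). }
assert (Hp : forall z, 0 < z -> Rcpow z a = (Rcpow z (a + 1) * / RtoC z)%C).
{ intros z Hz. rewrite Rcpow_plus Rcpow_1_r //. field. apply RtoC_neq_0; lra. }
split; [|split].
- intros z Hz. destruct (HK z Hz) as [h1 [h2 h3]].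
  split; [|split].
  + eapply Cder_eq.
    { apply Cder_minus; apply Cder_mult; [apply Cder_plus; [apply Cder_const|apply Hid]|exact h1|apply Hid|exact h2]. }
    cbv beta.
    replace (_ - _)%C with (- (RtoC z * w2 z + (b - RtoC z) * w1 z - (a + 1) * w z) + a * (w1 z - w z))%C by ring.
    rewrite h3. ring.
  + apply Cder_scal. by apply Cder_minus.
  + replace (_ - _)%C with (a * (RtoC z * w2 z + (b - RtoC z) * w1 z - (a + 1) * w z))%C by ring.
    rewrite h3. ring.
- apply (Clim_ext (fun z => ((a + 1 - b) * / RtoC z + 1) * (Rcpow z (a + 1) * w z) - Rcpow z (a + 1) * w1 z)%C).
  { intros z Hz. rewrite Hp //. field. apply RtoC_neq_0; lra. }
  (* The known limit of the derivative enters here: the relation multiplies it by z, so without that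
     limit it could compete with the leading term. *)
  apply (Clim_eq _ (((a + 1 - b) * 0 + 1) * 1 - 0)%C); [ring|].
  apply Clim_minus; auto. apply Clim_mult; auto.
  apply Clim_plus; [apply Clim_scal, Clim_inv_id|apply Clim_const].
- apply (Clim_ext (fun z => a * (/ RtoC z * (Rcpow z (a + 1) * w1 z - Rcpow z (a + 1) * w z)))%C).
  { intros z Hz. rewrite Hp //. ring. }
  apply (Clim_eq _ (a * (0 * (0 - 1)))%C); [ring|].
  apply Clim_scal, Clim_mult; [apply Clim_inv_id|by apply Clim_minus].
Qed.

Lemma ex_Kummer_recessive (a b : C) : exists w w1 w2, Kummer_recessive a b w w1 w2.
Proof.
assert (G : forall n (a : C), 2 <= Re a + INR n -> Im a * Im a / 2 < Re a + INR n - 1 ->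
   Re b - (Re a + INR n) - 1 <= 0 -> exists w w1 w2, Kummer_recessive a b w w1 w2).
{ induction n as [|n IH].
  - intros c. rewrite Rplus_0_r. apply ex_Kummer_recessive_large.
  - intros c H1 H2 H3. rewrite S_INR in H1 H2 H3.
    destruct (IH (c + 1)%C) as [w [w1 [w2 H]]].
    + rewrite /Re /= in H1 |- *. lra.
    + replace (Im (c + 1)%C) with (Im c) by (rewrite /Im /=; ring). rewrite /Re /= in H2 |- *. lra.
    + rewrite /Re /= in H3 |- *. lra.
    + by apply (Kummer_recessive_lower c b w w1 w2). }
(* This many unit shifts of [a] meet all three conditions of [ex_Kummer_recessive_large] at once. *)
destruct (INR_unbounded (2 + Im a * Im a / 2 + Rabs (Re b) + Rabs (Re a))) as [n Hn].
assert (T1 := Rle_abs (Re b)). assert (T2 := Rabs_maj2 (Re a)). assert (T3 := Rabs_pos (Re b)).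
assert (T4 : 0 <= Im a * Im a) by apply Rle_0_sqr.
apply (G n a); lra.
Qed.

(** * The Gaussian integral *)

Lemma gauss_continuous (t : R) : continuous (fun t => exp (- (t * t))) t.
Proof. apply (ex_derive_continuous (V := R_NormedModule)). auto_derive; auto. Qed.

Lemma gauss_ex_RInt (a b : R) : ex_RInt (fun t => exp (- (t * t))) a b.
Proof. apply (ex_RInt_continuous (V := R_CompleteNormedModule)). intros; apply gauss_continuous. Qed.

(** The classical companion of the squared primitive: its derivative is the opposite of that of
    [gauss_prim x * gauss_prim x], so the Gaussian integral needs no double integral. *)
Definition gauss_aux (x : R) : R := RInt (fun t => exp (- (x * x * (1 + t * t))) / (1 + t * t)) 0 1.
Definition gauss_prim (x : R) : R := RInt (fun t => exp (- (t * t))) 0 x.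

Lemma gauss_aux_continuous (x t : R) :
  continuous (fun t => exp (- (x * x * (1 + t * t))) / (1 + t * t)) t.
Proof. apply (ex_derive_continuous (V := R_NormedModule)). auto_derive; auto. nra. Qed.

Lemma gauss_aux_ex_RInt (x a b : R) :
  ex_RInt (fun t => exp (- (x * x * (1 + t * t))) / (1 + t * t)) a b.
Proof. apply (ex_RInt_continuous (V := R_CompleteNormedModule)). intros; apply gauss_aux_continuous. Qed.

Lemma gauss_aux_derive (x : R) : is_derive gauss_aux x (- 2 * exp (- (x * x)) * gauss_prim x).
Proof.
assert (HD : forall u t, is_derive (fun u => exp (- (u * u * (1 + t * t))) / (1 + t * t)) u
   (- 2 * u * exp (- (u * u * (1 + t * t))))).
{ intros u t. assert (0 <= t * t) by apply Rle_0_sqr. auto_derive; [lra|]. field. lra. }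
assert (E : RInt (fun t => Derive (fun u => exp (- (u * u * (1 + t * t))) / (1 + t * t)) x) 0 1
  = - 2 * exp (- (x * x)) * gauss_prim x).
(* The integrand is put in the form of a linear substitution t -> x t + 0, which turns the integral
   over [0, 1] into [gauss_prim x]. *)
{ rewrite (RInt_ext _ (fun t => scal (- 2 * exp (- (x * x))) (scal x (exp (- ((x * t + 0) * (x * t + 0))))))).
  - rewrite RInt_scal.
    + rewrite (RInt_comp_lin (V := R_CompleteNormedModule) (fun t => exp (- (t * t))) x 0 0 1).
      * unfold gauss_prim. rewrite /scal /= /mult /=. f_equal. f_equal; ring.
      * apply gauss_ex_RInt.
    + apply (ex_RInt_continuous (V := R_CompleteNormedModule)). intros t _.
      apply (ex_derive_continuous (V := R_NormedModule)). rewrite /scal /= /mult /=. auto_derive; auto.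
  - intros t _. rewrite (is_derive_unique _ _ _ (HD x t)).
    rewrite /scal /= /mult /=.
    replace (- (x * x * (1 + t * t))) with (- (x * x) + - ((x * t + 0) * (x * t + 0))) by ring.
    rewrite exp_plus. ring. }
rewrite -E. unfold gauss_aux.
apply (is_derive_RInt_param (fun u t => exp (- (u * u * (1 + t * t))) / (1 + t * t))).
- apply filter_forall. intros u t _. eexists. apply HD.
- intros t _. apply (continuity_2d_pt_ext (fun u t => - 2 * u * exp (- (u * u * (1 + t * t))))).
  { intros u v. by rewrite (is_derive_unique _ _ _ (HD u v)). }
  apply continuity_2d_pt_mult.
  + apply continuity_2d_pt_mult; [apply continuity_2d_pt_const|apply continuity_2d_pt_id1].
  + apply (continuity_1d_2d_pt_comp exp). { apply derivable_continuous_pt, derivable_pt_exp. }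
    apply continuity_2d_pt_opp, continuity_2d_pt_mult.
    * apply continuity_2d_pt_mult; apply continuity_2d_pt_id1.
    * apply continuity_2d_pt_plus; [apply continuity_2d_pt_const|].
      apply continuity_2d_pt_mult; apply continuity_2d_pt_id2.
- apply filter_forall. intros u. apply gauss_aux_ex_RInt.
Qed.

Lemma gauss_primitive_derive (x : R) : is_derive gauss_prim x (exp (- (x * x))).
Proof.
unfold gauss_prim. apply (is_derive_RInt (V := R_NormedModule) (fun t => exp (- (t * t))) _ 0).
- apply filter_forall. intros b. apply (RInt_correct (V := R_CompleteNormedModule)), gauss_ex_RInt.
- apply gauss_continuous.
Qed.

(** The derivatives cancel, and at x = 0 only the integral of 1/(1 + t^2) over [0, 1], that is atan
    1, is left. *)
Lemma gauss_conserved (x : R) : gauss_prim x * gauss_prim x + gauss_aux x = PI / 4.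
Proof.
assert (H : forall t, is_derive (fun x => gauss_prim x * gauss_prim x + gauss_aux x) t 0).
{ intros t. eapply is_derive_Req.
  { apply is_derive_Rplus; [apply is_derive_Rmult; apply gauss_primitive_derive|apply gauss_aux_derive]. }
  ring. }
assert (E : gauss_prim x * gauss_prim x + gauss_aux x = gauss_prim 0 * gauss_prim 0 + gauss_aux 0).
{ destruct (MVT_gen (fun x => gauss_prim x * gauss_prim x + gauss_aux x) 0 x (fun _ => 0)) as [c [_ E]].
  - intros t _. apply H.
  - intros t _. apply continuity_pt_filterlim.
    apply (ex_derive_continuous (V := R_NormedModule) (fun x => gauss_prim x * gauss_prim x + gauss_aux x) t). eexists; apply H.
  - lra. }
rewrite E. unfold gauss_prim, gauss_aux. rewrite RInt_point /zero /=.
rewrite (is_RInt_unique (V := R_CompleteNormedModule) _ 0 1 (minus (atan 1) (atan 0))).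
- rewrite atan_1 atan_0 /minus /plus /opp /=. lra.
- apply (is_RInt_ext (fun t => / (1 + t ^ 2))).
  + intros t _. replace (- (0 * 0 * (1 + t * t))) with 0 by ring. rewrite exp_0.
    rewrite /Rdiv Rmult_1_l. f_equal. ring.
  + apply (is_RInt_derive (V := R_CompleteNormedModule) atan).
    * intros t _. apply is_derive_Reals. apply derivable_pt_lim_atan.
    * intros t _. apply (ex_derive_continuous (V := R_NormedModule)). auto_derive. nra.
Qed.

Lemma gauss_aux_bounds (x : R) : 0 <= gauss_aux x <= exp (- (x * x)).
Proof.
assert (T : forall t, 0 <= t * t) by (intros; apply Rle_0_sqr).
split.
- apply RInt_ge_0; [lra|apply gauss_aux_ex_RInt|].
  intros t _. specialize (T t). apply Rdiv_le_0_compat; [left; apply exp_pos|lra].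
- replace (exp (- (x * x))) with (RInt (fun _ => exp (- (x * x))) 0 1).
  2:{ rewrite RInt_const /scal /= /mult /=. ring. }
  apply RInt_le; [lra|apply gauss_aux_ex_RInt|apply ex_RInt_const|].
  intros t _. assert (T1 := T t). assert (T2 := T x).
  apply (Rmult_le_reg_r (1 + t * t)); [lra|]. unfold Rdiv. rewrite Rmult_assoc Rinv_l; [|lra].
  rewrite Rmult_1_r. apply Rle_trans with (exp (- (x * x))).
  + apply exp_le. assert (0 <= x * x * (t * t)) by (by apply Rmult_le_pos). lra.
  + assert (E := exp_pos (- (x * x))). assert (0 <= exp (- (x * x)) * (t * t)) by (apply Rmult_le_pos; lra). lra.
Qed.

Lemma gauss_is_lint : is_lint (fun t => exp (- (t * t))) (sqrt PI).
Proof.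
assert (HPI := PI_RGT_0).
set (r := sqrt PI / 2).
assert (Hs : 0 < sqrt PI) by by apply sqrt_lt_R0.
assert (Hr : 0 < r) by (unfold r; lra).
assert (Hr2 : r * r = PI / 4).
{ unfold r. replace (sqrt PI / 2 * (sqrt PI / 2)) with (sqrt PI * sqrt PI / 4) by field. rewrite sqrt_sqrt; lra. }
(* The conserved quantity factors as (r - prim)(r + prim) = aux with r = sqrt pi / 2. Dividing by r
   + prim >= r and using e^(-s^2) <= e^(1 - s) gives an exponential rate. *)
assert (Hp : forall s, 0 <= s -> Rabs (gauss_prim s - r) <= exp 1 / r * exp (- s)).
{ intros s Hs0. assert (E := gauss_conserved s). assert (B := gauss_aux_bounds s).
  assert (HI : 0 <= gauss_prim s). { apply RInt_ge_0; [auto|apply gauss_ex_RInt|]. intros; left; apply exp_pos. }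
  assert (B2 : exp (- (s * s)) <= exp 1 * exp (- s)).
  { rewrite -exp_plus. apply exp_le. assert (0 <= (s - 1/2) * (s - 1/2)) by apply Rle_0_sqr. lra. }
  apply (Rmult_le_reg_r r); auto.
  replace (exp 1 / r * exp (- s) * r) with (exp 1 * exp (- s)) by (field; lra).
  assert (F : (r - gauss_prim s) * (r + gauss_prim s) = gauss_aux s) by (rewrite -Hr2 in E; lra).
  assert (gauss_prim s <= r) by nra.
  rewrite Rabs_left1; [|lra]. nra. }
replace (sqrt PI) with (r - - r) by (unfold r; field).
apply (is_lint_antiderivative gauss_prim).
- apply gauss_primitive_derive.
- apply gauss_continuous.
- apply (filterlim_exp_decay_m _ _ (exp 1 / r)). intros s Hs0.
  assert (Hodd : gauss_prim s = - gauss_prim (- s)).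
  { unfold gauss_prim.
    assert (G := RInt_comp_lin (V := R_CompleteNormedModule) (fun t => exp (- (t * t))) (- 1) 0 0 s (gauss_ex_RInt _ _)).
    replace (-1 * 0 + 0) with 0 in G by ring. replace (- 1 * s + 0) with (- s) in G by ring.
    rewrite -G. transitivity (- RInt (fun t => opp (exp (- (t * t)))) 0 s).
    - rewrite (RInt_opp (V := R_CompleteNormedModule)); [|apply gauss_ex_RInt].
      rewrite /opp /=. by rewrite Ropp_involutive.
    - f_equal. apply RInt_ext. intros t _. rewrite /scal /opp /= /mult /=.
      replace ((- 1 * t + 0) * (- 1 * t + 0)) with (t * t) by ring. ring. }
  rewrite Hodd. specialize (Hp (- s) ltac:(lra)). rewrite Ropp_involutive in Hp.
  replace (- gauss_prim (- s) - - r) with (- (gauss_prim (- s) - r)) by ring. by rewrite Rabs_Ropp.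
- apply (filterlim_exp_decay_p _ _ (exp 1 / r)). auto.
Qed.

(** Substitution t = sqrt z sinh(s/2) in the Gaussian integral; the factor cosh(s/2) is what makes
    the value exact. *)
Lemma sinh_gauss_is_lint (z : R) : 0 < z ->
  is_lint (fun s => cosh (s / 2) * exp (- (z * (sinh (s / 2) * sinh (s / 2))))) (2 * sqrt PI / sqrt z).
Proof.
intros Hz. assert (Hsz : 0 < sqrt z) by by apply sqrt_lt_R0.
assert (H := is_lint_subst (fun t => exp (- (t * t))) (fun s => sqrt z * sinh (s / 2))
  (fun s => sqrt z / 2 * cosh (s / 2)) (sqrt PI)).
assert (H' : is_lint (fun s => sqrt z / 2 * cosh (s / 2) * exp (- (sqrt z * sinh (s / 2) * (sqrt z * sinh (s / 2))))) (sqrt PI)).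
{ apply H.
  - apply gauss_continuous.
  - intros s. unfold sinh, cosh. auto_derive; auto. rewrite /Rdiv. field.
  - intros s. apply (ex_derive_continuous (V := R_NormedModule)). unfold cosh. auto_derive; auto.
  - intros P [M HM]. exists (Rmin 0 (2 * M / sqrt z)). intros s Hs. apply HM.
    assert (T1 := Rmin_l 0 (2 * M / sqrt z)). assert (T2 := Rmin_r 0 (2 * M / sqrt z)).
    assert (E := sinh_ge (- (s / 2)) ltac:(lra)).
    assert (E2 : sinh (- (s / 2)) = - sinh (s / 2)). { unfold sinh. rewrite Ropp_involutive. lra. }
    rewrite E2 in E.
    assert (E3 : sqrt z * sinh (s / 2) <= sqrt z * (s / 2)) by (apply Rmult_le_compat_l; lra).
    assert (E4 : s * sqrt z < 2 * M).
    { apply (Rmult_lt_reg_r (/ sqrt z)). { by apply Rinv_0_lt_compat. } rewrite (Rmult_assoc s) Rinv_r; [|lra]. unfold Rdiv in T2. lra. }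
    lra.
  - intros P [M HM]. exists (Rmax 0 (2 * M / sqrt z)). intros s Hs. apply HM.
    assert (T1 := Rmax_l 0 (2 * M / sqrt z)). assert (T2 := Rmax_r 0 (2 * M / sqrt z)).
    assert (E := sinh_ge (s / 2) ltac:(lra)).
    assert (E3 : sqrt z * (s / 2) <= sqrt z * sinh (s / 2)) by (apply Rmult_le_compat_l; lra).
    assert (E4 : 2 * M < s * sqrt z).
    { apply (Rmult_lt_reg_r (/ sqrt z)). { by apply Rinv_0_lt_compat. } rewrite (Rmult_assoc s) Rinv_r; [|lra]. unfold Rdiv in T2. lra. }
    lra.
  - apply gauss_is_lint. }
replace (2 * sqrt PI / sqrt z) with (2 / sqrt z * sqrt PI) by (field; lra).
apply (is_lint_ext (fun s => 2 / sqrt z * (sqrt z / 2 * cosh (s / 2) * exp (- (sqrt z * sinh (s / 2) * (sqrt z * sinh (s / 2))))))).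
- intros s. replace (sqrt z * sinh (s / 2) * (sqrt z * sinh (s / 2))) with (sqrt z * sqrt z * (sinh (s / 2) * sinh (s / 2))) by ring.
  rewrite sqrt_sqrt; [|lra]. field. lra.
- by apply (is_RInt_gen_scal (V := R_NormedModule)).
Qed.

(** * The kernel and its derivatives *)

(** Bounds away from 0 are enough, because the argument z cosh^2(s/2) is never below z; near 0 the
    derivatives of Psi may blow up. *)
Definition poly_bounded (f : R -> C) : Prop :=
  forall y0, 0 < y0 -> exists K N, 0 <= K /\ forall y, y0 <= y -> Cmod (f y) <= K * (1 + y) ^ N.

Lemma poly_bounded_plus (f g : R -> C) :
  poly_bounded f -> poly_bounded g -> poly_bounded (fun y => f y + g y)%C.
Proof.
intros Hf Hg y0 Hy0. destruct (Hf y0 Hy0) as [K [N [HK HN]]]. destruct (Hg y0 Hy0) as [L [M [HL HM]]].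
exists (K + L), (N + M)%nat. split; [lra|]. intros y Hy.
apply Rle_trans with (1 := Cmod_triangle _ _).
specialize (HN y Hy). specialize (HM y Hy).
assert (E1 : (1 + y) ^ N <= (1 + y) ^ (N + M)) by (apply Rle_pow; [lra|lia]).
assert (E2 : (1 + y) ^ M <= (1 + y) ^ (N + M)) by (apply Rle_pow; [lra|lia]).
rewrite Rmult_plus_distr_r. apply Rplus_le_compat.
- apply Rle_trans with (1 := HN). by apply Rmult_le_compat_l.
- apply Rle_trans with (1 := HM). by apply Rmult_le_compat_l.
Qed.

Lemma poly_bounded_mult (f g : R -> C) :
  poly_bounded f -> poly_bounded g -> poly_bounded (fun y => f y * g y)%C.
Proof.
intros Hf Hg y0 Hy0. destruct (Hf y0 Hy0) as [K [N [HK HN]]]. destruct (Hg y0 Hy0) as [L [M [HL HM]]].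
exists (K * L), (N + M)%nat. split; [by apply Rmult_le_pos|]. intros y Hy.
rewrite Cmod_mult Rdef_pow_add.
replace (K * L * ((1 + y) ^ N * (1 + y) ^ M)) with ((K * (1 + y) ^ N) * (L * (1 + y) ^ M)) by ring.
apply Rmult_le_compat; auto; apply Cmod_ge_0.
Qed.

Lemma poly_bounded_const (c : C) : poly_bounded (fun _ => c).
Proof.
intros y0 Hy0. exists (Cmod c), 0%nat. split; [apply Cmod_ge_0|]. intros y _. simpl. lra.
Qed.

Lemma poly_bounded_id : poly_bounded RtoC.
Proof.
intros y0 Hy0. exists 1, 1%nat. split; [lra|]. intros y Hy. rewrite Cmod_R Rabs_pos_eq; simpl; lra.
Qed.

Lemma poly_bounded_inv : poly_bounded (fun y => / RtoC y)%C.
Proof.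
intros y0 Hy0. exists (/ y0), 0%nat. split; [left; by apply Rinv_0_lt_compat|]. intros y Hy.
rewrite Cmod_inv; [|apply RtoC_neq_0; lra]. rewrite Cmod_R Rabs_pos_eq; [|lra].
simpl. rewrite Rmult_1_r. by apply Rinv_le_contravar.
Qed.

Lemma poly_bounded_ext (f g : R -> C) :
  (forall y, 0 < y -> f y = g y) -> poly_bounded f -> poly_bounded g.
Proof.
intros E Hf y0 Hy0. destruct (Hf y0 Hy0) as [K [N [HK HN]]]. exists K, N. split; auto.
intros y Hy. rewrite -E; [auto|lra].
Qed.

(** Far out, the limit gives |f| <= (|l| + 1) y^(-Re a); the remaining compact interval is handled
    by continuity. *)
Lemma poly_bounded_Clim (a l : C) (f : R -> C) :
  (forall y, 0 < y -> Ccont f y) -> Clim (fun y => Rcpow y a * f y)%C l -> poly_bounded f.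
Proof.
intros Hf Hl y0 Hy0.
destruct (Hl 1 ltac:(lra)) as [Z [HZ HZ']].
set (Y := y0 + Z + 1).
destruct (continuity_ab_maj (fun y => Cmod (f y)) y0 Y) as [m [Hm _]].
{ unfold Y; lra. }
{ intros c Hc. apply continuity_pt_filterlim, Ccont_Cmod, Hf. lra. }
destruct (INR_unbounded (Rabs (Re a))) as [N HN].
assert (H0 := Cmod_ge_0 l). assert (H1 := Cmod_ge_0 (f m)).
exists (Cmod l + 1 + Cmod (f m)), N. split; [lra|].
intros y Hy.
assert (Hpow : 1 <= (1 + y) ^ N) by (apply pow_R1_Rle; lra).
destruct (Rle_dec y Y) as [h|h].
- apply Rle_trans with (Cmod (f m)); [apply Hm; lra|]. nra.
- assert (E := HZ' y ltac:(unfold Y in h; lra)).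
  assert (B : Cmod (Rcpow y a) * Cmod (f y) <= Cmod l + 1).
  { rewrite -Cmod_mult. replace (Rcpow y a * f y)%C with ((Rcpow y a * f y - l) + l)%C by ring.
    apply Rle_trans with (1 := Cmod_triangle _ _). lra. }
  rewrite Cmod_Rcpow in B.
  assert (Hly : 0 <= ln y). { rewrite -ln_1. apply Rcomplements.ln_le; unfold Y in h; lra. }
  assert (P : exp (- (Re a * ln y)) <= (1 + y) ^ N).
  { rewrite -Rpower_pow; [|lra]. unfold Rpower. apply exp_le.
    assert (ln y <= ln (1 + y)) by (apply Rcomplements.ln_le; lra).
    assert (T := Rabs_maj2 (Re a)). assert (T2 := Rabs_pos (Re a)).
    apply Rle_trans with (INR N * ln y).
    - rewrite Ropp_mult_distr_l. apply Rmult_le_compat_r; lra.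
    - apply Rmult_le_compat_l; lra. }
  assert (E1 : Cmod (f y) = exp (- (Re a * ln y)) * (exp (Re a * ln y) * Cmod (f y))).
  { rewrite -Rmult_assoc -exp_plus Rplus_opp_l exp_0. ring. }
  rewrite E1. assert (Q := exp_pos (- (Re a * ln y))).
  apply Rle_trans with (exp (- (Re a * ln y)) * (Cmod l + 1)).
  + apply Rmult_le_compat_l; lra.
  + rewrite Rmult_comm. apply Rmult_le_compat; lra.
Qed.

(** [shp] and [chq] are p and q; [shch] is sinh(s)/2, their common derivative, with square p q and
    derivative (p + q)/2. These relations reduce the kernel equation to algebra. *)
Definition shp (s : R) : R := sinh (s / 2) * sinh (s / 2).
Definition chq (s : R) : R := cosh (s / 2) * cosh (s / 2).
Definition shch (s : R) : R := sinh (s / 2) * cosh (s / 2).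

Lemma chq_shp (s : R) : chq s = 1 + shp s.
Proof.
unfold chq, shp, cosh, sinh.
assert (E : exp (s / 2) * exp (- (s / 2)) = 1) by (rewrite -exp_plus Rplus_opp_r; apply exp_0). nra.
Qed.

Lemma shch_sqr (s : R) : shch s * shch s = shp s * chq s.
Proof. unfold shch, shp, chq; ring. Qed.

Lemma shp_ge (s : R) : s * s / 4 <= shp s.
Proof. assert (H := sqr_le_sinh_sqr (s / 2)). unfold shp. lra. Qed.

Lemma shp_nonneg (s : R) : 0 <= shp s.
Proof. apply Rle_0_sqr. Qed.

Lemma cosh_le_exp (s : R) : cosh (s / 2) <= exp (Rabs s / 2).
Proof.
unfold cosh.
assert (exp (s / 2) <= exp (Rabs s / 2)) by (apply exp_le; assert (T := Rle_abs s); lra).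
assert (exp (- (s / 2)) <= exp (Rabs s / 2)) by (apply exp_le; assert (T := Rabs_maj2 s); lra). lra.
Qed.

Lemma cosh_ge_1 (s : R) : 1 <= cosh s.
Proof.
unfold cosh. assert (H := sqr_le_exp s). assert (0 <= s * s) by apply Rle_0_sqr. lra.
Qed.

Lemma chq_le (s : R) : chq s <= exp (Rabs s).
Proof.
unfold chq. replace (exp (Rabs s)) with (exp (Rabs s / 2) * exp (Rabs s / 2)) by (rewrite -exp_plus; f_equal; field).
assert (H := cosh_le_exp s). assert (H1 := cosh_ge_1 (s / 2)). apply Rmult_le_compat; lra.
Qed.

Lemma chq_ge_1 (s : R) : 1 <= chq s.
Proof. rewrite chq_shp. assert (H := shp_nonneg s). lra. Qed.

Lemma is_derive_shp (s : R) : is_derive shp s (shch s).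
Proof. unfold shp, shch, sinh, cosh. auto_derive; auto. rewrite /Rdiv. field. Qed.

Lemma is_derive_chq (s : R) : is_derive chq s (shch s).
Proof. unfold chq, shch, sinh, cosh. auto_derive; auto. rewrite /Rdiv. field. Qed.

Lemma is_derive_shch (s : R) : is_derive shch s ((shp s + chq s) / 2).
Proof. unfold chq, shp, shch, sinh, cosh. auto_derive; auto. rewrite /Rdiv. field. Qed.

(** The class of coefficients that the Gaussian factor of the kernel can absorb. *)
Definition exp_bounded (r : R -> R) : Prop :=
  (forall s, continuous r s) /\ exists B M, 0 <= B /\ 0 <= M /\ forall s, Rabs (r s) <= B * exp (M * Rabs s).

Lemma exp_bounded_mult (f g : R -> R) :
  exp_bounded f -> exp_bounded g -> exp_bounded (fun s => f s * g s).
Proof.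
intros [Cf [B [M [HB [HM H]]]]] [Cg [B' [M' [HB' [HM' H']]]]].
split. { intros s. apply (continuous_mult (K := R_AbsRing)); auto. }
exists (B * B'), (M + M'). split; [by apply Rmult_le_pos|]. split; [lra|].
intros s. rewrite Rabs_mult.
replace (B * B' * exp ((M + M') * Rabs s)) with ((B * exp (M * Rabs s)) * (B' * exp (M' * Rabs s))).
- apply Rmult_le_compat; auto; apply Rabs_pos.
- replace ((M + M') * Rabs s) with (M * Rabs s + M' * Rabs s) by ring. rewrite exp_plus. ring.
Qed.

Lemma exp_bounded_const (c : R) : exp_bounded (fun _ => c).
Proof.
split. { intros; apply continuous_const. }
exists (Rabs c), 0. split; [apply Rabs_pos|]. split; [lra|].
intros s. rewrite Rmult_0_l exp_0. lra.
Qed.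

Lemma exp_bounded_of_derive (r r' : R -> R) :
  (forall s, is_derive r s (r' s)) -> (forall s, Rabs (r s) <= exp (Rabs s)) -> exp_bounded r.
Proof.
intros Hd H. split. { intros s. apply (ex_derive_continuous (V := R_NormedModule)). eexists; apply Hd. }
exists 1, 1. split; [lra|]. split; [lra|]. intros s. rewrite !Rmult_1_l. auto.
Qed.

Lemma exp_bounded_chq : exp_bounded chq.
Proof.
apply (exp_bounded_of_derive _ _ is_derive_chq). intros s.
rewrite Rabs_pos_eq; [apply chq_le|]. assert (H := chq_ge_1 s). lra.
Qed.

Lemma exp_bounded_shp : exp_bounded shp.
Proof.
apply (exp_bounded_of_derive _ _ is_derive_shp). intros s.
rewrite Rabs_pos_eq; [|apply shp_nonneg]. assert (H := chq_le s). rewrite chq_shp in H. lra.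
Qed.

Lemma exp_bounded_shch : exp_bounded shch.
Proof.
apply (exp_bounded_of_derive _ _ is_derive_shch). intros s.
apply Rle_trans with (2 := chq_le s).
apply Rsqr_incr_0_var; [|left; assert (H := chq_ge_1 s); lra].
rewrite -Rsqr_abs /Rsqr shch_sqr. apply Rmult_le_compat_r; [assert (H := chq_ge_1 s); lra|].
rewrite chq_shp; lra.
Qed.

(** With w = Psi(-alpha, 1/2; .) this is e^(nu s) k(z, s). Leaving [w] free keeps the family closed:
    its derivatives in [z] and [s] are combinations of the same expression for [w] and its
    derivative. *)
Definition Ckern (nu : C) (w : R -> C) (z s : R) : C :=
  (Cexp (nu * RtoC s) * (RtoC (exp (- (z * shp s))) * w (z * chq s)%R))%C.

Lemma scaled_chq_pos (z s : R) : 0 < z -> 0 < z * chq s.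
Proof. intros Hz. apply Rmult_lt_0_compat; auto. assert (H := chq_ge_1 s). lra. Qed.

Lemma Cder_Ckern_z (nu : C) (w w' : R -> C) (z s : R) :
  0 < z -> (forall y, 0 < y -> Cder w y (w' y)) ->
  Cder (fun z => Ckern nu w z s) z (RtoC (chq s) * Ckern nu w' z s - RtoC (shp s) * Ckern nu w z s)%C.
Proof.
intros Hz Hw. unfold Ckern. eapply Cder_eq.
{ apply Cder_scal, Cder_mult.
  - apply Cder_RtoC. instantiate (1 := - shp s * exp (- (z * shp s))). auto_derive; auto. ring.
  - apply (Cder_comp w (fun z => z * chq s) z (chq s)).
    + apply Hw, scaled_chq_pos, Hz.
    + auto_derive; auto. ring. }
cbv beta. rewrite RtoC_mult RtoC_opp. ring.
Qed.

Lemma Cder_Ckern_s (nu : C) (w w' : R -> C) (z s : R) :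
  0 < z -> (forall y, 0 < y -> Cder w y (w' y)) ->
  Cder (Ckern nu w z) s
    (nu * Ckern nu w z s + RtoC (z * shch s) * (Ckern nu w' z s - Ckern nu w z s))%C.
Proof.
intros Hz Hw. unfold Ckern. eapply Cder_eq.
{ apply Cder_mult; [apply Cder_Cexp|]. apply Cder_mult.
  - apply Cder_RtoC. instantiate (1 := - (z * shch s) * exp (- (z * shp s))).
    assert (H := is_derive_shp s). auto_derive; [eexists; apply H|].
    rewrite (is_derive_unique (fun x => shp x) _ _ H). ring.
  - apply (Cder_comp w (fun s => z * chq s) s (z * shch s)).
    + apply Hw, scaled_chq_pos, Hz.
    + assert (H := is_derive_chq s). auto_derive; [eexists; apply H|].
      rewrite (is_derive_unique (fun x => chq x) _ _ H). ring. }
cbv beta. rewrite !RtoC_mult !RtoC_opp !RtoC_mult. ring.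
Qed.

Lemma Ckern_Ccont (nu : C) (w : R -> C) (z s : R) :
  0 < z -> (forall y, 0 < y -> Ccont w y) -> Ccont (Ckern nu w z) s.
Proof.
intros Hz Hw. apply Ccont_mult; [eapply Cder_Ccont; apply Cder_Cexp|]. apply Ccont_mult.
- apply Ccont_RtoC. apply (ex_derive_continuous (V := R_NormedModule)).
  assert (H := is_derive_shp s). auto_derive; eexists; apply H.
- assert (Hc : continuous (fun s => z * chq s) s).
  { apply (ex_derive_continuous (V := R_NormedModule)).
    assert (H := is_derive_chq s). auto_derive; eexists; apply H. }
  apply (Ccont_comp w (fun s => z * chq s)); auto. apply Hw, scaled_chq_pos, Hz.
Qed.

(** Completing the square yields the constant L^2/(4 c). *)
Lemma quadratic_absorb (L c : R) : 0 <= L -> 0 < c ->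
  exists C0, forall s, L * Rabs s <= c * (s * s) + C0.
Proof.
intros HL Hc. exists (L * L / (4 * c)). intros s.
replace (s * s) with (Rabs s * Rabs s).
2:{ rewrite -Rabs_mult. apply Rabs_pos_eq, Rle_0_sqr. }
set (x := Rabs s).
assert (H : 0 <= c * ((x - L / (2 * c)) * (x - L / (2 * c)))).
{ apply Rmult_le_pos; [lra|]. apply Rle_0_sqr. }
replace (c * ((x - L / (2 * c)) * (x - L / (2 * c)))) with (c * (x * x) + L * L / (4 * c) - L * x) in H by (field; lra).
lra.
Qed.

(** Uniformity for [z] in compact parts of the half-line is what differentiation under the integral
    requires. *)
Definition loc_decays (f : R -> R -> C) : Prop :=
  (forall z s, 0 < z -> Ccont (f z) s) /\
  forall z1 z2, 0 < z1 -> exists K, 0 <= K /\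
    forall z s, z1 <= z <= z2 -> Cmod (f z s) <= K * exp (- Rabs s).

Lemma loc_decays_Ckern (nu : C) (w : R -> C) (r : R -> R) :
  (forall y, 0 < y -> Ccont w y) -> poly_bounded w -> exp_bounded r ->
  loc_decays (fun z s => RtoC (r s) * Ckern nu w z s)%C.
Proof.
intros Hw Hpw [Cr [B [M [HB [HM HBM]]]]]. split.
{ intros z s Hz. apply Ccont_mult; [by apply Ccont_RtoC|by apply Ckern_Ccont]. }
intros z1 z2 Hz1.
destruct (Rle_dec z1 z2) as [h12|h12]; [|exists 0; split; [lra|]; intros; lra].
destruct (Hpw z1 Hz1) as [K [N [HK HN]]].
(* The exponents to absorb: [M] from the coefficient, |Re nu| from e^(nu s), [N] from the polynomial
   bound through chq s <= e^|s|, and 1 for the decay to be reached. The Gaussian available is e^(-z1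
   s^2/4). *)
destruct (quadratic_absorb (M + Rabs (Re nu) + INR N + 1) (z1 / 4)) as [C0 HC0]; [|lra|].
{ assert (T1 := Rabs_pos (Re nu)). assert (T2 := pos_INR N). lra. }
exists (B * K * (1 + z2) ^ N * exp C0). split.
{ apply Rmult_le_pos; [|left; apply exp_pos]. apply Rmult_le_pos; [by apply Rmult_le_pos|]. apply pow_le; lra. }
intros z s [Hz Hz'].
unfold Ckern. rewrite !Cmod_mult !Cmod_R Cmod_Cexp (Rabs_pos_eq (exp _)); [|left; apply exp_pos].
replace (Re (nu * RtoC s)%C) with (Re nu * s) by (rewrite /Re /=; ring).
assert (Hq := chq_ge_1 s). assert (Hq' := chq_le s).
assert (E1 : z1 <= z * chq s) by nra.
assert (E2 : (1 + z * chq s) ^ N <= (1 + z2) ^ N * exp (INR N * Rabs s)).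
{ apply Rle_trans with (((1 + z2) * exp (Rabs s)) ^ N).
  - apply pow_incr. split; [nra|].
    assert (1 <= exp (Rabs s)) by lra. nra.
  - rewrite Rpow_mult_distr. right. f_equal.
    rewrite -Rpower_pow; [|apply exp_pos]. by rewrite /Rpower ln_exp. }
assert (E3 : exp (Re nu * s) <= exp (Rabs (Re nu) * Rabs s)).
{ apply exp_le. rewrite -Rabs_mult. apply Rle_abs. }
assert (E4 : exp (- (z * shp s)) <= exp (- (z1 / 4 * (s * s)))).
{ apply exp_le. assert (T := shp_ge s). assert (T2 := Rle_0_sqr s). unfold Rsqr in T2.
  assert (z1 * (s * s / 4) <= z * shp s) by (apply Rmult_le_compat; lra). lra. }
assert (E5 := HN _ E1). assert (E6 := HBM s).
assert (P1 := exp_pos (Re nu * s)). assert (P2 := exp_pos (- (z * shp s))).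
apply Rle_trans with ((B * exp (M * Rabs s)) * (exp (Rabs (Re nu) * Rabs s) *
  (exp (- (z1 / 4 * (s * s))) * (K * ((1 + z2) ^ N * exp (INR N * Rabs s)))))).
{ apply Rmult_le_compat; auto; [apply Rabs_pos| |].
  { repeat apply Rmult_le_pos; try lra. apply Cmod_ge_0. }
  apply Rmult_le_compat; auto; [lra| |].
  { apply Rmult_le_pos; try lra. apply Cmod_ge_0. }
  apply Rmult_le_compat; auto; [lra|apply Cmod_ge_0|].
  apply Rle_trans with (1 := E5). by apply Rmult_le_compat_l. }
replace (_ * _) with (B * K * (1 + z2) ^ N *
  (exp (M * Rabs s) * exp (Rabs (Re nu) * Rabs s) * exp (INR N * Rabs s) * exp (- (z1 / 4 * (s * s))))) by ring.
rewrite (Rmult_assoc _ (exp C0)). apply Rmult_le_compat_l.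
{ apply Rmult_le_pos; [by apply Rmult_le_pos|]. apply pow_le; lra. }
rewrite -!exp_plus. apply exp_le. specialize (HC0 s). lra.
Qed.

Lemma loc_decays_plus (f g : R -> R -> C) :
  loc_decays f -> loc_decays g -> loc_decays (fun z s => f z s + g z s)%C.
Proof.
intros [Cf Hf] [Cg Hg]. split. { intros; apply Ccont_plus; auto. }
intros z1 z2 Hz1. destruct (Hf z1 z2 Hz1) as [K [HK HK']]. destruct (Hg z1 z2 Hz1) as [L [HL HL']].
exists (K + L). split; [lra|]. intros z s Hz. apply Rle_trans with (1 := Cmod_triangle _ _).
specialize (HK' z s Hz). specialize (HL' z s Hz). lra.
Qed.

Lemma loc_decays_minus (f g : R -> R -> C) :
  loc_decays f -> loc_decays g -> loc_decays (fun z s => f z s - g z s)%C.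
Proof.
intros [Cf Hf] [Cg Hg]. split. { intros; apply Ccont_minus; auto. }
intros z1 z2 Hz1. destruct (Hf z1 z2 Hz1) as [K [HK HK']]. destruct (Hg z1 z2 Hz1) as [L [HL HL']].
exists (K + L). split; [lra|]. intros z s Hz. apply Rle_trans with (1 := Cmod_triangle _ _).
rewrite Cmod_opp. specialize (HK' z s Hz). specialize (HL' z s Hz). lra.
Qed.

Lemma loc_decays_decays (f : R -> R -> C) (z : R) : loc_decays f -> 0 < z -> decays (f z).
Proof.
intros [_ H] Hz. destruct (H z z Hz) as [K [_ HK]]. exists K. intros s. apply HK. lra.
Qed.

Lemma loc_decays_is_clint (f : R -> R -> C) (z : R) :
  loc_decays f -> 0 < z -> is_clint (f z) (CInt (f z)).
Proof.
intros H Hz. apply is_clint_decays; [intros; by apply H|by apply loc_decays_decays].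
Qed.

Lemma Cder_CInt_loc (f f1 f2 : R -> R -> C) (z0 : R) :
  (forall z s, 0 < z -> Cder (fun z => f z s) z (f1 z s)) ->
  (forall z s, 0 < z -> Cder (fun z => f1 z s) z (f2 z s)) ->
  loc_decays f -> loc_decays f1 -> loc_decays f2 -> 0 < z0 ->
  Cder (fun z => CInt (f z)) z0 (CInt (f1 z0)).
Proof.
intros D1 D2 H H1 H2 Hz0.
destruct (proj2 H2 (z0 / 2) (3 * z0 / 2)) as [K [_ HK]]; [lra|].
assert (Hz : forall z, Rabs (z - z0) < z0 / 2 -> z0 / 2 <= z <= 3 * z0 / 2).
{ intros z. split_Rabs; lra. }
assert (Hz' : forall z, Rabs (z - z0) < z0 / 2 -> 0 < z). { intros z T. specialize (Hz z T). lra. }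
apply (Cder_CInt f f1 f2 z0 (z0 / 2) K); auto.
- lra.
- intros z s T. apply H. by apply Hz'.
- intros s. by apply H1.
- intros z T. apply loc_decays_decays; auto.
- by apply loc_decays_decays.
Qed.

Lemma Cmod_Cexp_sub_1 (w : C) : Cmod (Cexp w - 1) <= 2 * Cmod w * exp (Cmod w).
Proof.
assert (H : Cmod (Cexp (w * RtoC 1) - Cexp (w * RtoC 0)) <= 2 * (Cmod w * exp (Cmod w)) * (1 - 0)).
{ apply (Cmod_mean_value (fun t => Cexp (w * RtoC t)) (fun t => w * Cexp (w * RtoC t))%C); [lra|].
  intros t Ht. split; [apply Cder_Cexp|].
  rewrite Cmod_mult Cmod_Cexp. apply Rmult_le_compat_l; [apply Cmod_ge_0|]. apply exp_le.
  replace (Re (w * RtoC t)%C) with (Re w * t) by (rewrite /Re /=; ring).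
  assert (T := re_le_Cmod w). assert (T2 := Rle_abs (Re w)). assert (T3 := Cmod_ge_0 w). nra. }
rewrite Cmult_1_r Cmult_0_r Cexp_0 in H. lra.
Qed.

(** * The kernel for fixed parameters and its differential equation *)

Section Kernel.
Variables (alpha nu : C) (w0 w1 w2 : R -> C).
Hypothesis Hw : Kummer_recessive (- alpha) (RtoC (1 / 2)) w0 w1 w2.

(** Kummer's equation differentiated once and solved for the highest term. It is needed since
    differentiating the integral twice calls for a bound on three z-derivatives of the kernel. *)
Definition third_derivative (y : R) : C :=
  (((RtoC y - RtoC (1 / 2) - 1) * w2 y + (1 - alpha) * w1 y) * / RtoC y)%C.

Local Notation w3 := third_derivative.

Lemma w0_derive (y : R) : 0 < y -> Cder w0 y (w1 y).
Proof. intros Hy. apply (proj1 Hw y Hy). Qed.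

Lemma w1_derive (y : R) : 0 < y -> Cder w1 y (w2 y).
Proof. intros Hy. apply (proj1 Hw y Hy). Qed.

Lemma w2_eq (y : R) : 0 < y ->
  w2 y = (((RtoC y - RtoC (1 / 2)) * w1 y - alpha * w0 y) * / RtoC y)%C.
Proof.
intros Hy. destruct (proj1 Hw y Hy) as [_ [_ H]].
assert (Hn : RtoC y <> 0%C) by (apply RtoC_neq_0; lra).
replace (w2 y) with ((RtoC y * w2 y + (RtoC (1 / 2) - RtoC y) * w1 y - - alpha * w0 y) * / RtoC y
  + ((RtoC y - RtoC (1 / 2)) * w1 y - alpha * w0 y) * / RtoC y)%C by (field; auto).
rewrite H. ring.
Qed.

Lemma w2_derive (y : R) : 0 < y -> Cder w2 y (w3 y).
Proof.
intros Hy. assert (Hn : RtoC y <> 0%C) by (apply RtoC_neq_0; lra).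
apply (Cder_ext_loc (fun y => ((RtoC y - RtoC (1 / 2)) * w1 y - alpha * w0 y) * / RtoC y)%C).
{ exists (mkposreal y Hy). intros t Ht. symmetry. apply w2_eq.
  change (Rabs (t - y) < y) in Ht. revert Ht. split_Rabs; lra. }
assert (Hid : Cder RtoC y 1) by (apply Cder_RtoC, (is_derive_id (K := R_AbsRing))).
eapply Cder_eq.
{ apply Cder_mult; [|apply (Cder_inv RtoC); [exact Hn|exact Hid]].
  apply Cder_minus; [|apply Cder_scal, w0_derive, Hy].
  apply Cder_mult; [|apply w1_derive, Hy].
  apply Cder_minus; [exact Hid|apply Cder_const]. }
cbv beta. unfold third_derivative. rewrite (w2_eq y Hy). field. auto.
Qed.

Lemma w0_poly_bounded : poly_bounded w0.
Proof.
apply (poly_bounded_Clim (- alpha) 1); [|apply Hw].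
intros y Hy. eapply Cder_Ccont, w0_derive, Hy.
Qed.

Lemma w1_poly_bounded : poly_bounded w1.
Proof.
apply (poly_bounded_Clim (- alpha) 0); [|apply Hw].
intros y Hy. eapply Cder_Ccont, w1_derive, Hy.
Qed.

Lemma w2_poly_bounded : poly_bounded w2.
Proof.
apply (poly_bounded_ext (fun y => ((RtoC y + - RtoC (1 / 2)) * w1 y + - alpha * w0 y) * / RtoC y)%C).
{ intros y Hy. rewrite w2_eq //. unfold Cminus. ring. }
apply poly_bounded_mult; [|apply poly_bounded_inv].
apply poly_bounded_plus; apply poly_bounded_mult.
- apply poly_bounded_plus; [apply poly_bounded_id|apply poly_bounded_const].
- apply w1_poly_bounded.
- apply poly_bounded_const.
- apply w0_poly_bounded.
Qed.

Lemma w3_poly_bounded : poly_bounded w3.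
Proof.
apply (poly_bounded_ext (fun y => ((RtoC y + - (RtoC (1 / 2) + 1)) * w2 y + (1 - alpha) * w1 y) * / RtoC y)%C).
{ intros y Hy. unfold third_derivative. ring. }
apply poly_bounded_mult; [|apply poly_bounded_inv].
apply poly_bounded_plus; apply poly_bounded_mult.
- apply poly_bounded_plus; [apply poly_bounded_id|apply poly_bounded_const].
- apply w2_poly_bounded.
- apply poly_bounded_const.
- apply w1_poly_bounded.
Qed.

Lemma w3_Ccont (y : R) : 0 < y -> Ccont w3 y.
Proof.
intros Hy. assert (Hn : RtoC y <> 0%C) by (apply RtoC_neq_0; lra).
assert (Hid : Cder RtoC y 1) by (apply Cder_RtoC, (is_derive_id (K := R_AbsRing))).
apply Ccont_mult; [|eapply Cder_Ccont, (Cder_inv RtoC); [exact Hn|exact Hid]].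
apply Ccont_plus; apply Ccont_mult.
- apply Ccont_minus; [|apply Ccont_const]. apply Ccont_minus; [|apply Ccont_const].
  eapply Cder_Ccont, Hid.
- eapply Cder_Ccont, w2_derive, Hy.
- apply Ccont_const.
- eapply Cder_Ccont, w1_derive, Hy.
Qed.

Let k (i : nat) : R -> R -> C :=
  Ckern nu (match i with 0%nat => w0 | 1%nat => w1 | 2%nat => w2 | _ => w3 end).

Let k_decays (i : nat) (r : R -> R) : exp_bounded r ->
  loc_decays (fun z s => RtoC (r s) * k i z s)%C.
Proof.
intros Hr. apply loc_decays_Ckern; auto; destruct i as [|[|[|i]]].
- intros y Hy. eapply Cder_Ccont, w0_derive, Hy.
- intros y Hy. eapply Cder_Ccont, w1_derive, Hy.
- intros y Hy. eapply Cder_Ccont, w2_derive, Hy.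
- apply w3_Ccont.
- apply w0_poly_bounded.
- apply w1_poly_bounded.
- apply w2_poly_bounded.
- apply w3_poly_bounded.
Qed.

(** Differentiation in [z] acts as q D - p, where D replaces w by w'. The coefficients of [kern1],
    [kern2], [kern3] are those of the powers of q D - p. *)
Definition kern0 (z s : R) : C := k 0 z s.
Definition kern1 (z s : R) : C := (RtoC (chq s) * k 1 z s - RtoC (shp s) * k 0 z s)%C.
Definition kern2 (z s : R) : C :=
  (RtoC (chq s * chq s) * k 2 z s - RtoC (2 * (chq s * shp s)) * k 1 z s + RtoC (shp s * shp s) * k 0 z s)%C.
Definition kern3 (z s : R) : C :=
  (RtoC (chq s * (chq s * chq s)) * k 3 z s - RtoC (3 * (chq s * (chq s * shp s))) * k 2 z s
   + RtoC (3 * (chq s * (shp s * shp s))) * k 1 z s - RtoC (shp s * (shp s * shp s)) * k 0 z s)%C.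

Lemma Cder_kern0 (z s : R) : 0 < z -> Cder (fun z => kern0 z s) z (kern1 z s).
Proof. intros Hz. apply (Cder_Ckern_z nu w0 w1); auto. apply w0_derive. Qed.

Lemma Cder_kern1 (z s : R) : 0 < z -> Cder (fun z => kern1 z s) z (kern2 z s).
Proof.
intros Hz. unfold kern1. eapply Cder_eq.
{ apply Cder_minus; apply Cder_scal; [apply (Cder_Ckern_z nu w1 w2)|apply (Cder_Ckern_z nu w0 w1)]; auto.
  - apply w1_derive. - apply w0_derive. }
unfold kern2, k. rewrite !RtoC_mult. ring.
Qed.

Lemma Cder_kern2 (z s : R) : 0 < z -> Cder (fun z => kern2 z s) z (kern3 z s).
Proof.
intros Hz. unfold kern2. eapply Cder_eq.
{ apply Cder_plus; [apply Cder_minus|]; apply Cder_scal;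
  [apply (Cder_Ckern_z nu w2 w3)|apply (Cder_Ckern_z nu w1 w2)|apply (Cder_Ckern_z nu w0 w1)]; auto.
  - apply w2_derive. - apply w1_derive. - apply w0_derive. }
unfold kern3, k. rewrite !RtoC_mult. ring.
Qed.

Ltac exp_bounded := lazymatch goal with
  | |- exp_bounded (fun s => @?a s * @?b s) => apply (exp_bounded_mult a b); exp_bounded
  | _ => first [apply exp_bounded_const|apply exp_bounded_chq|apply exp_bounded_shp]
  end.

Lemma kern0_decays : loc_decays kern0.
Proof.
assert (H := k_decays 0 (fun _ => 1) (exp_bounded_const 1)). destruct H as [H1 H2]. split.
- intros z s Hz. apply (Ccont_ext (fun s => RtoC 1 * k 0 z s)%C); [intros; unfold kern0; ring|]. by apply H1.
- intros z1 z2 Hz1. destruct (H2 z1 z2 Hz1) as [K [HK HK']]. exists K. split; auto.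
  intros z s Hz. specialize (HK' z s Hz). rewrite Cmult_1_l in HK'. auto.
Qed.

Lemma kern1_decays : loc_decays kern1.
Proof. apply loc_decays_minus; apply k_decays; exp_bounded. Qed.

Lemma kern2_decays : loc_decays kern2.
Proof. apply loc_decays_plus; [apply loc_decays_minus|]; apply k_decays; exp_bounded. Qed.

Lemma kern3_decays : loc_decays kern3.
Proof. apply loc_decays_minus; [apply loc_decays_plus; [apply loc_decays_minus|]|]; apply k_decays; exp_bounded. Qed.

(* Writing kern0 = e^{nu s} k, the integrand is e^{nu s} (k_ss - nu^2 k) = d/ds [e^{nu s} (k_s - nu k)]. *)
Lemma kern_ode (z : R) : 0 < z ->
  (RtoC z * RtoC z * CInt (kern2 z) + RtoC z * (1 - RtoC z) * CInt (kern1 z)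
   + ((alpha - RtoC (1 / 2)) * RtoC z - nu * nu) * CInt (kern0 z) = 0)%C.
Proof.
intros Hz.
set (h' := fun s => (RtoC z * RtoC z * kern2 z s + RtoC z * (1 - RtoC z) * kern1 z s
   + ((alpha - RtoC (1 / 2)) * RtoC z - nu * nu) * kern0 z s)%C).
assert (HI : is_clint h' (RtoC z * RtoC z * CInt (kern2 z) + RtoC z * (1 - RtoC z) * CInt (kern1 z)
   + ((alpha - RtoC (1 / 2)) * RtoC z - nu * nu) * CInt (kern0 z))%C).
{ apply is_clint_plus; [apply is_clint_plus|]; apply is_clint_scal; apply loc_decays_is_clint; auto.
  - apply kern2_decays. - apply kern1_decays. - apply kern0_decays. }
rewrite -(is_clint_CInt _ _ HI). apply is_clint_CInt.
set (h := fun s => (RtoC (z * shch s) * (k 1 z s - k 0 z s) - nu * k 0 z s)%C).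
apply (is_clint_derivative h).
- intros s. unfold h. eapply Cder_eq.
  { apply Cder_minus; [|apply Cder_scal, (Cder_Ckern_s nu w0 w1); [auto|apply w0_derive]].
    apply Cder_mult.
    - apply Cder_RtoC. instantiate (1 := z * ((shp s + chq s) / 2)).
      assert (H := is_derive_shch s). auto_derive; [eexists; apply H|].
      rewrite (is_derive_unique (fun x => shch x) _ _ H). ring.
    - apply Cder_minus; [apply (Cder_Ckern_s nu w1 w2)|apply (Cder_Ckern_s nu w0 w1)]; auto.
      + apply w1_derive. + apply w0_derive. }
  unfold h', kern0, kern1, kern2. change (Ckern nu w0 z s) with (k 0 z s).
  change (Ckern nu w1 z s) with (k 1 z s). change (Ckern nu w2 z s) with (k 2 z s).
  destruct (proj1 Hw (z * chq s) (scaled_chq_pos z s Hz)) as [_ [_ Ho]].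
  assert (Ho' : (RtoC (z * chq s) * k 2 z s + (RtoC (1 / 2) - RtoC (z * chq s)) * k 1 z s + alpha * k 0 z s = 0)%C).
  { unfold k, Ckern. set (y := z * chq s) in *.
    replace (_ + _)%C with (Cexp (nu * RtoC s) * RtoC (exp (- (z * shp s))) *
      (RtoC y * w2 y + (RtoC (1 / 2) - RtoC y) * w1 y - - alpha * w0 y))%C by ring.
    rewrite Ho. ring. }
  set (k0 := k 0 z s) in *. set (k1 := k 1 z s) in *. set (k2 := k 2 z s) in *.
  assert (Em : (RtoC (shch s) * RtoC (shch s) = RtoC (shp s) * RtoC (chq s))%C).
  { by rewrite -!RtoC_mult shch_sqr. }
  assert (Eq : (RtoC (chq s) = 1 + RtoC (shp s))%C) by rewrite -RtoC_plus chq_shp //.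
  assert (E2 : (RtoC (1 / 2) = 1 / 2)%C) by (rewrite RtoC_div; [auto|lra]).
  rewrite E2 in Ho' |- *. rewrite (RtoC_mult z (chq s)) in Ho'.
  rewrite (RtoC_mult z (shch s)) (RtoC_mult z (_ / 2)) !(RtoC_mult (chq s)) !(RtoC_mult (shp s)) (RtoC_mult 2).
  rewrite ?(RtoC_mult (chq s)).
  replace (RtoC ((shp s + chq s) / 2)) with ((RtoC (shp s) + RtoC (chq s)) / 2)%C.
  2:{ rewrite RtoC_div; [|lra]. by rewrite RtoC_plus. }
  set (p := RtoC (shp s)) in *. set (q := RtoC (chq s)) in *. set (m := RtoC (shch s)) in *. set (Z := RtoC z) in *.
  (* The two sides agree only modulo m^2 = p q and Kummer's equation, so their difference is written
     as a combination of these two relations. The coefficient [D] supplied next is minus the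
     coefficient of m^2 in the derivative of [h]. *)
  assert (E0 : forall X Y D : C, (D * (m * m - p * q) + Z * (Z * q * k2 + (1 / 2 - Z * q) * k1 + alpha * k0) = Y - X)%C -> X = Y).
  { intros X Y D HD. rewrite Em Ho' in HD. replace Y with (Y - X + X)%C by ring. rewrite -HD. ring. }
  apply (E0 _ _ (- (Z * Z * (k2 - 2 * k1 + k0)))%C).
  rewrite Eq. field.
- intros s. unfold h'.
  apply Ccont_plus; [apply Ccont_plus|]; (apply Ccont_mult; [apply Ccont_const|]).
  + by apply kern2_decays. + by apply kern1_decays. + by apply kern0_decays.
(* The growing weight [shch] is kept attached to the kernels, so that [h] is a combination of
   decaying terms. *)
- destruct (proj2 (k_decays 1 (fun s => shch s) exp_bounded_shch) z z Hz) as [K1 [_ HK1]].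
  destruct (proj2 (k_decays 0 (fun s => shch s) exp_bounded_shch) z z Hz) as [K0 [_ HK0]].
  destruct (proj2 kern0_decays z z Hz) as [K [_ HK]].
  exists (z * K1 + z * K0 + Cmod nu * K). intros s.
  specialize (HK1 z s ltac:(lra)). specialize (HK0 z s ltac:(lra)). specialize (HK z s ltac:(lra)).
  unfold h. replace (_ - _)%C with (RtoC z * (RtoC (shch s) * k 1 z s) - RtoC z * (RtoC (shch s) * k 0 z s) - nu * kern0 z s)%C.
  2:{ unfold kern0. rewrite RtoC_mult. ring. }
  apply Rle_trans with (1 := Cmod_triangle _ _). rewrite Cmod_opp.
  apply Rle_trans with (Cmod (RtoC z * (RtoC (shch s) * k 1 z s)) + Cmod (RtoC z * (RtoC (shch s) * k 0 z s)) + Cmod (nu * kern0 z s)).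
  { apply Rplus_le_compat_r. apply Rle_trans with (1 := Cmod_triangle _ _). rewrite Cmod_opp. lra. }
  rewrite (Cmod_mult (RtoC z)) (Cmod_mult (RtoC z)) (Cmod_mult nu) (Cmod_R z) (Rabs_pos_eq z); [|lra].
  rewrite !Rmult_plus_distr_r !Rmult_assoc.
  apply Rplus_le_compat; [apply Rplus_le_compat|]; apply Rmult_le_compat_l; try lra. apply Cmod_ge_0.
Qed.

Lemma Cder_CInt_kern0 (z : R) : 0 < z -> Cder (fun z => CInt (kern0 z)) z (CInt (kern1 z)).
Proof.
apply (Cder_CInt_loc kern0 kern1 kern2).
- apply Cder_kern0. - apply Cder_kern1. - apply kern0_decays. - apply kern1_decays. - apply kern2_decays.
Qed.

Lemma Cder_CInt_kern1 (z : R) : 0 < z -> Cder (fun z => CInt (kern1 z)) z (CInt (kern2 z)).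
Proof.
apply (Cder_CInt_loc kern1 kern2 kern3).
- apply Cder_kern1. - apply Cder_kern2. - apply kern1_decays. - apply kern2_decays. - apply kern3_decays.
Qed.

Definition kern_solution (z : R) : C := (RtoC (/ (2 * sqrt PI)) * (Rcpow z nu * CInt (kern0 z)))%C.

(** The equation of [kern_ode] has exponents nu and -nu at z = 0. The factor z^nu moves them to 2 nu
    and 0, which are 1 - b and 0 for Kummer's equation with b = 1 - 2 nu. *)
Lemma kern_solution_Kummer : exists f' f'',
  Kummer (RtoC (1 / 2) - alpha - nu) (1 - 2 * nu) kern_solution f' f''.
Proof.
set (c0 := RtoC (/ (2 * sqrt PI))).
exists (fun z => c0 * (Rcpow z nu * (CInt (kern1 z) + nu * / RtoC z * CInt (kern0 z))))%C,
  (fun z => c0 * (Rcpow z nu * (CInt (kern2 z) + 2 * nu * / RtoC z * CInt (kern1 z)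
    + nu * (nu - 1) * (/ RtoC z * / RtoC z) * CInt (kern0 z))))%C.
intros z Hz. assert (Hn : RtoC z <> 0%C) by (apply RtoC_neq_0; lra).
assert (Hid : Cder RtoC z 1) by (apply Cder_RtoC, (is_derive_id (K := R_AbsRing))).
split; [|split].
- unfold kern_solution. fold c0. apply Cder_scal. eapply Cder_eq.
  { apply Cder_mult; [apply Cder_Rcpow, Hz|apply Cder_CInt_kern0, Hz]. }
  cbv beta. field. auto.
- apply Cder_scal. eapply Cder_eq.
  { apply Cder_mult; [apply Cder_Rcpow, Hz|].
    apply Cder_plus; [apply Cder_CInt_kern1, Hz|].
    apply Cder_mult; [|apply Cder_CInt_kern0, Hz].
    apply Cder_scal, (Cder_inv RtoC); [exact Hn|exact Hid]. }
  cbv beta. field. auto.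
- unfold kern_solution. fold c0.
  assert (H := kern_ode z Hz).
  replace (_ - _)%C with (c0 * Rcpow z nu * / RtoC z * (RtoC z * RtoC z * CInt (kern2 z) + RtoC z * (1 - RtoC z) * CInt (kern1 z)
   + ((alpha - RtoC (1 / 2)) * RtoC z - nu * nu) * CInt (kern0 z)))%C.
  + rewrite H. ring.
  + assert (E2 : (RtoC (1 / 2) = 1 / 2)%C) by (rewrite RtoC_div; [auto|lra]).
    rewrite E2. field. auto.
Qed.

End Kernel.

(** * Behaviour at infinity and conclusion *)

Lemma exp_sub_1_le (x : R) : exp x - 1 <= x * exp x.
Proof.
assert (H := exp_ineq1_le (- x)). assert (P := exp_pos x).
assert (E : exp x * exp (- x) = 1) by (rewrite -exp_plus Rplus_opp_r; apply exp_0).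
assert (exp x * (1 + - x) <= exp x * exp (- x)) by (apply Rmult_le_compat_l; lra). lra.
Qed.

Lemma Rcpow_half (z : R) : 0 < z -> Rcpow z (RtoC (1 / 2)) = RtoC (sqrt z).
Proof. intros Hz. rewrite Rcpow_RtoC /Rdiv Rmult_1_l Rpower_sqrt //. Qed.

(* The integrand is compared with sqrt z cosh(s/2) e^{-z sinh^2(s/2)}, of integral 2 sqrt pi. *)
Lemma kern0_lim (alpha nu : C) (w0 w1 w2 : R -> C) :
  Kummer_recessive (- alpha) (RtoC (1 / 2)) w0 w1 w2 ->
  Clim (fun z => Rcpow z (RtoC (1 / 2) - alpha) * CInt (kern0 alpha nu w0 w1 w2 z))%C (RtoC (2 * sqrt PI)).
Proof.
intros Hw eps Heps.
assert (Hsp : 0 < sqrt PI) by (apply sqrt_lt_R0, PI_RGT_0).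
set (M := Cmod nu + Cmod alpha).
assert (HM : 0 <= M) by (unfold M; assert (T1 := Cmod_ge_0 nu); assert (T2 := Cmod_ge_0 alpha); lra).
(* 1/16 fits the estimate y/4 >= s^2/16 for y = z sinh^2(s/2) and z >= 1: the growth e^((M+1)|s|)
   then costs only a quarter of the exponent. *)
destruct (quadratic_absorb (M + 1) (1 / 16)) as [C0 HC0]; [lra|lra|].
set (E := exp C0). assert (HE : 0 < E) by apply exp_pos.
(* [e1] bounds the relative error in the asymptotics of [w0]; [N] is the threshold for sqrt z. Both
   are chosen so that the two parts of the final bound amount to at most eps/2 each. *)
set (e1 := eps / (16 * sqrt PI * E)).
assert (Hd : 0 < 16 * sqrt PI * E) by (apply Rmult_lt_0_compat; lra).
assert (He1 : 0 < e1) by (apply Rdiv_lt_0_compat; auto).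
destruct (proj1 (proj2 Hw) e1 He1) as [Z [HZ HZ']].
set (N := 64 * sqrt PI * E * (2 * M + 1) / eps).
assert (HN : 0 <= N).
{ apply Rdiv_le_0_compat; auto. apply Rmult_le_pos; [|lra]. apply Rmult_le_pos; lra. }
exists (Z + 1 + N * N). split; [assert (0 <= N * N) by apply Rle_0_sqr; lra|].
intros z Hz. assert (HNN : 0 <= N * N) by apply Rle_0_sqr.
assert (Hz0 : 0 < z) by lra. assert (Hz1 : 1 <= z) by lra.
assert (Hsz : 0 < sqrt z) by by apply sqrt_lt_R0.
assert (HNz : N < sqrt z).
{ rewrite -(sqrt_square N) //. apply sqrt_lt_1; lra. }
(* The majorant has z/2 in place of z: the other half of the exponent pays for the growth in |s| and
   for a factor sqrt z |s|. *)
set (g := fun s => cosh (s / 2) * exp (- (z / 2 * (sinh (s / 2) * sinh (s / 2))))).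
assert (Hg : is_lint g (2 * sqrt PI / sqrt (z / 2))) by (apply sinh_gauss_is_lint; lra).
set (B := (e1 * sqrt z + 4 * (2 * M + 1)) * E).
assert (HB : 0 <= B).
{ apply Rmult_le_pos; [|lra]. assert (0 <= e1 * sqrt z) by (apply Rmult_le_pos; lra). lra. }
assert (HBg : is_lint (fun s => B * g s) (B * (2 * sqrt PI / sqrt (z / 2)))).
{ by apply (is_RInt_gen_scal (V := R_NormedModule)). }
set (r := fun s => RtoC (sqrt z * (cosh (s / 2) * exp (- (z * (sinh (s / 2) * sinh (s / 2))))))).
assert (Hr : is_clint r (RtoC (2 * sqrt PI))).
{ apply is_clint_RtoC. replace (2 * sqrt PI) with (sqrt z * (2 * sqrt PI / sqrt z)) by (field; lra).
  apply (is_RInt_gen_scal (V := R_NormedModule)). by apply sinh_gauss_is_lint. }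
set (D := fun s => (Rcpow z (RtoC (1 / 2) - alpha) * kern0 alpha nu w0 w1 w2 z s - r s)%C).
assert (HD : is_clint D (Rcpow z (RtoC (1 / 2) - alpha) * CInt (kern0 alpha nu w0 w1 w2 z) - RtoC (2 * sqrt PI))%C).
{ apply is_clint_minus; auto. apply is_clint_scal. apply loc_decays_is_clint; auto. by apply kern0_decays. }
assert (Hbound : Cmod (Rcpow z (RtoC (1 / 2) - alpha) * CInt (kern0 alpha nu w0 w1 w2 z) - RtoC (2 * sqrt PI))
   <= 2 * (B * (2 * sqrt PI / sqrt (z / 2)))).
{ apply is_clint_bound with (4 := HBg) (5 := HD).
  - intros s. apply Ccont_minus.
    + apply Ccont_mult; [apply Ccont_const|]. by apply kern0_decays.
    + apply Ccont_RtoC, (ex_derive_continuous (V := R_NormedModule)). unfold cosh, sinh. auto_derive; auto.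
  - intros s. apply (ex_derive_continuous (V := R_NormedModule)). unfold g, cosh, sinh. auto_derive; auto.
  - intros s.
    assert (Hq1 := chq_ge_1 s). assert (Hq2 := chq_le s).
    assert (Hzq : 0 < z * chq s) by by apply scaled_chq_pos.
    set (lq := ln (chq s)).
    assert (Hlq : 0 <= lq <= Rabs s).
    { split.
      - rewrite -ln_1. apply Rcomplements.ln_le; lra.
      - rewrite -(ln_exp (Rabs s)). apply Rcomplements.ln_le; lra. }
    (* e^w = e^(nu s) q^alpha collects the factors that depend on s but not on z; its exponent is
       O(|s|). *)
    set (w := (nu * RtoC s + alpha * RtoC lq)%C).
    assert (Hwm : Cmod w <= M * Rabs s).
    { unfold w, M. apply Rle_trans with (1 := Cmod_triangle _ _). rewrite !Cmod_mult !Cmod_R.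
      rewrite (Rabs_pos_eq lq); [|lra]. rewrite Rmult_plus_distr_r.
      apply Rplus_le_compat_l. apply Rmult_le_compat_l; [apply Cmod_ge_0|lra]. }
    set (m0 := Cexp w). set (phi := (Rcpow (z * chq s) (- alpha) * w0 (z * chq s)%R)%C).
    assert (Hphi : Cmod (phi - 1) < e1).
    { apply HZ'. assert (z * 1 <= z * chq s) by (apply Rmult_le_compat_l; lra). lra. }
    (* Three errors are separated: the asymptotics of [w0], small uniformly in s because z q >= z,
       and the deviations of e^w and of cosh(s/2) from 1, both carrying a factor |s|. *)
    replace (D s) with (RtoC (sqrt z * exp (- (z * shp s))) * (m0 * (phi - 1) + (m0 - 1) + (1 - RtoC (cosh (s / 2)))))%C.
    2:{ unfold D, r, kern0, Ckern. fold (shp s). rewrite !(RtoC_mult (sqrt z)) (RtoC_mult (cosh _)).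
        replace (Rcpow z (RtoC (1 / 2) - alpha)) with (RtoC (sqrt z) * Rcpow z (- alpha))%C.
        2:{ rewrite -Rcpow_half // -Rcpow_plus. reflexivity. }
        unfold phi, m0, w. rewrite Cexp_plus. rewrite Rcpow_mult; [|auto|lra].
        change (Cexp (alpha * RtoC lq)) with (Rcpow (chq s) alpha).
        rewrite (Rcpow_opp (chq s)). field. apply Rcpow_neq_0. }
    set (x := Rabs s) in *. assert (Hx : 0 <= x) by apply Rabs_pos.
    assert (Hxx : x * x = s * s). { unfold x. rewrite -Rabs_mult. apply Rabs_pos_eq, Rle_0_sqr. }
    set (eM := exp ((M + 1) * x)).
    assert (HeM : exp (M * x) <= eM) by (apply exp_le; lra).
    assert (HeM1 : exp x <= eM). { apply exp_le. assert (0 <= M * x) by by apply Rmult_le_pos. lra. }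
    assert (HeM0 : 0 < eM) by apply exp_pos.
    assert (B1 : Cmod m0 <= eM).
    { unfold m0. rewrite Cmod_Cexp. apply Rle_trans with (2 := HeM). apply exp_le.
      apply Rle_trans with (2 := Hwm), Rle_trans with (2 := re_le_Cmod w), Rle_abs. }
    assert (B2 : Cmod (m0 - 1) <= 2 * (M * x) * eM).
    { apply Rle_trans with (1 := Cmod_Cexp_sub_1 w).
      apply Rmult_le_compat.
      - assert (T := Cmod_ge_0 w). lra.
      - left; apply exp_pos.
      - lra.
      - apply Rle_trans with (2 := HeM). by apply exp_le. }
    assert (B3 : Cmod (1 - RtoC (cosh (s / 2))) <= x * eM).
    { rewrite -RtoC_minus Cmod_R.
      assert (T1 := cosh_ge_1 (s / 2)). assert (T2 := cosh_le_exp s). fold x in T2.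
      assert (T3 : exp (x / 2) <= exp x) by (apply exp_le; lra).
      assert (T4 := exp_sub_1_le x). rewrite Rabs_left1; [|lra].
      assert (x * exp x <= x * eM) by (by apply Rmult_le_compat_l). lra. }
    assert (B4 : Cmod (m0 * (phi - 1) + (m0 - 1) + (1 - RtoC (cosh (s / 2)))) <= (e1 + (2 * M + 1) * x) * eM).
    { apply Rle_trans with (1 := Cmod_triangle _ _).
      apply Rle_trans with (Cmod (m0 * (phi - 1)) + Cmod (m0 - 1) + Cmod (1 - RtoC (cosh (s / 2)))).
      { apply Rplus_le_compat_r, Cmod_triangle. }
      assert (Cmod (m0 * (phi - 1)) <= eM * e1).
      { rewrite Cmod_mult. apply Rmult_le_compat; try apply Cmod_ge_0; lra. }
      lra. }
    rewrite Cmod_mult Cmod_R Rabs_pos_eq.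
    2:{ apply Rmult_le_pos; [lra|left; apply exp_pos]. }
    set (y := z * shp s).
    assert (Hy : z * (x * x) / 4 <= y).
    { unfold y. assert (T := shp_ge s). rewrite -Hxx in T.
      assert (z * (x * x / 4) <= z * shp s) by (apply Rmult_le_compat_l; lra). lra. }
    assert (Hxz : x * x <= z * (x * x)).
    { assert (0 <= x * x) by apply Rle_0_sqr. assert (0 <= (z - 1) * (x * x)) by (apply Rmult_le_pos; lra). lra. }
    assert (Hx0 : 0 <= x * x) by apply Rle_0_sqr.
    assert (B5 : eM <= E * exp (y / 4)).
    { unfold eM, E. rewrite -exp_plus. apply exp_le.
      assert (T := HC0 s). fold x in T. rewrite -Hxx in T. lra. }
    (* This trades a factor |s| for 1/sqrt z: from (sqrt z x - 2)^2 >= 0 and y >= z x^2/4 follows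
       sqrt z x <= 1 + y. *)
    assert (B6 : sqrt z * x <= 4 * exp (y / 4)).
    { assert (T := exp_ineq1_le (y / 4)). assert (T2 := sqrt_sqrt z ltac:(lra)).
      assert (T3 : 0 <= (sqrt z * x - 2) * (sqrt z * x - 2)) by apply Rle_0_sqr.
      assert (T4 : (sqrt z * x) * (sqrt z * x) = z * (x * x)) by (rewrite -{3}T2; ring). lra. }
    assert (B7 : 1 <= exp (y / 4)).
    { assert (T := exp_ineq1_le (y / 4)). lra. }
    set (ey := exp (y / 4)) in *.
    apply Rle_trans with (exp (- y) * ((sqrt z * (e1 + (2 * M + 1) * x)) * (E * ey))).
    { rewrite (Rmult_comm (sqrt z) (exp _)) Rmult_assoc. apply Rmult_le_compat_l; [left; apply exp_pos|].
      rewrite Rmult_assoc. apply Rmult_le_compat_l; [lra|].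
      apply Rle_trans with (1 := B4). apply Rmult_le_compat_l; auto.
      assert (0 <= (2 * M + 1) * x) by (apply Rmult_le_pos; lra). lra. }
    apply Rle_trans with (exp (- y) * (((e1 * sqrt z + 4 * (2 * M + 1)) * ey) * (E * ey))).
    { apply Rmult_le_compat_l; [left; apply exp_pos|]. apply Rmult_le_compat_r; [apply Rmult_le_pos; lra|].
      assert ((2 * M + 1) * (sqrt z * x) <= (2 * M + 1) * (4 * ey)) by (apply Rmult_le_compat_l; lra).
      assert (e1 * sqrt z * 1 <= e1 * sqrt z * ey).
      { apply Rmult_le_compat_l; auto. apply Rmult_le_pos; lra. }
      lra. }
    replace (_ * _) with (B * (exp (- y) * (ey * ey))) by (unfold B; ring).
    apply Rmult_le_compat_l; auto.
    (* Two factors e^(y/4) have been spent, so e^(-y/2) remains, which is the Gaussian in [g]. *)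
    unfold ey, g. fold (shp s). rewrite -!exp_plus.
    replace (- y + (y / 4 + y / 4)) with (- (z / 2 * shp s)) by (unfold y; field).
    rewrite -{1}(Rmult_1_l (exp _)). apply Rmult_le_compat_r; [left; apply exp_pos|apply cosh_ge_1]. }
apply Rle_lt_trans with (1 := Hbound).
assert (Hs2 : sqrt z / 2 <= sqrt (z / 2)).
{ replace (sqrt z / 2) with (sqrt (z / 4)).
  - apply sqrt_le_1; lra.
  - rewrite sqrt_div; [|lra|lra]. replace 4 with (2 * 2) by ring. rewrite sqrt_square //. lra. }
apply Rle_lt_trans with (2 * (B * (2 * sqrt PI * (2 / sqrt z)))).
{ apply Rmult_le_compat_l; [lra|]. apply Rmult_le_compat_l; auto. unfold Rdiv. apply Rmult_le_compat_l; [lra|].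
  replace (2 * / sqrt z) with (/ (sqrt z / 2)) by (field; lra). apply Rinv_le_contravar; [lra|auto]. }
replace (2 * (B * (2 * sqrt PI * (2 / sqrt z)))) with
  (eps / 2 + (eps / 2 * N) / sqrt z) by (unfold B, N, e1; field; repeat split; lra).
assert (eps / 2 * N / sqrt z < eps / 2).
{ apply (Rmult_lt_reg_r (sqrt z)); auto. unfold Rdiv at 1. rewrite Rmult_assoc Rinv_l; [|lra].
  rewrite Rmult_1_r. apply Rmult_lt_compat_l; lra. }
lra.
Qed.

Lemma kern_solution_lim (alpha nu : C) (w0 w1 w2 : R -> C) :
  Kummer_recessive (- alpha) (RtoC (1 / 2)) w0 w1 w2 ->
  Clim (fun z => Rcpow z (RtoC (1 / 2) - alpha - nu) * kern_solution alpha nu w0 w1 w2 z)%C 1.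
Proof.
intros Hw.
assert (Hsp : 0 < sqrt PI) by (apply sqrt_lt_R0, PI_RGT_0).
apply (Clim_ext (fun z => RtoC (/ (2 * sqrt PI)) * (Rcpow z (RtoC (1 / 2) - alpha) * CInt (kern0 alpha nu w0 w1 w2 z)))%C).
- intros z Hz. unfold kern_solution.
  replace (Rcpow z (RtoC (1 / 2) - alpha)) with (Rcpow z (RtoC (1 / 2) - alpha - nu) * Rcpow z nu)%C.
  2:{ rewrite -Rcpow_plus. f_equal. ring. }
  ring.
- apply (Clim_eq _ (RtoC (/ (2 * sqrt PI)) * RtoC (2 * sqrt PI))%C).
  { rewrite -RtoC_mult Rinv_l //. lra. }
  by apply Clim_scal, kern0_lim.
Qed.

Lemma Tricomi_integral (alpha nu : C) (w0 w1 w2 : R -> C) (z : R) :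
  Kummer_recessive (- alpha) (RtoC (1 / 2)) w0 w1 w2 -> 0 < z ->
  Tricomi (RtoC (1 / 2) - alpha - nu) (1 - 2 * nu) z = kern_solution alpha nu w0 w1 w2 z.
Proof.
intros Hw Hz. destruct (kern_solution_Kummer alpha nu w0 w1 w2 Hw) as [f' [f'' HK]].
apply (Tricomi_eq _ _ _ f' f''); auto. by apply kern_solution_lim.
Qed.

(** With z = 1/(2 x^2), the exponential in [eta] and the one inside D combine to z - z q = -z p, and
    half the squared argument of D is z q. *)
Lemma Cexp_eta_kern0 (alpha nu : C) (w0 w1 w2 : R -> C) (x s : R) :
  Kummer_recessive (- alpha) (RtoC (1 / 2)) w0 w1 w2 -> 0 < x ->
  (Cexp (nu * RtoC s) * eta alpha x s)%C =
  (Rcpow (2 * x ^ 2) (RtoC (- 1 / 2) + alpha) * RtoC (/ (2 * sqrt PI)) * kern0 alpha nu w0 w1 w2 (1 / (2 * x ^ 2)) s)%C.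
Proof.
intros Hw Hx.
assert (Hsp : 0 < sqrt PI) by (apply sqrt_lt_R0, PI_RGT_0).
assert (Hx2 : 0 < x ^ 2) by (by apply pow_lt).
assert (Hz : 0 < 1 / (2 * x ^ 2)) by (apply Rdiv_lt_0_compat; lra).
unfold eta, ParCyl, kern0, Ckern.
replace ((/ x * cosh (s / 2)) ^ 2 / 2) with (1 / (2 * x ^ 2) * chq s) by (unfold chq; field; lra).
replace (- (2 * alpha) / 2)%C with (- alpha)%C by field.
replace (2 * alpha / 2)%C with alpha by field.
rewrite (Tricomi_eq (- alpha) (RtoC (1 / 2)) w0 w1 w2); [|apply Hw|apply Hw|by apply scaled_chq_pos].
replace (exp (- (1 / (2 * x ^ 2) * shp s))) with
  (exp (1 / (2 * x ^ 2) - 1 / (4 * x ^ 2) * cosh (s / 2) ^ 2) * exp (- (/ x * cosh (s / 2)) ^ 2 / 4)).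
2:{ rewrite -exp_plus. f_equal. replace (shp s) with (chq s - 1) by (rewrite chq_shp; ring). unfold chq. field. lra. }
rewrite Rcpow_mult; [|lra|auto].
replace (Rcpow (x ^ 2) (RtoC (- 1 / 2) + alpha)) with (Rcpow x (RtoC (- 1) + 2 * alpha)).
2:{ rewrite /Rcpow. f_equal. replace (ln (x ^ 2)) with (2 * ln x).
    2:{ rewrite ln_pow //. }
    rewrite RtoC_mult RtoC_div; [|lra]. field. }
(* D contributes 2^alpha and [eta] contributes 2^(-3/2), which is half of 2^(-1/2); that half is the
   one in 1/(2 sqrt pi). *)
replace (Rcpow 2 (RtoC (- 1 / 2) + alpha)) with (RtoC (2 * Rpower 2 (- 3 / 2)) * Rcpow 2 alpha)%C.
2:{ rewrite Rcpow_plus Rcpow_RtoC. f_equal. f_equal.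
    rewrite -{1}(Rpower_1 2); [|lra]. rewrite -Rpower_plus. f_equal. field. }
rewrite !RtoC_mult !RtoC_inv ?RtoC_mult; try lra.
field. apply RtoC_neq_0. lra.
Qed.

(** z^nu cancels (2 x^2)^nu, which leaves the same prefactor as in [Cexp_eta_kern0]. *)
Lemma Wbold_integral (alpha nu : C) (w0 w1 w2 : R -> C) (x : R) :
  Kummer_recessive (- alpha) (RtoC (1 / 2)) w0 w1 w2 -> 0 < x ->
  Wbold alpha nu x =
  (Rcpow (2 * x ^ 2) (RtoC (- 1 / 2) + alpha) * RtoC (/ (2 * sqrt PI)) * CInt (kern0 alpha nu w0 w1 w2 (1 / (2 * x ^ 2))))%C.
Proof.
intros Hw Hx.
assert (Hx2 : 0 < x ^ 2) by (by apply pow_lt).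
assert (Hz : 0 < 1 / (2 * x ^ 2)) by (apply Rdiv_lt_0_compat; lra).
unfold Wbold. rewrite (Tricomi_integral alpha nu w0 w1 w2) //. unfold kern_solution.
replace (Rcpow (1 / (2 * x ^ 2)) nu) with (/ Rcpow (2 * x ^ 2) nu)%C.
2:{ rewrite -Rcpow_inv; [|lra]. by rewrite /Rdiv Rmult_1_l. }
rewrite (Rcpow_plus _ _ nu). field. apply Rcpow_neq_0.
Qed.

(** The way back from componentwise integrals to the C-valued integrals of the statement. *)
Lemma is_RInt_gen_C (Fa Fb : (R -> Prop) -> Prop) (f : R -> C) (l : C) :
  Filter Fa -> Filter Fb ->
  is_RInt_gen (fun t => Re (f t)) Fa Fb (Re l) -> is_RInt_gen (fun t => Im (f t)) Fa Fb (Im l) ->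
  is_RInt_gen f Fa Fb l.
Proof.
intros FFa FFb H1 H2 P [eps HP].
assert (G1 := H1 (ball (Re l) eps) (locally_ball _ eps)).
assert (G2 := H2 (ball (Im l) eps) (locally_ball _ eps)).
unfold filtermapi in *. apply: filter_imp (filter_and _ _ G1 G2).
intros [a b] [[y1 [I1 B1]] [y2 [I2 B2]]].
exists (y1, y2). split; [by apply is_RInt_fct_extend_pair|]. apply HP. by split.
Qed.

(** * Reflection and half-line integrals *)

Lemma RInt_comp_opp_R (f : R -> R) (a b : R) : (forall x, continuous f x) ->
  RInt (fun t => f (- t)) a b = RInt f (- b) (- a).
Proof.
intros Hf.
assert (Hex : forall a b, ex_RInt f a b)
  by (intros; apply (ex_RInt_continuous (V := R_CompleteNormedModule)); auto).
assert (Hc : forall t, continuous (fun t => f (- t)) t).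
{ intros t. apply (continuous_comp (fun t => - t) f); auto.
  apply (continuous_opp (V := R_NormedModule)), continuous_id. }
assert (G := RInt_comp_lin (V := R_CompleteNormedModule) f (- 1) 0 a b (Hex _ _)).
replace (- 1 * a + 0) with (- a) in G by ring. replace (- 1 * b + 0) with (- b) in G by ring.
rewrite -(opp_RInt_swap (V := R_CompleteNormedModule) f (- a) (- b)) // -G.
transitivity (- RInt (fun t => opp (f (- t))) a b).
- rewrite (RInt_opp (V := R_CompleteNormedModule)).
  + rewrite /opp /=. by rewrite Ropp_involutive.
  + apply (ex_RInt_continuous (V := R_CompleteNormedModule)); auto.
- rewrite /opp /=. f_equal. apply RInt_ext. intros t _. rewrite /scal /= /mult /=.
  replace (- 1 * t + 0) with (- t) by ring. ring.
Qed.

Lemma is_lint_comp_opp (f : R -> R) (l : R) :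
  (forall x, continuous f x) -> is_lint f l -> is_lint (fun t => f (- t)) l.
Proof.
intros Hf H.
assert (Hc : forall t, continuous (fun t => f (- t)) t).
{ intros t. apply (continuous_comp (fun t => - t) f); auto.
  apply (continuous_opp (V := R_NormedModule)), continuous_id. }
move: (proj1 (is_lint_eps f l Hf) H) => {}H. apply (proj2 (is_lint_eps _ l Hc)).
intros eps. destruct (H eps) as [M HM]. exists M. intros a b Ha Hb.
rewrite RInt_comp_opp_R //. apply HM; lra.
Qed.

(** Of the integral over the line only the symmetric intervals [-b, b] are used; evenness halves
    them. *)
Lemma is_lint_even (f : R -> R) (l : R) :
  (forall x, continuous f x) -> (forall x, f (- x) = f x) -> is_lint f l ->
  is_RInt_gen f (at_point 0) (Rbar_locally p_infty) (l / 2).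
Proof.
intros Hf He H. move: (proj1 (is_lint_eps f l Hf) H) => {}H.
assert (Hex : forall a b, ex_RInt f a b)
  by (intros; apply (ex_RInt_continuous (V := R_CompleteNormedModule)); auto).
intros P [eps HP]. destruct (H eps) as [M HM].
exists (fun a => a = 0) (fun b => M < b); [by []|by exists M|].
intros a b -> Hb. exists (RInt f 0 b). split; [by apply (RInt_correct (V := R_CompleteNormedModule))|].
apply HP. change (Rabs (RInt f 0 b - l / 2) < eps).
assert (E1 : RInt f (- b) 0 = RInt f 0 b).
{ rewrite -{1}Ropp_0 -RInt_comp_opp_R //. apply RInt_ext. intros; apply He. }
assert (E2 := RInt_Chasles (V := R_CompleteNormedModule) f (- b) 0 b (Hex _ _) (Hex _ _)).
rewrite /plus /= E1 in E2.
specialize (HM (- b) b ltac:(lra) Hb). rewrite -E2 in HM.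
revert HM. split_Rabs; lra.
Qed.

Lemma eta_opp (alpha : C) (x s : R) : eta alpha x (- s) = eta alpha x s.
Proof.
unfold eta.
assert (E : cosh (- s / 2) = cosh (s / 2)).
{ unfold cosh. replace (- s / 2) with (- (s / 2)) by field. rewrite Ropp_involutive. f_equal. apply Rplus_comm. }
by rewrite E.
Qed.

Lemma ex_lint_Cmod_decays (f : R -> C) : (forall s, Ccont f s) -> decays f ->
  exists l, is_lint (fun s => Cmod (f s)) l.
Proof.
intros Hf [K HK]. apply (ex_lint_dominated _ (fun s => K * decay_ref s) (K * 4)).
- intros s. by apply Ccont_Cmod.
- apply decay_bound_cont.
- intros s. rewrite Rabs_pos_eq; [|apply Cmod_ge_0]. apply le_decay_bound; auto. apply Cmod_ge_0.
- apply is_lint_decay_bound.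
Qed.

Theorem mainTheorem2 (alpha nu : C) (x : R) (hx : 0 < x) :
  (* absolute convergence of both integrals *)
  ex_RInt_gen (fun s => Cmod (Cexp (nu * RtoC s) * eta alpha x s)%C)
    (Rbar_locally m_infty) (Rbar_locally p_infty) /\
  ex_RInt_gen (fun s => Cmod (Ccosh (nu * RtoC s) * eta alpha x s)%C)
    (at_point 0) (Rbar_locally p_infty) /\
  (* W = int_{-oo}^{oo} e^{nu s} eta_x(s) ds *)
  is_RInt_gen (fun s => (Cexp (nu * RtoC s) * eta alpha x s)%C)
    (Rbar_locally m_infty) (Rbar_locally p_infty) (Wbold alpha nu x) /\
  (* W = 2 int_0^oo cosh(nu s) eta_x(s) ds *)
  (exists I : C,
     is_RInt_gen (fun s => (Ccosh (nu * RtoC s) * eta alpha x s)%C)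
       (at_point 0) (Rbar_locally p_infty) I /\
     Wbold alpha nu x = (2 * I)%C).
Proof.
destruct (ex_Kummer_recessive (- alpha) (RtoC (1 / 2))) as [w0 [w1 [w2 Hw]]].
assert (Hx2 : 0 < x ^ 2) by (by apply pow_lt).
set (z := 1 / (2 * x ^ 2)).
assert (Hz : 0 < z) by (apply Rdiv_lt_0_compat; lra).
set (kappa := (Rcpow (2 * x ^ 2) (RtoC (- 1 / 2) + alpha) * RtoC (/ (2 * sqrt PI)))%C).
set (F := fun s => (Cexp (nu * RtoC s) * eta alpha x s)%C).
set (H := fun s => (Ccosh (nu * RtoC s) * eta alpha x s)%C).
assert (EF : forall s, (kappa * kern0 alpha nu w0 w1 w2 z s)%C = F s).
{ intros s. symmetry. by apply Cexp_eta_kern0. }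
assert (HF : is_clint F (Wbold alpha nu x)).
{ rewrite (Wbold_integral alpha nu w0 w1 w2) //. apply (is_clint_ext _ _ _ EF).
  apply is_clint_scal, loc_decays_is_clint; auto. by apply kern0_decays. }
assert (CF : forall s, Ccont F s).
{ intros s. apply (Ccont_ext _ _ _ EF). apply Ccont_mult; [apply Ccont_const|]. by apply kern0_decays. }
destruct (proj2 (kern0_decays alpha nu w0 w1 w2 Hw) z z Hz) as [K [_ HK]].
assert (BF : forall s, Cmod (F s) <= Cmod kappa * K * exp (- Rabs s)).
{ intros s. rewrite -EF Cmod_mult Rmult_assoc. apply Rmult_le_compat_l; [apply Cmod_ge_0|]. apply HK; lra. }
(* Evenness of [eta] makes the cosh integrand the mean of [F s] and [F (- s)]. It is therefore even
   with the same integral over the line, and it inherits the decay bound. *)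
assert (EH : forall s, (/ 2 * (F s + F (- s)%R))%C = H s).
{ intros s. unfold F, H, Ccosh. rewrite eta_opp RtoC_opp.
  replace (nu * - RtoC s)%C with (- (nu * RtoC s))%C by ring. field. }
assert (CFo : forall s, Ccont (fun t => F (- t)) s).
{ intros s. assert (Ho : continuous (fun t => - t) s) by (apply (continuous_opp (V := R_NormedModule)), continuous_id).
  by apply (Ccont_comp F (fun t => - t)). }
assert (CH : forall s, Ccont H s).
{ intros s. apply (Ccont_ext _ _ _ EH). apply Ccont_mult; [apply Ccont_const|].
  exact (Ccont_plus F (fun t => F (- t)) s (CF s) (CFo s)). }
assert (Hev : forall s, H (- s) = H s).
{ intros s. rewrite -!EH Ropp_involutive. ring. }
assert (DH : decays H).
{ exists (Cmod kappa * K). intros s. rewrite -EH Cmod_mult.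
  assert (T1 := BF s). assert (T2 := BF (- s)). rewrite Rabs_Ropp in T2.
  assert (T3 := Cmod_triangle (F s) (F (- s))).
  rewrite -RtoC_inv; [|lra]. rewrite Cmod_R Rabs_pos_eq; lra. }
assert (HH : is_clint H (Wbold alpha nu x)).
{ apply (is_clint_ext _ _ _ EH).
  replace (Wbold alpha nu x) with (/ 2 * (Wbold alpha nu x + Wbold alpha nu x))%C by field.
  apply is_clint_scal, is_clint_plus; auto.
  destruct HF as [HF1 HF2]. split.
  - apply (is_lint_comp_opp (fun t => Re (F t))); auto. intros u; exact (proj1 (CF u)).
  - apply (is_lint_comp_opp (fun t => Im (F t))); auto. intros u; exact (proj2 (CF u)). }
split; [|split; [|split]].
- apply (ex_lint_Cmod_decays F); auto. by exists (Cmod kappa * K).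
- destruct (ex_lint_Cmod_decays H) as [l Hl]; auto. exists (l / 2).
  apply (is_lint_even (fun s => Cmod (H s))); auto.
  + intros s. by apply Ccont_Cmod.
  + intros s. by rewrite Hev.
- apply is_RInt_gen_C; try apply Rbar_locally_filter; apply HF.
- exists (RtoC (/ 2) * Wbold alpha nu x)%C. split.
  2:{ rewrite RtoC_inv; [|lra]. field. }
  destruct HH as [HH1 HH2].
  apply is_RInt_gen_C; try apply Rbar_locally_filter; try apply at_point_filter.
  + replace (Re (RtoC (/ 2) * Wbold alpha nu x)%C) with (Re (Wbold alpha nu x) / 2) by (rewrite /Re /=; field).
    refine (is_lint_even (fun s => Re (H s)) _ (fun s => proj1 (CH s)) _ HH1).
    intros s. cbv beta. by rewrite Hev.
  + replace (Im (RtoC (/ 2) * Wbold alpha nu x)%C) with (Im (Wbold alpha nu x) / 2) by (rewrite /Im /=; field).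
    refine (is_lint_even (fun s => Im (H s)) _ (fun s => proj2 (CH s)) _ HH2).
    intros s. cbv beta. by rewrite Hev.
Qed.
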